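(* Let $E$ be a real Banach space, $H$ a real separable Hilbert space, $S=(S(t))_{t\ge 0}$ a $C_0$-semigroup on $E$, $B\in\mathscr{L}(H,E)$ a bounded linear operator and $W_H$ an $H$-cylindrical Brownian motion. Assume that $s\mapsto S(s)B$ is stochastically integrable with respect to $W_H$ on every interval $[0,T]$. Let $t>0$, $x\in E$, $\xi\in\mathscr{D}_t$, let $a\in W^{1,\infty}(0,t)$ satisfy $a(0+)=0$ and $a(t-)=1$, and let $f:E\to\mathbb{R}$ be a bounded Borel function. Then the derivative $D_\xi P_tf(x):=\frac{\mathrm{d}}{\mathrm{d}\varepsilon}\big|_{\varepsilon=0}P_tf(x+\varepsilon\xi)$ satisfies $$|D_\xi P_tf(x)|\le\sqrt{2/\pi}\,\|f\|_\infty\,\|a'\|_{L^\infty(0,t)}\Bigl(\int_0^t\|S(s)\xi\|_{E_B}^2\,\mathrm{d}s\Bigr)^{1/2}.$$ In particular, for $a(s)=s/t$, $$|D_\xi P_tf(x)|\le\frac{\sqrt{2/\pi}}{t}\,\|f\|_\infty\Bigl(\int_0^t\|S(s)\xi\|_{E_B}^2\,\mathrm{d}s\Bigr)^{1/2}.$$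
   Context: $E_B:=\operatorname{Ran}(B)$, equipped with the Hilbert norm transported from $(\operatorname{Ker}B)^\perp\subseteq H$, i.e. $\|Bh\|_{E_B}=\|h\|_H$ for $h\in(\operatorname{Ker}B)^\perp$. For $t>0$ the space of admissible directions is $\mathscr{D}_t:=\{\xi\in E:\ S(\cdot)\xi\in L^2(0,t;E_B)\}$, i.e. $S(s)\xi\in E_B$ for almost all $s\in(0,t)$ and $\int_0^t\|S(s)\xi\|_{E_B}^2\,\mathrm{d}s<\infty$. $a(0+)$, $a(t-)$ denote the one-sided limits at the end points of the (Lipschitz) continuous representative of $a$. $\|f\|_\infty=\sup_{y\in E}|f(y)|$. For $\xi\in\mathscr{D}_t$ and bounded Borel $f$ the derivative $D_\xi P_tf(x)$ exists. An $H$-cylindrical Brownian motion is a family $W_H(t):H\to L^2(\Omega)$, $t\ge 0$, of bounded linear operators such that all vectors $(W_H(t_1)h_1,\dots,W_H(t_N)h_N)$ are centred Gaussian and $\mathbb{E}(W_H(s)g\,W_H(t)h)=(s\wedge t)(g|h)_H$. For a real separable Hilbert space $\mathscr{H}$, an $\mathscr{H}$-isonormal Gaussian process is a bounded linear operator $W:\mathscr{H}\to L^2(\Omega)$ such that all vectors $(Wh_1,\dots,Wh_N)$ are centred Gaussian and $\mathbb{E}(Wg\,Wh)=(g|h)_{\mathscr{H}}$. The formula $W(\mathbf{1}_{(a,b]}\otimes h)=W_H(b)h-W_H(a)h$ extends uniquely to an $L^2(\mathbb{R}_+;H)$-isonormal process $W$; its restriction to $L^2(0,t;H)$ (functions extended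 by zero) is denoted $W_t$. A bounded operator $R:\mathscr{H}\to E$ is $\gamma$-radonifying, $R\in\gamma(\mathscr{H},E)$, if for one (equivalently every) orthonormal basis $(h_n)$ of $\mathscr{H}$ and independent standard Gaussians $(\gamma_n)$ the series $\sum_n\gamma_nRh_n$ converges in $L^2(\Omega;E)$. Given such $R$ and an $\mathscr{H}$-isonormal process $W$, $X_R$ denotes the (a.s. unique) centred $E$-valued Gaussian random variable with $\langle X_R,x^*\rangle=W(R^*x^* )$ for all $x^*\in E^*$. A function $\Phi:\mathbb{R}_+\to\mathscr{L}(H,E)$ is stochastically integrable with respect to $W_H$ if $s\mapsto\langle\Phi(s)h,x^*\rangle$ is square integrable for all $h\in H$, $x^*\in E^*$, and there is $I_\Phi\in\gamma(L^2(\mathbb{R}_+;H),E)$ with $\langle I_\Phi(\mathbf{1}_{[a,b)}\otimes h),x^*\rangle=\int_a^b\langle\Phi(s)h,x^*\rangle\,\mathrm{d}s$ for all $0\le a<b<\infty$, $h\in H$, $x^*\in E^*$; then $\int_0^\infty\Phi\,\mathrm{d}W_H:=X_{I_\Phi}$. Integrability on a finite interval is defined by extending by zero. Stochastic integrability of $s\mapsto S(s)B$ on $[0,t]$ implies that of $s\mapsto S(t-s)B$ on $[0,t]$; the associated $\gamma$-radonifying operator is $R_t:L^2(0,t;H)\to E$, $R_tv=\int_0^tS(t-s)Bv(s)\,\mathrm{d}s$. The stochastic convolution is $W_A(t):=\int_0^tS(t-s)B\,\mathrm{d}W_H(s)=X_{R_t}$ (formed with $W_t$). For $x\in E$ put $U_t^x:=S(t)x+W_A(t)$,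 and for bounded Borel $f:E\to\mathbb{R}$ put $P_tf(x):=\mathbb{E}f(U_t^x)$. *)

(* Defs.v *)
From HB Require Import structures.
From mathcomp Require Import all_boot all_order all_algebra.
From mathcomp Require Import all_classical all_reals all_analysis.

Set Implicit Arguments.
Unset Strict Implicit.
Unset Printing Implicit Defensive.
Import Order.TTheory GRing.Theory Num.Theory.
Import numFieldNormedType.Exports.
Local Open Scope classical_set_scope.
Local Open Scope ring_scope.

HB.mixin Record CompleteNormedModule_isHilbert (R : realType) (H : Type)
    of CompleteNormedModule R H := {
  dotp : {dot H for @idfun R} ;
  sqr_normE : forall h : H, `|h| ^+ 2 = dotp h h
}.

#[short(type="hilbertType")]
HB.structure Definition Hilbert (R : realType) :=
  {H of CompleteNormedModule R H & CompleteNormedModule_isHilbert R H}.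

Definition separable (T : topologicalType) : Prop :=
  exists2 A : set T, countable A & dense A.

Definition borel (T : ptopologicalType) := g_sigma_algebraType (@open T).

(* The topological dual is ranged over by [phi : {linear E -> R^o}] together
   with [continuous phi]. *)

Definition C0_semigroup (R : realType) (E : completeNormedModType R)
    (S : R -> {linear E -> E}) : Prop :=
  [/\ forall s, 0 <= s -> continuous (S s),
      S 0 =1 id,
      forall r s, 0 <= r -> 0 <= s -> S (r + s) =1 S r \o S s
    & forall x, S s x @[s --> 0^'+] --> x].

Section gaussian.
Context d (Omega : measurableType d) (R : realType) (P : probability Omega R).

(* The degenerate case is separate because [normal_prob 0 0] is not the Dirac
   mass at 0 in the library. *)
Definition centred_gaussian (X : Omega -> R) : Prop :=
  measurable_fun setT X /\
  (X = cst 0 %[ae P] \/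
   exists2 sigma : R, 0 < sigma &
     forall A : set R, measurable A -> P (X @^-1` A) = normal_prob 0 sigma A).

Definition centred_gaussian_vector n (X : 'I_n -> Omega -> R) : Prop :=
  forall c : 'I_n -> R, centred_gaussian (fun w => \sum_(i < n) c i * X i w).

Definition independent_seq (g : nat -> Omega -> R) : Prop :=
  forall (s : seq nat) (A : nat -> set R), uniq s ->
    (forall k, measurable (A k)) ->
    P (\bigcap_(k in [set` s]) (g k @^-1` A k)) =
    (\prod_(k <- s) P (g k @^-1` A k))%E.

Definition standard_gaussian_seq (g : nat -> Omega -> R) : Prop :=
  [/\ forall k, measurable_fun setT (g k),
      forall k (A : set R), measurable A ->
        P (g k @^-1` A) = normal_prob 0 1 A
    & independent_seq g].

(* An everywhere defined, Borel measurable version with separable range. *)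
Definition vector_random_variable (E : completeNormedModType R)
    (X : Omega -> E) : Prop :=
  measurable_fun setT (X : Omega -> borel E) /\
  exists2 A : set E, countable A & range X `<=` closure A.

End gaussian.

(** The elements of the Hilbert space [L^2(R_+; H)] are represented by functions [v : R -> H] satisfying [L2 v], of
  which only the restriction to [0, +oo[ matters.  An operator on it is a map
  on such functions; being linear and bounded for the seminorm it depends only
  on the class of its argument modulo almost everywhere equality.  The space
  [L^2(0, t; H)] is the subspace of the functions vanishing outside (0, t). *)

Section L2.
Context (R : realType) (H : hilbertType R).
Local Notation mu := (@lebesgue_measure R).

Definition L2 (v : R -> H) : Prop :=
  measurable_fun (`[0, +oo[ : set R) (v : measurableTypeR R -> borel H) /\
  (\int[mu]_(s in `[0%R, +oo[) (`|v s| ^+ 2)%:E < +oo)%E.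

Definition L2_dotp (u v : R -> H) : R :=
  \int[mu]_(s in `[0, +oo[) dotp (u s) (v s).

Definition L2_norm (v : R -> H) : R := Num.sqrt (L2_dotp v v).

Definition L2_orthonormal_basis (D : set nat) (e : nat -> R -> H) : Prop :=
  [/\ forall k, D k -> L2 (e k),
      forall j k, D j -> D k -> L2_dotp (e j) (e k) = (j == k)%:R
    & forall v, L2 v -> (forall k, D k -> L2_dotp v (e k) = 0) ->
        L2_dotp v v = 0].

Definition L2_bounded_operator (E : completeNormedModType R)
    (T : (R -> H) -> E) : Prop :=
  (forall (c : R) u v, L2 u -> L2 v ->
     T (fun s => c *: u s + v s) = c *: T u + T v) /\
  exists C : R, forall v, L2 v -> `|T v| <= C * L2_norm v.

Definition step (A : set R) (h : H) : R -> H := fun s => \1_A s *: h.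

Definition gamma_radonifying (E : completeNormedModType R)
    (T : (R -> H) -> E) : Prop :=
  L2_bounded_operator T /\
  exists (D : set nat) (e : nat -> R -> H), L2_orthonormal_basis D e /\
  exists (d : measure_display) (Omega : measurableType d)
    (P : probability Omega R) (g : nat -> Omega -> R) (Y : Omega -> E),
  [/\ standard_gaussian_seq P g,
      vector_random_variable Y
    & (\int[P]_w
         (`|\sum_(0 <= k < n | k \in D) g k w *: T (e k) - Y w| ^+ 2)%:E)%E
        @[n --> \oo] --> 0%E].

End L2.

Section stochastic_integral.
Context d (Omega : measurableType d) (R : realType) (P : probability Omega R).
Context (H : hilbertType R) (E : completeNormedModType R).
Local Notation mu := (@lebesgue_measure R).

(* Operators into [L^2(Omega)] are given by representatives, hence linear up to
   almost sure equality; their boundedness is contained in the covariance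
   formula. *)
Definition cylindrical_brownian_motion (WH : R -> H -> Omega -> R) : Prop :=
  [/\ forall t h, 0 <= t -> WH t h \in Lfun P 2%:E,
      forall t (c : R) g h, 0 <= t ->
        WH t (c *: g + h) = (fun w => c * WH t g w + WH t h w) %[ae P],
      forall n (t : 'I_n -> R) (h : 'I_n -> H), (forall i, 0 <= t i) ->
        centred_gaussian_vector P (fun i => WH (t i) (h i))
    & forall s t g h, 0 <= s -> 0 <= t ->
        'E_P[fun w => (WH s g w * WH t h w)%R]%E
          = (Num.min s t * dotp g h)%:E].

Definition isonormal_process (W : (R -> H) -> Omega -> R) : Prop :=
  [/\ forall v, L2 v -> W v \in Lfun P 2%:E,
      forall (c : R) u v, L2 u -> L2 v ->
        W (fun s => c *: u s + v s) = (fun w => c * W u w + W v w) %[ae P],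
      forall n (v : 'I_n -> R -> H), (forall i, L2 (v i)) ->
        centred_gaussian_vector P (fun i => W (v i))
    & forall u v, L2 u -> L2 v ->
        'E_P[fun w => (W u w * W v w)%R]%E = (L2_dotp u v)%:E].

Definition isonormal_extension (WH : R -> H -> Omega -> R)
    (W : (R -> H) -> Omega -> R) : Prop :=
  isonormal_process W /\
  forall (a b : R) h, 0 <= a -> a <= b ->
    W (step `]a, b] h) = (fun w => WH b h w - WH a h w) %[ae P].

(* [g] stands for [T^* phi]. *)
Definition L2_adjoint_at (T : (R -> H) -> E) (phi : E -> R) (g : R -> H) :
    Prop :=
  L2 g /\ forall v, L2 v -> L2_dotp g v = phi (T v).

(* [X] is a version of the random variable [X_T] defined by [T] and [W]. *)
Definition gaussian_variable_of (W : (R -> H) -> Omega -> R)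
    (T : (R -> H) -> E) (X : Omega -> E) : Prop :=
  vector_random_variable X /\
  forall phi : {linear E -> R^o}, continuous phi ->
    centred_gaussian P (phi \o X) /\
    exists2 g, L2_adjoint_at T phi g & phi \o X = W g %[ae P].

(* [I] is the operator [I_Phi]. *)
Definition integral_operator (Phi : R -> {linear H -> E})
    (I : (R -> H) -> E) : Prop :=
  gamma_radonifying I /\
  forall (a b : R) h (phi : {linear E -> R^o}), 0 <= a -> a < b ->
    continuous phi ->
    phi (I (step `[a, b[ h)) = \int[mu]_(s in `[a, b]) (phi (Phi s h) : R).

Definition stochastically_integrable (Phi : R -> {linear H -> E}) : Prop :=
  [/\ forall s, 0 <= s -> continuous (Phi s),
      forall h (phi : {linear E -> R^o}), continuous phi ->
        measurable_fun (`[0, +oo[ : set R)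
          ((fun s => phi (Phi s h)) : measurableTypeR R -> R) /\
        (\int[mu]_(s in `[0%R, +oo[) ((phi (Phi s h) : R) ^+ 2)%:E < +oo)%E
    & exists I, integral_operator Phi I].

Definition stochastic_integral (W : (R -> H) -> Omega -> R)
    (Phi : R -> {linear H -> E}) (X : Omega -> E) : Prop :=
  exists2 I, integral_operator Phi I & gaussian_variable_of W I X.

Definition extend0 (T : R) (Phi : R -> {linear H -> E}) :
    R -> {linear H -> E} :=
  fun s => if s \in `[0, T] then Phi s else (\0 : {linear H -> E}).

Definition stochastic_convolution (S : R -> {linear E -> E})
    (B : {linear H -> E}) (W : (R -> H) -> Omega -> R) (t : R)
    (WA : Omega -> E) : Prop :=
  stochastic_integral W
    (extend0 t (fun s => (S (t - s) \o B : {linear H -> E}))) WA.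

(* [P_t f x] for the given version [WA] of the stochastic convolution. *)
Definition transition (S : R -> {linear E -> E}) (WA : Omega -> E) (t : R)
    (f : E -> R) (x : E) : R :=
  fine 'E_P[fun w => f (S t x + WA w)%R]%E.

End stochastic_integral.

Section admissible.
Context (R : realType) (H : hilbertType R) (E : completeNormedModType R).
Local Notation mu := (@lebesgue_measure R).

(* The preimage of [y] in the orthogonal complement of the kernel of [B] is
   unique when [y] is in the range of [B]; otherwise the value is 0. *)
Definition range_norm (B : {linear H -> E}) (y : E) : R :=
  `|xget 0 [set h | B h = y /\ forall k, B k = 0 -> dotp h k = 0]|.

Definition admissible_direction (S : R -> {linear E -> E})
    (B : {linear H -> E}) (t : R) (xi : E) : Prop :=
  {ae mu, forall s, s \in `]0, t[ -> range B (S s xi)} /\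
  (\int[mu]_(s in `]0%R, t[) (range_norm B (S s xi) ^+ 2)%:E < +oo)%E.

Definition admissible_energy (S : R -> {linear E -> E})
    (B : {linear H -> E}) (t : R) (xi : E) : R :=
  \int[mu]_(s in `]0, t[) (range_norm B (S s xi) ^+ 2).

End admissible.

Definition sup_norm (R : realType) (T : Type) (f : T -> R) : R :=
  sup (range (fun y => `|f y|)).

Section sobolev.
Context (R : realType).
Implicit Types (t l r : R) (a b u : R -> R).
Local Notation mu := (@lebesgue_measure R).

Definition lebesgue_on t := mrestr mu (measurable_itv `]0, t[).

Definition Linfty_norm t u : \bar R := 'N[lebesgue_on t]_+oo[EFin \o u]%E.

Definition Linfty t u : Prop :=
  measurable_fun (`]0, t[ : set R) (u : measurableTypeR R -> R) /\
  (Linfty_norm t u < +oo)%E.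

(* Test functions are only required to be of class C^1, which gives the same
   weak derivatives as smooth ones. *)
Definition test_function t (phi : R -> R) : Prop :=
  [/\ forall s, derivable phi s 1,
      continuous (derive1 phi)
    & exists c e : R, [/\ 0 < c, e < t
        & forall s, s \notin `[c, e] -> phi s = 0]].

(* [a] belongs to [W^{1,oo}(0, t)] and [b] is its weak derivative [a']. *)
Definition sobolev1oo t a b : Prop :=
  [/\ Linfty t a, Linfty t b
    & forall phi, test_function t phi ->
        \int[mu]_(s in `]0, t[) (a s * derive1 phi s) =
        - \int[mu]_(s in `]0, t[) (b s * phi s)].

(* The continuous representative of [a] has limits [l] at 0+ and [r] at t-. *)
Definition boundary_values t a l r : Prop :=
  exists abar : R -> R,
    [/\ {ae mu, forall s, s \in `]0, t[ -> a s = abar s},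
        {in `]0, t[, continuous abar},
        abar s @[s --> 0^'+] --> l
      & abar s @[s --> t^'-] --> r].

End sobolev.

(* Main.v *)
(** Let [T] be the operator of the stochastic convolution [X], so that [X] is
  the image of white noise [W] under [T], and let [v] be a control steering to
  the direction: [T v = S t xi].  With [s] the norm of [v], the variable
  [X - (W v / s ^ 2) S t xi] is independent of [W v], which is Gaussian of
  variance [s ^ 2]: independence is checked on characteristic functionals, and
  a bounded Borel function is reached by Fourier uniqueness.  Replacing [x] by
  [x + h xi] then only shifts the mean of [W v] by [h * s ^ 2], and
  differentiating its Gaussian density gives a derivative bounded by
  [sup |f| * E |W v| = sqrt (2 / pi) * sup |f| * s].

  For a weight [b] of integral 1 on (0, t) the control
  [v s = b s * B^-1 (S s xi)], where [B^-1] is the inverse on the orthogonal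
  complement of the kernel, does steer to [S t xi], since
  [S (t - s) (B (v s)) = b s * S t xi].  Its norm is at most
  [sup |b| * (admissible energy) ^ (1/2)].  Both [b = a'] and [b = 1 / t] have
  integral 1. *)

Require Import Defs.
From HB Require Import structures.
From mathcomp Require Import all_boot all_order all_algebra.
From mathcomp Require Import all_classical all_reals all_analysis.
From mathcomp Require Import measurable_realfun ess_sup_inf.
From mathcomp Require Import ring lra.
Import Order.TTheory GRing.Theory Num.Theory.
Import numFieldNormedType.Exports.
Local Open Scope classical_set_scope.
Local Open Scope ring_scope.
Set Implicit Arguments.
Unset Strict Implicit.
Unset Printing Implicit Defensive.

(** * Norming functionals *)

(** [E] is not assumed separable, so continuous functionals need not generate its Borel sets, and a
    sum of Borel maps need not be Borel. Both difficulties are met by the fact that [X] takes its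
    values in the closure of a countable set: Fourier uniqueness is proved for measures carried by
    such a set, by enlarging a class of weights rather than by an inversion formula, and joint
    measurability is tested on countably many boxes. The operator [T] is prescribed only weakly and
    on steps. Its value at the control is therefore read through adjoints, after [T^* phi] has been
    identified, for almost every [s], with [B^* S(t - s)^* phi]. The inverse of [B] may be
    unbounded, so the control inherits no continuity from the orbit. It is measurable because [B]
    maps the part of a closed ball orthogonal to the kernel onto a closed set. The function [a'] is
    only a weak derivative, so its integral is computed by testing against explicit plateaus. *)

Section hahn_banach.
Context (R : realType) (E : normedModType R).

(** Graphs of functionals below the norm. Such a set is single valued of itself: a vertical
    difference [(0, r)] satisfies r <= 0, and so does its opposite. *)
Let dominated (G : set (E * R)) : Prop :=
  (forall (c : R) p q, G p -> G q -> G (c *: p.1 + q.1, c * p.2 + q.2)) /\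
  (forall p, G p -> p.2 <= `|p.1|).

Let dominated_bigcup (F : set (set (E * R))) :
  F `<=` dominated -> total_on F subset -> dominated (\bigcup_(G in F) G).
Proof.
move=> Fdom Ftot; split=> [c p q [G1 FG1 G1p] [G2 FG2 G2q]|p [G FG Gp]].
- have [G12|G21] := Ftot _ _ FG1 FG2.
  + by exists G2 => //; apply: (Fdom _ FG2).1 => //; exact: G12.
  + by exists G1 => //; apply: (Fdom _ FG1).1 => //; exact: G21.
- exact: (Fdom _ FG).2.
Qed.

Let dominated0 G p : dominated G -> G p -> G (0, 0).
Proof.
move=> [Glin _] Gp; have := Glin (-1) _ _ Gp Gp.
by rewrite scaleN1r mulN1r !addNr.
Qed.

Let dominatedZ G c p : dominated G -> G p -> G (c *: p.1, c * p.2).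
Proof.
move=> Gd Gp; have := Gd.1 c _ _ Gp (dominated0 Gd Gp).
by rewrite /= !addr0.
Qed.

Let dominated_ext (G : set (E * R)) (u : E) : dominated G -> G !=set0 ->
  exists2 G', dominated G' & G `<=` G' /\ exists s, G' (u, s).
Proof.
move=> Gd [p0 Gp0].
(* A value s at [u] keeps the bound exactly when p.2 - |p.1 - u| <= s <= |q.1 + u| - q.2 on the
   graph. The triangle inequality puts every lower constraint below every upper one, and s is the
   supremum of the lower ones. *)
pose lower := [set p.2 - `|p.1 - u| | p in G].
have lowerP p q : G p -> G q -> p.2 - `|p.1 - u| <= `|q.1 + u| - q.2.
  move=> Gp Gq; rewrite lerBrDr addrAC lerBlDr.
  have := Gd.2 _ (Gd.1 1 _ _ Gp Gq); rewrite /= scale1r mul1r => /le_trans; apply.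
  rewrite -[p.1 + q.1](subrKA u) (addrC u) (addrC `|q.1 + u|).
  exact: ler_normD.
have lower_ub p : G p -> ubound lower (`|p.1 + u| - p.2).
  by move=> Gp _ [q Gq <-]; exact: lowerP.
have lower_sup : has_sup lower.
  split; first by exists (p0.2 - `|p0.1 - u|), p0.
  by exists (`|p0.1 + u| - p0.2); exact: lower_ub.
pose s := sup lower.
have s_ge p : G p -> p.2 - `|p.1 - u| <= s.
  by move=> Gp; apply: ub_le_sup; [exact: lower_sup.2 | exists p].
have s_le p : G p -> s <= `|p.1 + u| - p.2.
  by move=> Gp; apply: ge_sup; [exact: lower_sup.1 | exact: lower_ub].
exists [set q | exists2 p, G p & exists c : R, q = (p.1 + c *: u, p.2 + c * s)].
  split=> [c _ _ [p Gp [a ->]] [q Gq [b ->]]|_ [p Gp [c ->]] /=].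
    exists (c *: p.1 + q.1, c * p.2 + q.2); first exact: Gd.1.
    exists (c * a + b) => /=; congr pair; last by ring.
    by rewrite scalerDr scalerDl scalerA addrACA.
  (* Scaling reduces to coefficients 1 and -1: for c > 0 the upper constraint is used at p / c, for
     c < 0 the lower one at p / (- c). *)
  have [c0|c0|->] := ltgtP c 0; last first.
  - by rewrite scale0r mul0r !addr0; exact: Gd.2.
  - have := s_le _ (dominatedZ c^-1 Gd Gp); rewrite /= lerBrDr => sle.
    have := ler_wpM2l (ltW c0) sle.
    rewrite mulrDr mulrA divff ?gt_eqF// mul1r addrC => /le_trans; apply.
    rewrite -{1}(gtr0_norm c0) -normrZ scalerDr scalerA divff ?gt_eqF//.
    by rewrite scale1r.
  - have nc0 : 0 < - c by rewrite oppr_gt0.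
    have := s_ge _ (dominatedZ (- c)^-1 Gd Gp); rewrite /= lerBlDr => sge.
    have := ler_wpM2l (ltW nc0) sge.
    rewrite mulrA divff ?gt_eqF// mul1r mulrDr mulNr addrC -lerBlDr opprK.
    move=> /le_trans; apply.
    rewrite -{1}(gtr0_norm nc0) -normrZ scalerBr scalerA divff ?gt_eqF//.
    by rewrite scale1r scaleNr opprK.
split=> [p Gp|]; first by exists p => //; exists 0; rewrite scale0r mul0r !addr0; case: p Gp.
by exists s, (0, 0); [exact: dominated0 Gp0|exists 1; rewrite scale1r mul1r !add0r].
Qed.

(** Hahn-Banach by Zorn's lemma on graphs. It serves twice: to describe balls by half-spaces, and to
    separate points of [E]. *)
Lemma norming_functional (x : E) : exists phi : {linear E -> R^o},
  [/\ continuous phi, forall u, `|phi u| <= `|u| & phi x = `|x|].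
Proof.
(* The alternative [G = set0] accommodates the empty chain. Maximality rules it out afterwards,
   since the line spanned by (x, |x|) would be larger. *)
pose P (G : set (E * R)) := dominated G /\ (G = set0 \/ G (x, `|x|)).
have [F FP Ftot|G [[Gd Gx] Gmax]] := Zorn_bigcup (P := P).
  split; first by apply: dominated_bigcup => // G /FP[].
  have [FG|nFG] := pselect (exists2 G, F G & G (x, `|x|)).
    by right; case: FG => G FG Gx; exists G.
  left; rewrite -subset0 => p [G FG Gp].
  have [_ [G0|Gx]] := FP _ FG; first by rewrite G0 in Gp.
  by apply: nFG; exists G.
have {}Gx : G (x, `|x|).
  case: Gx => // G0; exfalso; apply: (Gmax [set p | exists c, p = (c *: x, c * `|x|)]).
    rewrite G0; split=> // /(_ (0, 0)); apply.
    by exists 0; rewrite scale0r mul0r.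
  split; last by right; exists 1; rewrite scale1r mul1r.
  split=> [c _ _ [a ->] [b ->]|_ [c ->]] /=.
    by exists (c * a + b); rewrite scalerA mulrA -scalerDl -mulrDl.
  by rewrite normrZ ler_wpM2r// ler_norm.
have Gtot u : exists s, G (u, s).
  have [|G' G'd [GG' [s G's]]] := @dominated_ext _ u Gd; first by exists (x, `|x|).
  have [GE|GE] := pselect (G' `<=` G); first by exists s; exact: GE.
  by exfalso; apply: (Gmax G') => //; split=> //; right; exact: GG'.
have Gfun u s s' : G (u, s) -> G (u, s') -> s = s'.
  have : forall r, G (0, r) -> r <= 0 by move=> r /Gd.2 /=; rewrite normr0.
  move=> Gr Gs Gs'; apply/eqP; rewrite eq_le -subr_le0 -[(_ <= s)]subr_le0.
  have := Gd.1 (-1) _ _ Gs Gs'; have := Gd.1 (-1) _ _ Gs' Gs.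
  rewrite /= !scaleN1r !mulN1r !addNr addrC => /Gr ->.
  by rewrite addrC => /Gr ->.
pose phi (u : E) : R^o := xget 0 [set s | G (u, s)].
have phiG u : G (u, phi u) by have [s Gs] := Gtot u; exact: (@xgetI _ 0 [set s | G (u, s)] s).
have phi_lin : linear phi.
  by move=> c u v; apply: Gfun (phiG _) _; exact: (Gd.1 c _ _ (phiG u) (phiG v)).
pose phi_aux := GRing.isLinear.Build _ _ _ _ phi phi_lin.
pose phiL : {linear E -> R^o} := HB.pack phi phi_aux.
have phi_le u : `|phi u| <= `|u|.
  rewrite ler_norml (Gd.2 _ (phiG u) : phi u <= `|u|) andbT lerNl -(normrN u).
  have -> : - phi u = phi (- u) by exact/esym/(linearN phiL).
  exact: (Gd.2 _ (phiG (- u))).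
exists phiL; split=> //; last exact: Gfun (phiG x) Gx.
apply/bounded_linear_continuous/linear_boundedP.
by near=> r => u; rewrite (le_trans (phi_le u))// ler_peMl.
Unshelve. all: end_near. Qed.

End hahn_banach.

(** * Bounded measurable functions under a finite measure *)

Section bounded_measurable.
Context d (T : measurableType d) (R : realType).
Implicit Types (f g : T -> R).

Definition bounded_measurable f :=
  measurable_fun setT f /\ exists M, forall x, `|f x| <= M.

Lemma bounded_measurable_cst (c : R) : bounded_measurable (fun=> c).
Proof. by split=> //; exists `|c|. Qed.

Lemma bounded_measurableM f g : bounded_measurable f -> bounded_measurable g ->
  bounded_measurable (fun x => f x * g x).
Proof.
move=> [mf [M fM]] [mg [N gN]]; split; first exact: measurable_funM.
by exists (M * N) => x; rewrite normrM ler_pM.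
Qed.

Lemma bounded_measurable_lin (c : R) f g :
  bounded_measurable f -> bounded_measurable g ->
  bounded_measurable (fun x => c * f x + g x).
Proof.
move=> [mf [M fM]] [mg [N gN]]; split.
  by apply: measurable_funD => //; exact: measurable_funM.
exists (`|c| * M + N) => x; rewrite (le_trans (ler_normD _ _))// lerD//.
by rewrite normrM ler_wpM2l.
Qed.

Lemma bounded_measurable_comp (h : R -> R) f : continuous h ->
  (exists M, forall x, `|h x| <= M) -> measurable_fun setT f ->
  bounded_measurable (fun x => h (f x)).
Proof.
move=> ch [M hM] mf; split; last by exists M.
by apply: measurableT_comp => //; exact: continuous_measurable_fun.
Qed.

Lemma bounded_measurable_indic (A : set T) : measurable A ->
  bounded_measurable (\1_A : T -> R).
Proof.
move=> mA; split; first exact: measurable_indic.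
by exists 1 => x; rewrite indicE; case: (_ \in _); rewrite ?normr0 ?normr1.
Qed.

Context (m : {finite_measure set T -> \bar R}).

Lemma bounded_measurable_integrable f : bounded_measurable f ->
  m.-integrable setT (EFin \o f).
Proof.
move=> [mf [M fM]]; apply: measurable_bounded_integrable => //.
  by rewrite -ge0_fin_numE// fin_num_measure.
exists M; split; first exact: num_real.
by move=> x Mx y _; rewrite /= (le_trans (fM y))// ltW.
Qed.

Lemma Rintegral_lin (c : R) f g : bounded_measurable f -> bounded_measurable g ->
  \int[m]_x (c * f x + g x) = c * \int[m]_x f x + \int[m]_x g x.
Proof.
move=> bf bg; rewrite RintegralD//; last 2 first.
- have := bounded_measurable_integrable (bounded_measurable_lin c bf (bounded_measurable_cst 0)).
  by under eq_fun do rewrite /= addr0.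
- exact: bounded_measurable_integrable.
by rewrite RintegralZl//; exact: bounded_measurable_integrable.
Qed.

Lemma bounded_cvg_Rintegral (f_ : nat -> T -> R) f (M : R) :
  (forall n, measurable_fun setT (f_ n)) -> (forall n x, `|f_ n x| <= M) ->
  (forall x, f_ n x @[n --> \oo] --> f x) ->
  \int[m]_x f_ n x @[n --> \oo] --> \int[m]_x f x.
Proof.
move=> mf_ fM cf.
have mf : measurable_fun setT f by apply: (@measurable_fun_cvg _ _ _ setT f_) => // x _; exact: cf.
have bM : m.-integrable setT (EFin \o cst M).
  exact/bounded_measurable_integrable/bounded_measurable_cst.
have fle x : `|f x| <= M.
  have : `|f_ n x| @[n --> \oo] --> `|f x| by exact: cvg_norm.
  by move/cvg_lim => <-//; apply: limr_le; [apply: is_cvg_norm; apply/cvg_ex; eexists; exact: cf|exact: nearW].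
apply: fine_cvg; rewrite /= fineK; last first.
  apply: integrable_fin_num => //; apply: bounded_measurable_integrable.
  by split=> //; exists M.
apply: (@dominated_cvg _ _ _ m setT measurableT _ _ (EFin \o cst M)) => //.
- by move=> n; exact/measurable_EFinP.
- by move=> x _; apply/fine_cvgP; split; [exact: nearW|exact: cf].
- by move=> n x _; rewrite lee_fin.
Qed.

End bounded_measurable.

(** * Fourier uniqueness for Borel measures *)

Section indicator_by_polynomials.
Context (R : realType).

Lemma bernoulli_le (y : R) n : -1 <= y -> 1 + n%:R * y <= (1 + y) ^+ n.
Proof.
move=> y1; elim: n => [|n IH]; first by rewrite mul0r addr0 expr0.
rewrite exprS; apply: le_trans (ler_wpM2l _ IH); last by rewrite -lerBlDl sub0r.
have : 0 <= n%:R * y ^+ 2 by rewrite mulr_ge0// sqr_ge0.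
rewrite -natr1; nra.
Qed.

(** Half of the decay pays for the factor n: with s = sqrt q and h = 1/s - 1, Bernoulli gives n h <=
    s^(-n), hence n q^n <= s^n / h. *)
Lemma cvg_natrX (q : R) : 0 <= q < 1 -> n%:R * q ^+ n @[n --> \oo] --> 0.
Proof.
rewrite le_eqVlt => /andP[/orP[/eqP <- _|q0 q1]].
  apply: cvg_near_cst; near=> n; rewrite expr0n gtn_eqF ?mulr0//.
  by near: n; exact: nbhs_infty_gt.
pose s := Num.sqrt q; have s0 : 0 < s by rewrite sqrtr_gt0.
have s1 : s < 1 by rewrite -sqrtr1 ltr_sqrt.
pose h := s^-1 - 1; have h0 : 0 < h by rewrite subr_gt0 invf_gt1.
apply: (@squeeze_cvgr _ _ _ _ (cst 0) (fun n => h^-1 * s ^+ n)).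
- near=> n; rewrite mulr_ge0 ?exprn_ge0 ?(ltW q0)//=.
  have -> : q = s * s by rewrite -expr2 sqr_sqrtr ?ltW.
  rewrite exprMn mulrA ler_wpM2r ?exprn_ge0 ?(ltW s0)//.
  rewrite -ler_pdivlMr ?exprn_gt0// -ler_pdivrMl ?invr_gt0// invrK -exprVn.
  have -> : s^-1 = 1 + h by rewrite /h addrC subrK.
  by apply: (le_trans _ (bernoulli_le n _)); lra.
- exact: cvg_cst.
- rewrite -(mulr0 h^-1); apply: cvgMr; apply: cvg_expr.
  by rewrite ger0_norm ?ltW.
Unshelve. all: end_near. Qed.

(* The factor [n] in the outer exponent makes the limit at [w = 1/2] vanish. *)
Lemma cvg_half_indic (w : R) : 0 <= w <= 1 ->
  (1 - w ^+ n) ^+ (n * 2 ^ n) @[n --> \oo] --> ((w < 2^-1)%R%:R : R).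
Proof.
move=> /andP[w0 w1].
have wn n : 0 <= w ^+ n <= 1 by rewrite exprn_ge0// exprn_ile1.
have wE n : (n * 2 ^ n)%:R * w ^+ n = n%:R * (2 * w) ^+ n.
  by rewrite natrM natrX exprMn mulrA.
have [wh|wh] := ltP w 2^-1.
  apply: (@squeeze_cvgr _ _ _ _ (fun n => 1 - n%:R * (2 * w) ^+ n) (cst 1)).
  - near=> n; have /andP[wn0 wn1] := wn n.
    rewrite exprn_ile1 ?subr_ge0 ?gerBl// andbT -wE -mulrN.
    by apply: bernoulli_le; rewrite lerN2.
  - rewrite -[X in _ --> X]subr0; apply: cvgB; first exact: cvg_cst.
    by apply: cvg_natrX; rewrite mulr_ge0//= -ltr_pdivlMl// mulr1.
  - exact: cvg_cst.
apply: (@squeeze_cvgr _ _ _ _ (cst 0) (@harmonic R)).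
- near=> n; have /andP[wn0 wn1] := wn n.
  rewrite exprn_ge0 ?subr_ge0//=.
  (* From (1 - y)(1 + y) <= 1 and Bernoulli with exponent N = n 2^n, the quantity is at most 1 / (1
     + N w^n). Here N w^n = n (2w)^n >= n, because 2w >= 1. *)
  apply: (@le_trans _ _ ((1 + w ^+ n) ^+ (n * 2 ^ n))^-1).
    rewrite -[leRHS]mul1r ler_pdivlMr; last by rewrite exprn_gt0 ?ltr_pwDl.
    rewrite -exprMn exprn_ile1//; last by nra.
    by rewrite mulr_ge0 ?subr_ge0 ?addr_ge0.
  rewrite /harmonic lef_pV2 ?posrE ?exprn_gt0 ?ltr_pwDl//.
  rewrite -natr1 addrC.
  apply: (le_trans _ (bernoulli_le _ _)); last by rewrite (le_trans _ wn0).
  rewrite wE lerD2l ler_peMr// exprn_ege1//.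
  by rewrite -ler_pdivrMl// mulr1.
- exact: cvg_cst.
- exact: cvg_harmonic.
Unshelve. all: end_near. Qed.

End indicator_by_polynomials.

Section multipliers.
Context d (T : measurableType d) (R : realType).
Context (m1 m2 : {finite_measure set T -> \bar R}) (L : set (T -> R)).
Hypothesis L_measurable : forall l, L l -> measurable_fun setT l.
Hypothesis L_lin : forall (c : R) k l, L k -> L l -> L (fun x => k x + c * l x).

(* The weights whose product preserves the equality of the two Fourier transforms
   form an algebra closed under bounded limits; it contains the cosines, hence
   the indicators of half-spaces and of the Borel sets they generate. *)
Definition fourier_matched (V : T -> R) := bounded_measurable V /\
  forall th l, L l ->
    \int[m1]_x (V x * cos (th + l x)) = \int[m2]_x (V x * cos (th + l x)).

Definition multiplier (w : T -> R) := bounded_measurable w /\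
  forall V, fourier_matched V -> fourier_matched (fun x => V x * w x).

Let bounded_measurable_cos th l : L l ->
  bounded_measurable (fun x => cos (th + l x)).
Proof.
move=> Ll; apply: (@bounded_measurable_comp _ _ _ (fun r => cos (th + r))).
- move=> r; apply: continuous_comp; last exact: continuous_cos.
  by apply: cvgD; [exact: cvg_cst|exact: cvg_id].
- by exists 1 => r; exact: cos_max.
- exact: L_measurable.
Qed.

Let fourier_matched_lin (c : R) V V' : fourier_matched V -> fourier_matched V' ->
  fourier_matched (fun x => c * V x + V' x).
Proof.
move=> [bV VE] [bV' V'E]; split; first exact: bounded_measurable_lin.
move=> th l Ll.
have bc := bounded_measurable_cos th Ll.
under eq_Rintegral do rewrite mulrDl -mulrA.
under [RHS]eq_Rintegral do rewrite mulrDl -mulrA.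
by rewrite !Rintegral_lin ?VE ?V'E//; exact: bounded_measurableM.
Qed.

Lemma multiplier_cst (c : R) : multiplier (fun=> c).
Proof.
split; first exact: bounded_measurable_cst.
move=> V VE; have VE0 : fourier_matched (fun=> 0).
  split; first exact: bounded_measurable_cst.
  move=> th l Ll; under eq_Rintegral do rewrite mul0r.
  under [RHS]eq_Rintegral do rewrite mul0r.
  by rewrite !Rintegral_cst// !mul0r.
have := fourier_matched_lin c VE VE0.
by under eq_fun do rewrite addr0 mulrC.
Qed.

Lemma multiplierM w w' : multiplier w -> multiplier w' ->
  multiplier (fun x => w x * w' x).
Proof.
move=> [bw wE] [bw' w'E]; split; first exact: bounded_measurableM.
by move=> V /wE /w'E; under eq_fun do rewrite -mulrA.
Qed.

Lemma multiplier_lin (c : R) w w' : multiplier w -> multiplier w' ->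
  multiplier (fun x => c * w x + w' x).
Proof.
move=> [bw wE] [bw' w'E]; split; first exact: bounded_measurable_lin.
move=> V VE; have := fourier_matched_lin c (wE _ VE) (w'E _ VE).
by under eq_fun do rewrite mulrCA -mulrDr.
Qed.

Lemma multiplierX w n : multiplier w -> multiplier (fun x => w x ^+ n).
Proof.
move=> wE; elim: n => [|n IH]; first by under eq_fun do rewrite expr0; exact: multiplier_cst.
by under eq_fun do rewrite exprS; exact: multiplierM.
Qed.

Lemma multiplier_cvg (w_ : nat -> T -> R) w M : (forall n, multiplier (w_ n)) ->
  (forall n x, `|w_ n x| <= M) -> (forall x, w_ n x @[n --> \oo] --> w x) ->
  multiplier w.
Proof.
move=> w_E wM cw.
have bw : bounded_measurable w.
  split.
    apply: (@measurable_fun_cvg _ _ _ setT w_) => [n|x _]; last exact: cw.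
    exact: (w_E n).1.1.
  exists M => x; have : `|w_ n x| @[n --> \oo] --> `|w x| by exact: cvg_norm.
  move/cvg_lim => <-//; apply: limr_le; last exact: nearW.
  by apply: is_cvg_norm; apply/cvg_ex; eexists; exact: cw.
split=> // V VE; split; first exact: bounded_measurableM VE.1 bw.
move=> th l Ll; have bc := bounded_measurable_cos th Ll.
have [_ [N VN]] := VE.1.
have cvg_int (m : {finite_measure set T -> \bar R}) :
    \int[m]_x (V x * w_ n x * cos (th + l x)) @[n --> \oo] -->
    \int[m]_x (V x * w x * cos (th + l x)).
  apply: (@bounded_cvg_Rintegral _ _ _ _ _ _ (N * M)).
  - by move=> n; have [] := bounded_measurableM (bounded_measurableM VE.1 (w_E n).1) bc.
  - move=> n x; rewrite !normrM -[leRHS]mulr1.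
    by rewrite ler_pM ?mulr_ge0 ?ler_pM ?cos_max.
  - move=> x; apply: cvgM; last exact: cvg_cst.
    by apply: cvgM; [exact: cvg_cst|exact: cw].
rewrite -(cvg_lim _ (cvg_int m1))// -(cvg_lim _ (cvg_int m2))//.
by congr (lim (_ @ \oo)); apply/funext => n; apply: ((w_E n).2 V VE).2.
Qed.

(** Product-to-sum: multiplying by one more cosine gives two cosines whose functionals are a sum and
    a difference, again in [L]. The free phase in [fourier_matched] absorbs the new phases. *)
Lemma multiplier_cos th l : L l -> multiplier (fun x => cos (th + l x)).
Proof.
move=> Ll; split; first exact: bounded_measurable_cos.
move=> V [bV VE]; split; first exact/bounded_measurableM/bounded_measurable_cos.
move=> th' l' Ll'.
have E x : V x * cos (th + l x) * cos (th' + l' x) =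
    2^-1 * (V x * cos (th + th' + (l x + 1 * l' x))) +
    2^-1 * (V x * cos (th' - th + (l' x + (-1) * l x))).
  have -> : th + th' + (l x + 1 * l' x) = (th' + l' x) + (th + l x) by ring.
  have -> : th' - th + (l' x + (-1) * l x) = (th' + l' x) - (th + l x) by ring.
  by move: (th + l x) (th' + l' x) => p q; rewrite cosD cosB; field.
under eq_Rintegral do rewrite E; under [RHS]eq_Rintegral do rewrite E.
have b1 := bounded_measurableM bV (bounded_measurable_cos (th + th') (L_lin 1 Ll Ll')).
have b2 := bounded_measurableM bV (bounded_measurable_cos (th' - th) (L_lin (-1) Ll' Ll)).
have b2' : bounded_measurable
    (fun x => 2^-1 * (V x * cos (th' - th + (l' x + (-1) * l x)))).
  by apply: bounded_measurableM b2; exact: bounded_measurable_cst.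
rewrite !(Rintegral_lin _ _ b1 b2').
have b0 := @bounded_measurable_cst _ T R 0.
under [X in _ + X]eq_Rintegral do rewrite -[_ * (V _ * _)]addr0.
under [X in _ = _ + X]eq_Rintegral do rewrite -[_ * (V _ * _)]addr0.
rewrite !(Rintegral_lin _ _ b2 b0) !Rintegral_cst// !mul0r.
by rewrite (VE _ _ (L_lin 1 Ll Ll')) (VE _ _ (L_lin (-1) Ll' Ll)).
Qed.

Lemma multiplier_lt_half w : multiplier w -> (forall x, 0 <= w x <= 1) ->
  multiplier (fun x => (w x < 2^-1)%R%:R).
Proof.
move=> wE w01.
apply: (@multiplier_cvg (fun n x => (1 - w x ^+ n) ^+ (n * 2 ^ n)) _ 1).
- move=> n; apply: multiplierX.
  under eq_fun do rewrite addrC -mulN1r.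
  by apply: multiplier_lin; [exact: multiplierX|exact: multiplier_cst].
- move=> n x; have /andP[w0 w1] := w01 x.
  rewrite normrX exprn_ile1// ger0_norm ?subr_ge0 ?exprn_ile1//.
  by rewrite gerBl exprn_ge0.
- by move=> x; exact: cvg_half_indic.
Qed.

(* For [c > 0] small, [l x > a] amounts to [sin (c * (a - l x)) < 0]. *)
Lemma multiplier_gt a l : L l -> multiplier (fun x => (a < l x)%R%:R).
Proof.
move=> Ll.
pose u (n : nat) x := (a - l x) / n.+1%:R.
(* The phase pi / 2 turns the cosine into a sine. The functional l / (n + 1) is written as l + (1 /
   (n + 1) - 1) l to have the shape produced by [L_lin]. *)
have E (n : nat) x : cos (pi / 2 + - (a / n.+1%:R) + (l x + (n.+1%:R^-1 - 1) * l x)) = sin (u n x).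
  rewrite -cosBpihalf -cosN; congr cos; rewrite /u; ring.
apply: (@multiplier_cvg (fun n x => ((1 + sin (u n x)) / 2 < 2^-1)%R%:R) _ 1).
- move=> n; apply: multiplier_lt_half.
    under eq_fun do rewrite mulrDl addrC mulrC -E.
    apply: multiplier_lin; last exact: multiplier_cst.
    exact/multiplier_cos/L_lin.
  by move=> x; have := sin_geN1 (u n x); have := sin_le1 (u n x); lra.
- by move=> n x; case: (_ < _); rewrite ?normr1 ?normr0.
- move=> x; apply: cvg_near_cst; near=> n; congr ((nat_of_bool _)%:R).
  suff -> : ((1 + sin (u n x)) / 2 < 2^-1) = (sin (u n x) < 0).
    have n0 : 0 < n.+1%:R^-1 :> R by rewrite invr_gt0.
    have un : `|u n x| < pi.
      rewrite /u normrM normfV (@ger0_norm _ n.+1%:R)// ltr_pdivrMr//.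
      rewrite -ltr_pdivrMl ?pi_gt0// -natr1 ltr_wpDr//.
      by near: n; exact: nbhs_infty_gtr.
    have [al|la|al] := ltgtP a (l x).
    - rewrite -oppr_gt0 -sinN sin_gt0_pi//; apply/andP; split.
        by rewrite oppr_gt0 /u pmulr_llt0 ?subr_lt0.
      by rewrite (le_lt_trans _ un)// ler_normr lexx orbT.
    - apply/negbTE; rewrite -leNgt sin_ge0_pi//; apply/andP; split.
        by rewrite /u mulr_ge0// ?subr_ge0 ltW.
      by rewrite (le_trans (ler_norm _))// ltW.
    - by rewrite /u al subrr mul0r sin0 ltxx.
  by apply/idP/idP; lra.
Unshelve. all: end_near. Qed.

End multipliers.

(** * Borel sets and the sigma-algebra of multiplier sets *)

Lemma countable_range (T : pointedType) (A : set T) : countable A ->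
  exists e : nat -> T, A `<=` range e.
Proof.
move=> /countable_injP[f finj].
exists (fun n => xget point [set x | A x /\ f x = n]) => x Ax.
exists (f x) => //; have [Ay fy] : [set y | A y /\ f y = f x] (xget point [set y | A y /\ f y = f x]).
  by apply: (@xgetI _ _ _ x); split.
by apply: finj => //; exact: mem_set.
Qed.

Lemma borel_measurableP d (T : measurableType d) (X : ptopologicalType) (D : set T)
    (f : T -> X) :
  (forall U, open U -> measurable (D `&` f @^-1` U)) ->
  measurable_fun D (f : T -> borel X).
Proof.
move=> fU; apply: (@measurability _ _ T (borel X) D f open) => //.
by move=> _ [U oU <-]; exact: fU.
Qed.

Lemma open_borel (X : ptopologicalType) (U : set X) : open U -> measurable (U : set (borel X)).
Proof. by move=> oU; exact: sub_sigma_algebra. Qed.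

Lemma closed_borel (X : ptopologicalType) (F : set X) : closed F -> measurable (F : set (borel X)).
Proof.
move=> cF; rewrite -(setCK F); apply: measurableC; apply: open_borel.
exact: closed_openC.
Qed.

Lemma continuous_borel_fun (X Y : ptopologicalType) (h : X -> Y) : continuous h ->
  measurable_fun setT (h : borel X -> borel Y).
Proof.
move=> ch; apply: borel_measurableP => U oU; rewrite setTI; apply: open_borel.
by move/continuousP : ch; apply.
Qed.

Lemma continuous_borel_real (X : ptopologicalType) (R : realType) (h : X -> R) :
  continuous h -> measurable_fun setT (h : borel X -> R).
Proof.
move=> ch; apply: (measurability _ (RGenOInfty.measurableE R)) => _ [_ [a ->] <-].
rewrite setTI; apply: open_borel.
by move/continuousP : ch; apply; exact: interval_open.
Qed.

Section multiplier_sets.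
Context d (T : measurableType d) (R : realType).
Context (m1 m2 : {finite_measure set T -> \bar R}) (L : set (T -> R)).
Hypothesis L_measurable : forall l, L l -> measurable_fun setT l.
Hypothesis L_lin : forall (c : R) k l, L k -> L l -> L (fun x => k x + c * l x).

Definition multiplier_set (A : set T) :=
  measurable A /\ multiplier m1 m2 L (\1_A : T -> R).

(** Complements come from 1 - w and intersections from products. The indicators of the partial
    unions are eventually constant at each point and bounded by 1, so their limit is a
    multiplier. *)
Lemma multiplier_set_sigma_algebra : sigma_algebra setT multiplier_set.
Proof.
have mC A : multiplier_set A -> multiplier_set (setT `\` A).
  move=> [mA AE]; split; first exact: measurableD.
  have := multiplier_lin L_measurable (-1) AE (multiplier_cst m1 m2 L_measurable 1).
  congr multiplier; apply/funext => x; rewrite setTD !indicE in_setC.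
  by case: (x \in A) => /=; rewrite ?mulr0 ?add0r// mulr1 addNr.
have mI A B : multiplier_set A -> multiplier_set B -> multiplier_set (A `&` B).
  move=> [mA AE] [mB BE]; split; first exact: measurableI.
  have := multiplierM AE BE; congr multiplier; apply/funext => x.
  by rewrite !indicE in_setI -natrM mulnb.
have mU A B : multiplier_set A -> multiplier_set B -> multiplier_set (A `|` B).
  move=> AE BE; rewrite -[_ `|` _]setCK setCU -!setTD.
  by apply: (mC); apply: mI; exact: mC.
split=> [||A AE]; [|exact: mC|].
  split=> //; have := multiplier_cst m1 m2 L_measurable 0; congr multiplier.
  by apply/funext => x; rewrite indic0.
have bigA n : multiplier_set (\big[setU/set0]_(i < n) A i).
  elim: n => [|n IH]; last by rewrite big_ord_recr; exact: mU.
  rewrite big_ord0; split=> //; have := multiplier_cst m1 m2 L_measurable 0; congr multiplier.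
  by apply/funext => x; rewrite indic0.
split; first by apply: bigcup_measurable => k _; have [] := AE k.
apply: (@multiplier_cvg _ _ _ m1 m2 _ L_measurable
  (fun n => \1_(\big[setU/set0]_(i < n) A i)) _ 1) => [n|n x|x].
- exact: (bigA n).2.
- by rewrite indicE; case: (_ \in _); rewrite ?normr0 ?normr1.
- apply: cvg_near_cst; rewrite !indicE.
  have [[k _ Akx]|nAx] := pselect ((\bigcup_k A k) x).
    near=> n; congr ((nat_of_bool _)%:R); rewrite !mem_set//; first by exists k.
    rewrite -bigcup_mkord; exists k => //=; near: n; exact: nbhs_infty_gt.
  near=> n; congr ((nat_of_bool _)%:R); rewrite !memNset//.
  by rewrite -bigcup_mkord => -[k _ Akx]; apply: nAx; exists k.
Unshelve. all: end_near. Qed.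

(** A weight vanishing off a common null set makes both integrals zero. This disposes of the part of
    a Borel set lying outside the separable carrier. *)
Lemma multiplier_set_null A : measurable A -> m1 A = 0%E -> m2 A = 0%E ->
  multiplier_set A.
Proof.
move=> mA A1 A2; split=> //; split; first exact: bounded_measurable_indic.
move=> V [bV VE]; split.
  by apply: bounded_measurableM => //; exact: bounded_measurable_indic.
move=> th l Ll; suff int0 (m : {finite_measure set T -> \bar R}) : m A = 0%E ->
    \int[m]_x (V x * \1_A x * cos (th + l x)) = 0 by rewrite !int0.
move=> mA0; rewrite /Rintegral (_ : (\int[m]_x _)%E = 0%E)//.
rewrite (negligible_integral mA)//; last first.
  apply: bounded_measurable_integrable; apply: bounded_measurableM.
    by apply: bounded_measurableM => //; exact: bounded_measurable_indic.
  apply: (@bounded_measurable_comp _ _ _ (fun r => cos (th + r))).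
  - move=> r; apply: continuous_comp; last exact: continuous_cos.
    by apply: cvgD; [exact: cvg_cst|exact: cvg_id].
  - by exists 1 => r; exact: cos_max.
  - exact: L_measurable.
apply: integral0_eq => x [_ nAx].
by rewrite indicE memNset// mulr0 mul0r.
Qed.

Lemma multiplier_set_gt a l : L l -> multiplier_set [set x | a < l x].
Proof.
move=> Ll; split.
  have -> : [set x | a < l x] = setT `&` l @^-1` `]a, +oo[.
    by apply/seteqP; split=> x /=; rewrite in_itv/= andbT; [split|case].
  by apply: L_measurable.
have := multiplier_gt m1 m2 L_measurable L_lin a Ll; congr multiplier.
apply/funext => x; rewrite indicE; congr ((nat_of_bool _)%:R).
by apply/idP/idP => [ax|/set_mem]//; exact: mem_set.
Qed.

(** The hypothesis on cosines says that the weight 1 is matched. Multiplying it by the indicator of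
    A and evaluating at phase 0 and functional 0, where the cosine is 1, leaves the two masses. The
    element [l0] only produces the zero functional. *)
Lemma multiplier_set_eq_measure l0 A : L l0 ->
  (forall th l, L l -> \int[m1]_x cos (th + l x) = \int[m2]_x cos (th + l x)) ->
  multiplier_set A -> m1 A = m2 A.
Proof.
move=> L0 cosE [mA [_ AE]].
have L00 : L (fun=> 0).
  by have := L_lin (-1) L0 L0; congr L; apply/funext => x; rewrite mulN1r subrr.
have [|_ /(_ 0 _ L00)] := AE (fun=> 1).
  split; first exact: bounded_measurable_cst.
  move=> th l Ll; under eq_Rintegral do rewrite mul1r.
  by under [RHS]eq_Rintegral do rewrite mul1r; exact: cosE.
under eq_Rintegral do rewrite mul1r addr0 cos0 mulr1.
under [RHS]eq_Rintegral do rewrite mul1r addr0 cos0 mulr1.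
rewrite /Rintegral !integral_indic// !setIT => fineE.
by rewrite -(fineK (fin_num_measure m1 A mA)) fineE fineK// fin_num_measure.
Qed.

End multiplier_sets.

Section fourier_uniqueness.
Context (R : realType) (E : completeNormedModType R).
Context (m1 m2 : {finite_measure set (borel E) -> \bar R}) (e : nat -> E).
Let F := closure (range e).
Hypothesis m1F : m1 (~` F) = 0%E.
Hypothesis m2F : m2 (~` F) = 0%E.
Hypothesis cosE : forall (th : R) (phi : {linear E -> R^o}), continuous phi ->
  \int[m1]_x cos (th + phi x) = \int[m2]_x cos (th + phi x).

Let L : set (borel E -> R) :=
  [set l | exists2 phi : {linear E -> R^o}, continuous phi & l = (phi : E -> R)].

Let L_measurable l : L l -> measurable_fun setT l.
Proof. by move=> [phi cphi ->]; exact: (@continuous_borel_real E R). Qed.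

Let L_lin (c : R) k l : L k -> L l -> L (fun x => k x + c * l x).
Proof.
move=> [phi cphi ->] [psi cpsi ->].
exists (phi \+ (c *: (psi : E -> R^o))) => //.
by move=> x; apply: cvgD; [exact: cphi|apply: cvgZr; exact: cpsi].
Qed.

(** Making the multiplier sets the measurable sets of a type gives access to the general closure
    lemmas for countable operations. *)
Let M := g_sigma_algebraType (multiplier_set m1 m2 L).

Let M_measurableE : @measurable _ M = multiplier_set m1 m2 L.
Proof.
exact/sigma_algebra_id/multiplier_set_sigma_algebra.
Qed.

(** It suffices that open sets are multiplier sets. Within [F], a small closed ball centred at some
    [e i] is a countable intersection of half-spaces, cut out by functionals norming the differences
    [e j - e i]; outside [F] everything is null. *)
Lemma fourier_uniqueness (A : set E) : measurable (A : set (borel E)) ->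
  m1 A = m2 A.
Proof.
have mF : measurable (F : set (borel E)) by apply: (@closed_borel E); exact: closed_closure.
have MF : measurable (F : set M).
  rewrite -(setCK F); apply: measurableC; rewrite M_measurableE.
  by apply: (multiplier_set_null L_measurable) => //; exact: measurableC.
suff sub : @measurable _ (borel E) `<=` multiplier_set m1 m2 L.
  move=> mA; apply: (multiplier_set_eq_measure L_lin (l0 := fun=> 0)).
  - by exists \0 => // x; exact: cvg_cst.
  - by move=> th _ [phi cphi ->]; exact: cosE.
  - exact: sub.
apply: smallest_sub; first exact: (multiplier_set_sigma_algebra _ _ L_measurable).
move=> U oU; rewrite -M_measurableE.
have [phi_ phiP] : exists phi_ : nat -> nat -> {linear E -> R^o}, forall i j,
    [/\ continuous (phi_ i j), forall u, `|phi_ i j u| <= `|u| &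
        phi_ i j (e j - e i) = `|e j - e i|].
  by have /choice[f fP] := fun p : nat * nat => norming_functional (e p.2 - e p.1);
    exists (fun i j => f (i, j)) => i j; exact: (fP (i, j)).
pose K i (n : nat) : set E :=
  \bigcap_j [set x | phi_ i j (x - e i) <= n.+1%:R^-1].
have MK i n : measurable (K i n : set M).
  apply: bigcapT_measurable => j; rewrite -[X in measurable X]setCK.
  apply: measurableC; rewrite M_measurableE.
  have -> : ~` [set x | phi_ i j (x - e i) <= n.+1%:R^-1] =
      [set x | n.+1%:R^-1 + phi_ i j (e i) < phi_ i j x].
    apply/funext => x; apply/propext; rewrite /setC /mkset linearB lerBlDr ltNge.
    by split=> /negP.
  by apply: (multiplier_set_gt _ _ L_measurable L_lin); exists (phi_ i j); have [] := phiP i j.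
(* A point x of [F] is approximated by some [e j] within r / 2. The functional norming [e j - e i]
   then computes |x - e i| up to r from its value at x - e i. *)
have KF i n x : F x -> K i n x <-> `|x - e i| <= n.+1%:R^-1.
  move=> Fx; split=> [Kx|xle j _ /=]; last first.
    by have [_ le _] := phiP i j; rewrite (le_trans (ler_norm _))// (le_trans (le _)).
  apply/ler_addgt0Pr => r r0.
  have [_ [[j _ <-]]] := Fx _ (nbhsx_ballx x (r / 2) ltac:(by rewrite divr_gt0)).
  rewrite -ball_normE /= => xj; have [_ le phiE] := phiP i j.
  have -> : x - e i = (x - e j) + (e j - e i) by rewrite subrKA.
  rewrite (le_trans (ler_normD _ _))// -phiE.
  have -> : e j - e i = (x - e i) - (x - e j) by rewrite opprB [RHS]addrC subrKA.
  rewrite linearB; have /= Kj := Kx j I; have := le (x - e j).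
  rewrite ler_norml => /andP[lej _].
  have gen (p q y N s : R) : p <= N -> y < s / 2 -> - y <= q ->
    y + (p - q) <= N + s by lra.
  exact: gen.
(* Every point of U in [F] lies in one of countably many closed balls contained in U; the remainder
   of U is a null set. *)
have -> : U = (\bigcup_(p in [set p : nat * nat | closed_ball (e p.1) p.2.+1%:R^-1 `<=` U])
    (K p.1 p.2 `&` F)) `|` (U `\` F).
  apply/seteqP; split=> [x Ux|x]; last first.
    move=> [[[i n] /= sub [Kx Fx]]|[]//]; apply: sub.
    by rewrite closed_ballE// /closed_ball_ /= distrC; apply/(KF _ _ _ Fx).
  have [Fx|nFx] := pselect (F x); [left|by right].
  have /nbhs_ballP[r /= r0 rU] : nbhs x U by exact: open_nbhs_nbhs.
  have [n nr] : exists n : nat, n.+1%:R^-1 < r / 2.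
    have r2 : 0 < r / 2 by rewrite divr_gt0.
    by have [n _ /(_ n (leqnn n))] := near_infty_natSinv_lt (PosNum r2); exists n.
  have [_ [[i _ <-] xi]] := Fx _ (nbhsx_ballx x n.+1%:R^-1 ltac:(by [])).
  move: xi; rewrite -ball_normE /= => xi.
  exists (i, n) => /=; last by split=> //; apply/KF => //; exact: ltW.
  move=> y; rewrite closed_ballE// /closed_ball_ /= => yi; apply: rU.
  rewrite -ball_normE /= -(subrKA (e i)) (le_lt_trans (ler_normD _ _))//.
  by rewrite (splitr r) ltrD// ?(lt_trans xi)// (le_lt_trans yi).
apply: measurableU.
  rewrite bigcup_mkcond; apply: countable_bigcupT_measurable => // p.
  by case: ifP => _ //; exact: measurableI.
rewrite M_measurableE; have mUF : measurable (U `\` F : set (borel E)).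
  by apply: measurableD => //; exact: open_borel.
apply: (multiplier_set_null L_measurable) => //.
- exact: (subset_measure0 mUF (measurableC mF) (@subIsetr _ _ _) m1F).
- exact: (subset_measure0 mUF (measurableC mF) (@subIsetr _ _ _) m2F).
Qed.

End fourier_uniqueness.

(** * Gaussian integrals *)

Section lebesgue_invariance.
Context (R : realType).
Local Notation mu := (@lebesgue_measure R).
Local Open Scope ereal_scope.

Lemma lebesgue_measure_translate (c : R) (A : set R) : measurable A ->
  pushforward mu ((fun x => x + c)%R : measurableTypeR R -> measurableTypeR R) A = mu A.
Proof.
move=> mA; apply/esym/lebesgue_measure_unique => //=.
  exact: measurable_funD.
move=> mf _ [[a b]] _ <-.
rewrite /pushforward.
have -> : (fun x => x + c)%R @^-1` `]a, b] = `](a - c)%R, (b - c)%R]%classic.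
  by apply/seteqP; split=> x /=; rewrite !in_itv/= ltrBlDr lerBrDr.
by rewrite /= !lebesgue_measure_itv/= !lte_fin ltrD2r -!EFinB opprB addrA subrK.
Qed.

(** Half-open intervals determine the measure. Reflection moves the closed end to the other side,
    which leaves the length unchanged. *)
Lemma lebesgue_measure_reflect (c : R) (A : set R) : measurable A ->
  pushforward mu ((fun x => c - x)%R : measurableTypeR R -> measurableTypeR R) A = mu A.
Proof.
move=> mA; apply/esym/lebesgue_measure_unique => //=.
  exact: measurable_funB.
move=> mf _ [[a b]] _ <-.
rewrite /pushforward.
have -> : (fun x => c - x)%R @^-1` `]a, b] = `[(c - b)%R, (c - a)%R[%classic.
  by apply/seteqP; split=> x /=; rewrite !in_itv/= => /andP[? ?]; apply/andP; split; lra.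
rewrite /= !lebesgue_measure_itv/= !lte_fin ltrD2l ltrN2 -!EFinB.
by case: ifP => // _; congr EFin; ring.
Qed.

Lemma integral_translate (f : R -> \bar R) (c : R) :
  measurable_fun setT (f : measurableTypeR R -> \bar R) -> (forall x, 0 <= f x) ->
  \int[mu]_x f (x + c)%R = \int[mu]_x f x.
Proof.
move=> mf f0.
transitivity (\int[pushforward mu ((fun x => x + c)%R : measurableTypeR R -> measurableTypeR R)]_x f x).
  by rewrite ge0_integral_pushforward//; exact: measurable_funD.
by apply: eq_measure_integral => [|mphi A mA _]; [exact: measurable_funD | exact: lebesgue_measure_translate].
Qed.

Lemma integral_reflect (f : R -> \bar R) (c : R) :
  measurable_fun setT (f : measurableTypeR R -> \bar R) -> (forall x, 0 <= f x) ->
  \int[mu]_x f (c - x)%R = \int[mu]_x f x.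
Proof.
move=> mf f0.
transitivity (\int[pushforward mu ((fun x => c - x)%R : measurableTypeR R -> measurableTypeR R)]_x f x).
  by rewrite ge0_integral_pushforward//; exact: measurable_funB.
by apply: eq_measure_integral => [|mphi A mA _]; [exact: measurable_funB | exact: lebesgue_measure_reflect].
Qed.

End lebesgue_invariance.

Section Rintegral_invariance.
Context (R : realType).
Local Notation mu := (@lebesgue_measure R).

Lemma Rintegral_translate (f : R -> R) (c : R) : measurable_fun setT f ->
  \int[mu]_x f (x + c) = \int[mu]_x f x.
Proof.
move=> mf; rewrite /Rintegral; congr fine.
have mF : measurable_fun setT (EFin \o f) by exact/measurable_EFinP.
rewrite integralE [in RHS]integralE; congr (_ - _)%E.
- rewrite -(integral_translate c (measurable_funepos mF))//.
  by rewrite (_ : (fun x => (f (x + c))%:E) = (EFin \o f) \o (fun x => x + c))// funepos_comp.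
- rewrite -(integral_translate c (measurable_funeneg mF))//.
  by rewrite (_ : (fun x => (f (x + c))%:E) = (EFin \o f) \o (fun x => x + c))// funeneg_comp.
Qed.

Lemma Rintegral_reflect (f : R -> R) (c : R) : measurable_fun setT f ->
  \int[mu]_x f (c - x) = \int[mu]_x f x.
Proof.
move=> mf; rewrite /Rintegral; congr fine.
have mF : measurable_fun setT (EFin \o f) by exact/measurable_EFinP.
rewrite integralE [in RHS]integralE; congr (_ - _)%E.
- rewrite -(integral_reflect c (measurable_funepos mF))//.
  by rewrite (_ : (fun x => (f (c - x))%:E) = (EFin \o f) \o (fun x => c - x))// funepos_comp.
- rewrite -(integral_reflect c (measurable_funeneg mF))//.
  by rewrite (_ : (fun x => (f (c - x))%:E) = (EFin \o f) \o (fun x => c - x))// funeneg_comp.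
Qed.

End Rintegral_invariance.

Lemma is_derive_unique (R : numFieldType) (V W : normedModType R) (f : V -> W)
  (x v : V) (a b : W) : is_derive x v f a -> is_derive x v f b -> a = b.
Proof. by move=> [_ <-] [_ <-]. Qed.

Lemma is_derive_under_integral d (Y : measurableType d) (R : realType)
    (mu : {measure set Y -> \bar R}) (f f' : R -> Y -> R) (a : R) (G : Y -> R) :
  (forall x, x \in `]a - 1, a + 1[ -> mu.-integrable setT (EFin \o f x)) ->
  (forall x y, x \in `]a - 1, a + 1[ -> is_derive x 1 (f ^~ y) (f' x y)) ->
  mu.-integrable setT (EFin \o G) ->
  (forall x y, x \in `]a - 1, a + 1[ -> `|f' x y| <= G y) ->
  is_derive a 1 (fun x => \int[mu]_y f x y) (\int[mu]_y f' a y).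
Proof.
move=> intf df intG f'G.
have aI : a \in `]a - 1, a + 1[ by rewrite in_itv/=; apply/andP; split; lra.
have dE x y : x \in `]a - 1, a + 1[ -> partial1of2 f x y = f' x y.
  by move=> xI; rewrite partial1of2E; exact: (@derive_val _ _ _ _ _ _ _ (df x y xI)).
have G0 y : 0 <= G y by rewrite (le_trans _ (f'G a y aI)).
have der x y : x \in `]a - 1, a + 1[ -> setT y -> derivable (f ^~ y) x 1.
  by move=> xI _; exact: (@ex_derive _ _ _ _ _ _ _ (df x y xI)).
have ub x y : x \in `]a - 1, a + 1[ -> setT y -> `|partial1of2 f x y| <= G y.
  by move=> xI _; rewrite dE//; exact: f'G.
apply: DeriveDef.
  exact: (@derivable_under_integral _ _ _ mu f setT measurableT a _ _ aI intf der G G0 intG ub).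
rewrite -derive1E (@differentiation_under_integral _ _ _ mu f setT measurableT a _ _ aI intf der G G0 intG ub).
by apply: eq_Rintegral => y _; rewrite dE.
Qed.

Section normal_integrals.
Context (R : realType) (s : R).
Hypothesis s0 : 0 < s.
Local Notation mu := (@lebesgue_measure R).
Local Notation n := (normal_pdf 0 s).

Let sn0 : s != 0. Proof. by rewrite gt_eqF. Qed.

Lemma normal_pdf_expE h x :
  normal_pdf h s x = normal_peak s * expR (- (x - h) ^+ 2 / (s ^+ 2 *+ 2)).
Proof. by rewrite normal_pdfE. Qed.

Lemma normal_pdf_shift h x : normal_pdf h s x = n (x - h).
Proof. by rewrite !normal_pdf_expE subr0. Qed.

Lemma normal_pdfN x : n (- x) = n x.
Proof. by rewrite !normal_pdf_expE !subr0 sqrrN. Qed.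

Lemma is_derive_normal_pdf (h x : R) :
  is_derive x 1 (normal_pdf h s) (- ((x - h) / s ^+ 2) * normal_pdf h s x).
Proof.
have -> : normal_pdf h s = fun x => normal_peak s * expR (- (x - h) ^+ 2 / (s ^+ 2 *+ 2)).
  by apply/funext => y; exact: normal_pdf_expE.
pose q (x : R) := - (x - h) ^+ 2 / (s ^+ 2 *+ 2).
have dq : is_derive x 1 q (- ((x - h) / s ^+ 2)).
  rewrite /q; apply: is_derive_eq.
  by rewrite scaler0 add0r /GRing.scale/=; field.
have de : is_derive x 1 (expR \o q) (expR (q x) * - ((x - h) / s ^+ 2)).
  exact: is_derive1_comp.
have := is_deriveZ (normal_peak s) de.
rewrite mulrCA => dn; apply: is_derive_eq.
by rewrite /GRing.scale/= /q; ring.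
Qed.

(** The density is symmetric in mean and argument, so this is the derivative in the argument with
    the roles exchanged. *)
Lemma is_derive_normal_pdf_mean (h x : R) :
  is_derive h 1 ((normal_pdf (R := R)) ^~ s ^~ x) ((x - h) / s ^+ 2 * normal_pdf h s x).
Proof.
have E m y : normal_pdf m s y = normal_pdf y s m.
  by rewrite !normal_pdf_expE -sqrrN opprB.
have := is_derive_normal_pdf x h; rewrite -[normal_pdf x s h]E.
have -> : normal_pdf x s = (normal_pdf (R := R)) ^~ s ^~ x by apply/funext => y; rewrite E.
by move=> ?; apply: is_derive_eq; rewrite -mulNr opprB.
Qed.

(** One integrable majorant for all means in [-1, 1], with doubled deviation. With u = r - h and x =
    u^2 / (4 s^2) the exponential splits into two factors e^(-x). One absorbs 1 + u^2, since x
    e^(-x) <= 1; the other is compared through u^2 >= r^2 / 2 - h^2, which is a square. *)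
Lemma normal_dominated : exists2 C : R, 0 <= C & forall h r, `|h| <= 1 ->
  (1 + (r - h) ^+ 2) * normal_pdf h s r <= C * normal_pdf 0 (2 * s) r.
Proof.
exists (normal_peak s * (1 + 4 * s ^+ 2) * expR (4 * s ^+ 2)^-1 / normal_peak (2 * s)).
  rewrite divr_ge0 ?normal_peak_ge0// mulr_ge0 ?expR_ge0// mulr_ge0 ?normal_peak_ge0//.
  by rewrite addr_ge0// mulr_ge0// sqr_ge0.
move=> h r h1.
have s20 : 2 * s != 0 by rewrite mulf_neq0.
rewrite (normal_pdfE _ s20) normal_pdf_expE /normal_fun subr0.
rewrite (mulrCA (1 + _)) -!mulrA ler_wpM2l ?normal_peak_ge0//.
rewrite mulKf; last by rewrite gt_eqF// normal_peak_gt0.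
set u := r - h; pose x := u ^+ 2 / (4 * s ^+ 2).
have s2 : 0 < 4 * s ^+ 2 by rewrite mulr_gt0// exprn_gt0.
have -> : - u ^+ 2 / (s ^+ 2 *+ 2) = - x + - x by rewrite /x; field.
have x0 : 0 <= x by rewrite /x divr_ge0 ?sqr_ge0// ltW.
have uE : u ^+ 2 = 4 * s ^+ 2 * x by rewrite /x mulrC divfK// gt_eqF.
have ux : (1 + u ^+ 2) * expR (- x) <= 1 + 4 * s ^+ 2.
  rewrite expRN ler_pdivrMr ?expR_gt0// mulrDl mul1r uE lerD//.
    by rewrite -expR0 ler_expR.
  by rewrite ler_wpM2l ?(ltW s2)// (le_trans _ (expR_ge1Dx _))// lerDr.
rewrite expRD [leLHS]mulrA; apply: ler_pM => //; rewrite ?expR_ge0//.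
  by rewrite mulr_ge0 ?expR_ge0// addr_ge0// sqr_ge0.
rewrite -expRD ler_expR /x.
have -> : - (u ^+ 2 / (4 * s ^+ 2)) = (- u ^+ 2) / (4 * s ^+ 2) by rewrite mulNr.
have -> : (4 * s ^+ 2)^-1 + - r ^+ 2 / ((2 * s) ^+ 2 *+ 2) = (1 - r ^+ 2 / 2) / (4 * s ^+ 2).
  by field.
rewrite ler_wpM2r ?invr_ge0 ?(ltW s2)// /u.
have h2 : h ^+ 2 <= 1 by rewrite -real_normK ?num_real// exprn_ile1.
have : 0 <= (r / 2 - h) ^+ 2 by rewrite sqr_ge0.
nra.
Qed.

Lemma integrable_normal_growth (g : R -> R) (K h : R) : measurable_fun setT g ->
  `|h| <= 1 -> (forall r, `|g r| <= K * (1 + (r - h) ^+ 2)) ->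
  mu.-integrable setT (EFin \o (fun r => g r * normal_pdf h s r)).
Proof.
move=> mg h1 gK; have [C C0 CP] := normal_dominated.
have K0 : 0 <= K.
  have := le_trans (normr_ge0 _) (gK h).
  by rewrite subrr expr0n addr0 mulr1.
apply: (@le_integrable _ _ _ mu setT measurableT _ (fun r => ((K * C)%:E * (normal_pdf 0 (2 * s) r)%:E)%E)) => //.
- apply/measurable_EFinP; apply: measurable_funM => //; exact: measurable_normal_pdf.
- move=> r _; rewrite /= lee_fin normrM (ger0_norm (normal_pdf_ge0 _ _ _)).
  rewrite normrM (ger0_norm (normal_pdf_ge0 _ _ _)) (ger0_norm (mulr_ge0 K0 C0)).
  rewrite -mulrA (le_trans (ler_wpM2r (normal_pdf_ge0 _ _ _) (gK r)))//.
  by rewrite -mulrA ler_wpM2l// CP.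
- by apply: integrableZl => //; exact: integrable_normal_pdf.
Qed.

End normal_integrals.

Section normal_characteristic.
Context (R : realType) (s : R).
Hypothesis s0 : 0 < s.
Local Notation mu := (@lebesgue_measure R).
Local Notation n := (normal_pdf 0 s).

(** The smoothing mechanism: the mean enters only through the density, so the derivative falls on
    the density and [g] is only multiplied by it. *)
Lemma is_derive_normal_mean (g : R -> R) : bounded_measurable g ->
  is_derive (0 : R) 1 (fun h => \int[mu]_r (g r * normal_pdf h s r))
    (\int[mu]_r (g r * (r / s ^+ 2 * n r))).
Proof.
move=> [mg [M gM]]; have [C C0 CP] := normal_dominated s0.
have M0 : 0 <= M by rewrite (le_trans _ (gM 0)).
have I1 (h : R) : h \in `]0 - 1, 0 + 1[ -> `|h| <= 1.
  by rewrite in_itv/= ler_norml => /andP[? ?]; apply/andP; split; lra.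
pose f' h r := g r * ((r - h) / s ^+ 2 * normal_pdf h s r).
have -> : \int[mu]_r (g r * (r / s ^+ 2 * n r)) = \int[mu]_r f' 0 r.
  by apply: eq_Rintegral => r _; rewrite /f' subr0.
apply: (@is_derive_under_integral _ _ _ mu (fun h r => g r * normal_pdf h s r) f' 0
  (fun r => M / s ^+ 2 * C * normal_pdf 0 (2 * s) r)).
- move=> h /I1 h1; apply: (integrable_normal_growth s0 (K := M)) => // r.
  by rewrite (le_trans (gM r))// ler_peMr// lerDl sqr_ge0.
- move=> h r _; have := is_deriveZ (g r) (is_derive_normal_pdf_mean s0 h r).
  by [].
- exact: (integrableZl measurableT _ (integrable_normal_pdf 0 (2 * s))).
- move=> h r /I1 h1.
  have p0 := normal_pdf_ge0 h s r.
  have i0 : 0 <= (s ^+ 2)^-1 by rewrite invr_ge0 sqr_ge0.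
  rewrite /f' !normrM (ger0_norm p0) (ger0_norm i0) -!mulrA.
  rewrite ler_pM ?mulr_ge0// (mulrCA `|r - h|) ler_wpM2l//.
  rewrite (le_trans _ (CP h r h1))// ler_wpM2r//.
  rewrite -(real_normK (num_real (r - h))); have := normr_ge0 (r - h).
  have : 0 <= (`|r - h| - 1) ^+ 2 by rewrite sqr_ge0.
  nra.
Qed.

Let phi (a : R) := \int[mu]_r (cos (a * r) * n r).

Let mcos (a : R) : measurable_fun setT (fun r : R => cos (a * r)).
Proof.
apply: measurableT_comp; first by apply: continuous_measurable_fun; exact: continuous_cos.
exact: measurable_funM.
Qed.

Let msin (a : R) : measurable_fun setT (fun r : R => sin (a * r)).
Proof.
apply: measurableT_comp; first by apply: continuous_measurable_fun; exact: continuous_sin.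
exact: measurable_funM.
Qed.

Let le_growth (r : R) : `|r| <= 1 + (r - 0) ^+ 2.
Proof.
rewrite subr0 -(real_normK (num_real r)); have := normr_ge0 r.
have : 0 <= (`|r| - 1) ^+ 2 by rewrite sqr_ge0.
nra.
Qed.

Let intcos (a : R) : mu.-integrable setT (EFin \o (fun r : R => cos (a * r) * n r)).
Proof.
apply: (integrable_normal_growth s0 (K := 1)) => [//||r]; first by rewrite normr0.
by rewrite mul1r (le_trans (cos_max _))// lerDl sqr_ge0.
Qed.

Let intsin (a : R) : mu.-integrable setT (EFin \o (fun r : R => sin (a * r) * n r)).
Proof.
apply: (integrable_normal_growth s0 (K := 1)) => [//||r]; first by rewrite normr0.
by rewrite mul1r (le_trans (sin_max _))// lerDl sqr_ge0.
Qed.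

Let intrsin (a : R) : mu.-integrable setT (EFin \o (fun r : R => r * sin (a * r) * n r)).
Proof.
apply: (integrable_normal_growth s0 (K := 1)) => [||r].
- exact: measurable_funM.
- by rewrite normr0.
- by rewrite mul1r normrM (le_trans _ (le_growth r))// ler_piMr ?sin_max.
Qed.

Let nsym (a : R) : \int[mu]_r (sin (a * r) * n r) = 0.
Proof.
have ms : measurable_fun setT (fun r : R => sin (a * r) * n r).
  by apply: measurable_funM => //; exact: measurable_normal_pdf.
have := Rintegral_reflect 0 ms.
under eq_Rintegral do rewrite sub0r mulrN sinN mulNr normal_pdfN// -mulN1r.
rewrite RintegralZl//.
by move=> /eqP; rewrite mulN1r -subr_eq0 -opprD oppr_eq0 -mulr2n mulrn_eq0 => /eqP.
Qed.

(* Shifting the mean of the density by [h] multiplies [phi a] by [sin (a * h)]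
   in the integral of the sine; differentiate at [h = 0]. *)
Let rsinE (a : R) : \int[mu]_r (r * sin (a * r) * n r) = s ^+ 2 * (a * phi a).
Proof.
have bs : bounded_measurable (fun r : R => sin (a * r)).
  by split=> //; exists 1 => r; exact: sin_max.
have := is_derive_normal_mean bs.
have -> : (fun h => \int[mu]_r (sin (a * r) * normal_pdf h s r)) = (fun h => sin (a * h) * phi a).
  apply/funext => h.
  have mf : measurable_fun setT (fun r : R => sin (a * r) * normal_pdf h s r).
    by apply: measurable_funM => //; exact: measurable_normal_pdf.
  rewrite -(Rintegral_translate h mf).
  have E r : sin (a * (r + h)) * normal_pdf h s (r + h) =
      cos (a * h) * (sin (a * r) * n r) + sin (a * h) * (cos (a * r) * n r).
    by rewrite normal_pdf_shift// addrK mulrDr sinD; ring.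
  under eq_Rintegral do rewrite E.
  rewrite RintegralD//; last 2 first.
  - exact: (integrableZl measurableT _ (intsin a)).
  - exact: (integrableZl measurableT _ (intcos a)).
  rewrite RintegralZl ?nsym ?mulr0 ?add0r//.
  by rewrite RintegralZl.
have d2 : is_derive (0 : R) 1 (fun h => sin (a * h) * phi a) (a * phi a).
  by apply: is_derive_eq; rewrite /GRing.scale/= !mulr0 cos0; ring.
move=> d1; rewrite (is_derive_unique d2 d1).
rewrite -RintegralZl//.
  by apply: eq_Rintegral => r _; field; rewrite gt_eqF.
have -> : (EFin \o (fun r : R => sin (a * r) * (r / s ^+ 2 * n r))) =
    (fun r => ((s ^+ 2)^-1)%:E * (EFin \o (fun r : R => r * sin (a * r) * n r)%R) r)%E.
  by apply/funext => r /=; rewrite -EFinM; congr EFin; ring.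
exact: (integrableZl measurableT _ (intrsin a)).
Qed.

(** Differentiation under the integral yields a sine moment, which [rsinE] converts back into [phi]:
    a linear differential equation for the characteristic function. *)
Let is_derive_phi (a : R) : is_derive a 1 phi (- (s ^+ 2 * (a * phi a))).
Proof.
rewrite -rsinE.
have -> : - (\int[mu]_r (r * sin (a * r) * n r)) = \int[mu]_r (- r * sin (a * r) * n r).
  under [RHS]eq_Rintegral do rewrite !mulNr -mulN1r.
  by rewrite RintegralZl// mulN1r.
apply: (@is_derive_under_integral _ _ _ mu (fun a r => cos (a * r) * n r)
  (fun a r => - r * sin (a * r) * n r) a (fun r => (1 + (r - 0) ^+ 2) * n r)).
- by move=> b _; exact: intcos.
- by move=> b r _; apply: is_derive_eq; rewrite /GRing.scale/=; ring.
- apply: (integrable_normal_growth s0 (K := 1)) => [||r].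
  + by apply: measurable_funD => //; apply: measurable_funX; exact: measurable_funB.
  + by rewrite normr0.
  + by rewrite mul1r ger0_norm// addr_ge0// sqr_ge0.
- move=> b r _; rewrite !normrM normrN (ger0_norm (normal_pdf_ge0 _ _ _)).
  rewrite ler_wpM2r ?normal_pdf_ge0// (le_trans _ (le_growth r))//.
  by rewrite ler_piMr// sin_max.
Qed.

Let phi0 : phi 0 = 1.
Proof.
rewrite /phi; under eq_Rintegral do rewrite mul0r cos0 mul1r.
by rewrite /Rintegral integral_normal_pdf.
Qed.

(** The sine part vanishes by symmetry. For the cosine part, the product of [phi] with the inverse
    of the expected Gaussian has derivative zero and equals 1 at the origin. *)
Lemma Rintegral_cos_normal_pdf (th a : R) :
  \int[mu]_r (cos (th + a * r) * n r) = cos th * expR (- (a * s) ^+ 2 / 2).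
Proof.
have E r : cos (th + a * r) * n r = cos th * (cos (a * r) * n r) + (- sin th) * (sin (a * r) * n r).
  by rewrite cosD; ring.
under eq_Rintegral do rewrite E.
rewrite RintegralD//; last 2 first.
- exact: (integrableZl measurableT _ (intcos a)).
- exact: (integrableZl measurableT _ (intsin a)).
rewrite [X in _ + X]RintegralZl ?nsym ?mulr0 ?addr0// RintegralZl//.
congr (_ * _); rewrite -/(phi a).
pose psi b := phi b * expR ((b * s) ^+ 2 / 2).
have dpsi (b : R) : is_derive b 1 psi 0.
  have := is_derive_phi b => ?; rewrite /psi.
  by apply: is_derive_eq; rewrite /GRing.scale/=; field.
have : psi a = psi 0 by exact: is_derive_0_is_cst.
rewrite {2}/psi phi0 mul0r expr0n/= mul0r expR0 mulr1 /psi => psi1.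
rewrite mulNr expRN -[RHS]mul1r; apply: (canRL (mulfK _)) => //.
by rewrite gt_eqF// expR_gt0.
Qed.

Lemma integrable_sqr_normal_pdf :
  mu.-integrable setT (EFin \o (fun r : R => r ^+ 2 * n r)).
Proof.
apply: (integrable_normal_growth s0 (K := 1)) => [||r].
- exact: measurable_funX.
- by rewrite normr0.
- by rewrite mul1r ger0_norm ?sqr_ge0// subr0 lerDr.
Qed.

(** The sine moment is differentiated at 0 in two ways: under the integral, and from its closed form
    s^2 a phi(a). *)
Lemma Rintegral_sqr_normal_pdf : \int[mu]_r (r ^+ 2 * n r) = s ^+ 2.
Proof.
pose K a := \int[mu]_r (r * sin (a * r) * n r).
have d1 : is_derive (0 : R) 1 K (\int[mu]_r (r ^+ 2 * cos (0 * r) * n r)).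
  apply: (@is_derive_under_integral _ _ _ mu (fun a r => r * sin (a * r) * n r)
    (fun a r => r ^+ 2 * cos (a * r) * n r) 0 (fun r => r ^+ 2 * n r)).
  - by move=> b _; exact: intrsin.
  - by move=> b r _; apply: is_derive_eq; rewrite /GRing.scale/=; ring.
  - exact: integrable_sqr_normal_pdf.
  - move=> b r _; rewrite normrM (normrM (r ^+ 2)) (ger0_norm (normal_pdf_ge0 _ _ _)).
    rewrite ler_wpM2r ?normal_pdf_ge0// (ger0_norm (sqr_ge0 _)).
    by rewrite ler_piMr ?sqr_ge0// cos_max.
have d2 : is_derive (0 : R) 1 K (s ^+ 2).
  have -> : K = fun a => s ^+ 2 * (a * phi a) by apply/funext => a; exact: rsinE.
  have := is_derive_phi 0 => ?.
  by apply: is_derive_eq; rewrite /GRing.scale/= phi0; ring.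
rewrite (is_derive_unique d2 d1).
by apply: eq_Rintegral => r _; rewrite mul0r cos0 mulr1.
Qed.

(* [- s ^+ 2 * n] is a primitive of [r * n r] on the half-line. *)
Lemma integral_norm_normal_pdf :
  (\int[mu]_r (`|r| * n r)%:E = (s * Num.sqrt (2 / pi))%:E)%E.
Proof.
rewrite ge0_symfun_integralT; last 3 first.
- by move=> r; rewrite mulr_ge0 ?normal_pdf_ge0.
- move=> r; apply: cvgM; first exact: norm_continuous.
  by apply: continuous_normal_pdf; rewrite gt_eqF.
- by move=> r /=; rewrite normrN normal_pdfN.
rewrite -set_itvcy.
have -> : (\int[mu]_(x in `[0%R, +oo[) (`|x| * n x)%:E =
    \int[mu]_(x in `[0%R, +oo[) (x * n x)%:E)%E.
  apply: eq_integral => r; rewrite inE/= in_itv/= andbT => r0.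
  by rewrite ger0_norm.
have sn0 : s != 0 by rewrite gt_eqF.
have cn : continuous n by exact: continuous_normal_pdf.
have dF (r : R) : is_derive r 1 (fun r => - s ^+ 2 * n r) (r * n r).
  have := is_deriveZ (- s ^+ 2) (is_derive_normal_pdf s0 0 r) => ?.
  by apply: is_derive_eq; rewrite /GRing.scale/= subr0; field.
rewrite (@ge0_continuous_FTC2y _ _ (fun r => - s ^+ 2 * n r) 0 0).
- have p2 : (0 : R) < Num.sqrt (2 * pi) :> R by rewrite sqrtr_gt0 mulr_gt0// pi_gt0.
  have -> : Num.sqrt (2 / pi) = 2 / Num.sqrt (2 * pi) :> R.
    have -> : 2 / pi = 2 ^+ 2 * (2 * pi)^-1 :> R by rewrite invfM mulrA expr2 mulfK.
    by rewrite sqrtrM ?sqr_ge0// sqrtr_sqr ger0_norm// sqrtrV ?mulr_ge0 ?pi_ge0.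
  rewrite -EFinB -EFinM normal_pdf_expE// subr0 expr0n/= oppr0 mul0r expR0 mulr1.
  have -> : normal_peak s = (s * Num.sqrt (2 * pi))^-1.
    by rewrite /normal_peak -mulr_natl mulrCA sqrtrM ?sqr_ge0// sqrtr_sqr gtr0_norm.
  by congr EFin; field; rewrite sn0 gt_eqF.
- by move=> r r0; rewrite mulr_ge0// normal_pdf_ge0.
- by apply: continuous_subspaceT => r; apply: cvgM; [exact: cvg_id|exact: cn].
- rewrite -[X in _ --> X](mulr0 (- s ^+ 2)); apply: cvgMr.
  (* For r >= 2 s^2 the exponent r^2 / (2 s^2) is at least r. *)
  apply: (@squeeze_cvgr _ _ _ _ (cst 0) (fun x => normal_peak s * expR (- x))).
  + near=> r; rewrite normal_pdf_ge0/= normal_pdf_expE// ler_wpM2l ?normal_peak_ge0//.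
    have s2 : 0 < s ^+ 2 *+ 2 by rewrite pmulrn_lgt0// exprn_gt0.
    rewrite ler_expR subr0 mulNr lerN2 ler_pdivlMr//.
    rewrite expr2 ler_pM2l//; near: r; exact: nbhs_pinfty_ge.
  + exact: cvg_cst.
  + rewrite -[X in _ --> X](mulr0 (normal_peak s)); apply: cvgMr.
    exact: cvgr_expR.
- by move=> r _; exact: (@ex_derive _ _ _ _ _ _ _ (dF r)).
- by apply: cvg_at_right_filter; apply: cvgMr; exact: cn.
- by move=> r _; rewrite derive1E; exact: (@derive_val _ _ _ _ _ _ _ (dF r)).
Unshelve. all: end_near. Qed.

Lemma integrable_norm_normal_pdf :
  mu.-integrable setT (EFin \o (fun r : R => `|r| * n r)).
Proof.
apply: (integrable_normal_growth s0 (K := 1)) => [||r].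
- exact: normr_measurable.
- by rewrite normr0.
- by rewrite mul1r normr_id; exact: le_growth.
Qed.

End normal_characteristic.

(** The Radon-Nikodym derivative agrees almost everywhere with [normal_pdf], because both have the
    same integral over every measurable set. *)
Lemma integral_normal_prob (R : realType) (m s : R) (f : R -> R) :
  (normal_prob m s).-integrable setT (EFin \o f) ->
  \int[normal_prob m s]_x f x = \int[@lebesgue_measure R]_x (f x * normal_pdf m s x).
Proof.
move=> intf.
have mp : measurable_fun setT (fun x : R => (normal_pdf m s x)%:E).
  by apply/measurable_EFinP; exact: measurable_normal_pdf.
have mf : measurable_fun setT (EFin \o f) by exact: measurable_int intf.
rewrite /Rintegral; congr fine.
rewrite -(Radon_Nikodym_change_of_variables (normal_prob_dominates m s))//.
under [RHS]eq_integral do rewrite EFinM.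
apply: ae_eq_integral => //.
- apply: emeasurable_funM => //; apply: (measurable_int lebesgue_measure).
  by apply: Radon_Nikodym_integrable; exact: normal_prob_dominates.
- exact: emeasurable_funM.
- apply: ae_eqe_mul2l => /=.
  rewrite Radon_NikodymE//=; first exact: normal_prob_dominates.
  move=> dom; case: cid => /= h [h1 h2 h3].
  apply: integral_ae_eq => //=.
  by move=> A _ mA; rewrite -h3.
Qed.

Section centred_gaussian_characteristic.
Context d (Omega : measurableType d) (R : realType) (P : probability Omega R).

Lemma integral_law (s : R) (X : Omega -> R) (f : R -> \bar R) :
  measurable_fun setT X ->
  (forall A, measurable A -> P (X @^-1` A) = normal_prob 0 s A) ->
  measurable_fun setT f ->
  (\int[P]_w f (X w) = \int[normal_prob 0 s]_x f x)%E.
Proof.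
move=> mX XE mf.
have H (g : R -> \bar R) : measurable_fun setT g -> (forall x, 0 <= g x)%E ->
    (\int[P]_w g (X w) = \int[normal_prob 0 s]_x g x)%E.
  move=> mg g0.
  have mX' : measurable_fun setT (X : Omega -> measurableTypeR R) by [].
  transitivity (\int[pushforward P (X : Omega -> measurableTypeR R)]_x g x)%E.
    by rewrite ge0_integral_pushforward.
  by apply: eq_measure_integral => A mA _; exact: XE.
rewrite integralE [in RHS]integralE; congr (_ - _)%E.
- rewrite -(H _ (measurable_funepos mf))//.
  by rewrite (_ : (fun w => f (X w)) = f \o X)// funepos_comp.
- rewrite -(H _ (measurable_funeneg mf))//.
  by rewrite (_ : (fun w => f (X w)) = f \o X)// funeneg_comp.
Qed.

(** The variance is known only as a second moment, so it is first matched with the law: 0 in the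
    degenerate case, s^2 otherwise. The phase lets one real formula stand for the whole
    characteristic function. *)
Lemma centred_gaussian_cos (X : Omega -> R) (v th : R) : centred_gaussian P X ->
  ('E_P[fun w => (X w * X w)%R] = v%:E)%E ->
  \int[P]_w cos (th + X w) = cos th * expR (- v / 2).
Proof.
rewrite unlock => -[mX [X0|[s s0 XE]]] EX.
  have v0 : v = 0.
    apply: EFin_inj; rewrite -EX (ae_eq_integral (cst 0%E)) ?integral0//.
      by apply/measurable_EFinP; exact: measurable_funM.
    by apply: filterS X0 => w /= -> //; rewrite mul0r.
  have mc : measurable_fun setT (fun w => cos (th + X w)).
    apply: measurableT_comp; first by apply: continuous_measurable_fun; exact: continuous_cos.
    exact: measurable_funD.
  rewrite v0 oppr0 mul0r expR0 mulr1 /Rintegral (ae_eq_integral (cst (cos th)%:E))//.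
  - by rewrite integral_cst// [X in (_ * X)%E](probability_setT P) mule1.
  - exact/measurable_EFinP.
  - by apply: filterS X0 => w /= -> //; rewrite addr0.
have mc : measurable_fun setT (fun x : R => cos (th + x)).
  apply: measurableT_comp; first by apply: continuous_measurable_fun; exact: continuous_cos.
  exact: measurable_funD.
have -> : v = s ^+ 2.
  have m2 : measurable_fun setT (fun x : R => (x * x)%:E).
    by apply/measurable_EFinP; exact: measurable_funM.
  rewrite -(Rintegral_sqr_normal_pdf s0) -integral_normal_prob.
    by rewrite /Rintegral -[v]/(fine v%:E) -EX -(integral_law mX XE m2).
  apply/integrableP; split; first exact/measurable_EFinP/measurable_funX.
  under eq_integral do rewrite /= ger0_norm ?sqr_ge0// expr2.
  by rewrite -(integral_law mX XE m2) EX ltry.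
have mce : measurable_fun setT (EFin \o (fun x : R => cos (th + x))) by exact/measurable_EFinP.
rewrite /Rintegral (integral_law mX XE mce) -/(Rintegral _ _ _) integral_normal_prob.
  under eq_Rintegral do rewrite -[X in th + X]mul1r.
  by rewrite Rintegral_cos_normal_pdf// mul1r.
by apply: bounded_measurable_integrable; split=> //; exists 1 => x; exact: cos_max.
Qed.

End centred_gaussian_characteristic.

(** * Gaussian decomposition and smoothing *)

Section measurable_pair.
Context d (T : measurableType d) (R : realType) (X Y : normedModType R).
Variables (D : set T) (u : T -> X) (v : T -> Y) (e : nat -> X) (e' : nat -> Y).
Hypothesis u_open : forall U, open U -> measurable (D `&` u @^-1` U).
Hypothesis v_open : forall U, open U -> measurable (D `&` v @^-1` U).
Hypothesis u_sep : forall w, D w -> closure (range e) (u w).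
Hypothesis v_sep : forall w, D w -> closure (range e') (v w).

(** For nonseparable spaces an open set of the product need not be a countable union of boxes. On
    the separable ranges, boxes of balls centred at the two sequences with radii 1 / (n + 1)
    suffice. *)
Lemma measurable_pair_open (O : set (X * Y)) : open O ->
  measurable (D `&` [set w | O (u w, v w)]).
Proof.
move=> oO.
pose I := [set p : nat * nat * nat | forall x y,
  ball (e p.1.1) p.2.+1%:R^-1 x -> ball (e' p.1.2) p.2.+1%:R^-1 y -> O (x, y)].
have -> : D `&` [set w | O (u w, v w)] = \bigcup_(p in I)
    ((D `&` u @^-1` ball (e p.1.1) p.2.+1%:R^-1) `&`
     (D `&` v @^-1` ball (e' p.1.2) p.2.+1%:R^-1)).
  apply/seteqP; split=> [w [Dw Ow]|w [[[i j] n] Ip [[Dw ui] [_ vj]]]]; last first.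
    by split=> //; exact: Ip.
  have /nbhs_ballP[r /= r0 rO] : nbhs (u w, v w) O by exact: open_nbhs_nbhs.
  have [n nr] : exists n : nat, n.+1%:R^-1 < r / 2.
    have r2 : 0 < r / 2 by rewrite divr_gt0.
    by have [n _ /(_ n (leqnn n))] := near_infty_natSinv_lt (PosNum r2); exists n.
  have n0 : 0 < n.+1%:R^-1 :> R by [].
  have [_ [[i _ <-] ui]] := u_sep Dw (nbhsx_ballx (u w) _ n0).
  have [_ [[j _ <-] vj]] := v_sep Dw (nbhsx_ballx (v w) _ n0).
  exists (i, j, n) => /=; last by do 2?split=> //; exact: ball_sym.
  move=> x y xi yj; apply: rO; split => /=.
    apply: (le_ball (ltW _) (ball_triangle ui xi)).
    by rewrite (splitr r) ltrD.
  apply: (le_ball (ltW _) (ball_triangle vj yj)).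
  by rewrite (splitr r) ltrD.
rewrite bigcup_mkcond; apply: countable_bigcupT_measurable => // p.
case: ifP => _ //; apply: measurableI.
- by apply: u_open; exact: ball_open.
- by apply: v_open; exact: ball_open.
Qed.

End measurable_pair.

Lemma measurable_fun_open d (T : measurableType d) (R : realType) (D : set T)
    (g : T -> R) (U : set R) : measurable D -> measurable_fun D g -> open U ->
  measurable (D `&` g @^-1` U).
Proof. by move=> mD mg oU; apply: mg => //; exact: open_measurable. Qed.

Lemma dense_rat_seq (R : realType) : exists e : nat -> R^o, forall x, closure (range e) x.
Proof.
have [e eP] : exists e : nat -> R^o, range (@ratr R) `<=` range e.
  by apply: countable_range; exact: (sub_countable (card_image_le _ _)).
exists e => x A nA.
have [||y [Ay qy]] := @dense_rat R (A^°); [by exists x|exact: open_interior|].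
by exists y; split; [exact: eP|exact: interior_subset].
Qed.

(** The combination is continuous on pairs, and [measurable_pair_open] replaces joint measurability
    of the addition of [E], using the separable range of [U]. *)
Lemma vector_random_variable_axpy d (T : measurableType d) (R : realType)
    (E : completeNormedModType R) (e : nat -> E) (U : T -> E) (c : T -> R) (y : E) :
  measurable_fun setT (U : T -> borel E) -> (forall w, closure (range e) (U w)) ->
  measurable_fun setT c -> measurable_fun setT ((fun w => U w + c w *: y) : T -> borel E).
Proof.
move=> mU Ue mc; have [q qP] := dense_rat_seq R.
apply: borel_measurableP => O oO.
apply: (@measurable_pair_open _ T R E R^o setT U c e q _ _ _ _
  [set p | O (p.1 + (p.2 : R) *: y)]) => //.
- by move=> V oV; apply: mU => //; exact: open_borel.
- by move=> V oV; apply: measurable_fun_open.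
- apply: (@open_comp _ _ (fun p : E * R^o => p.1 + (p.2 : R) *: y)) => // p _.
  by apply: cvgD; [exact: cvg_fst|apply: cvgZr_tmp; exact: cvg_snd].
Qed.

Lemma norm_Rintegral_le d (T : measurableType d) (R : realType)
    (P : probability T R) (f : T -> R) (M : R) :
  measurable_fun setT f -> (forall x, `|f x| <= M) -> `|\int[P]_x f x| <= M.
Proof.
move=> mf fM.
have intf : P.-integrable setT (EFin \o f).
  by apply: bounded_measurable_integrable; split=> //; exists M.
rewrite (le_trans (le_normr_Rintegral measurableT intf))//.
have -> : M = \int[P]_x (cst M x).
  by rewrite Rintegral_cst// [X in fine X](probability_setT P) mulr1.
apply: le_Rintegral => //.
- apply: bounded_measurable_integrable; split; first exact: measurableT_comp.
  by exists M => x; rewrite normr_id.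
- exact/bounded_measurable_integrable/bounded_measurable_cst.
Qed.

Section bounded_fubini.
Context d1 d2 (T1 : measurableType d1) (T2 : measurableType d2) (R : realType).
Context (P1 : probability T1 R) (P2 : probability T2 R) (f : T1 * T2 -> R).
Hypothesis bf : bounded_measurable f.

Lemma bounded_measurable_section y : bounded_measurable (fun x => f (x, y)).
Proof.
have [mf [M fM]] := bf; split; last by exists M.
by apply: measurableT_comp => //; exact: measurable_pair2.
Qed.

Let Gfin y : (\int[P1]_x (f (x, y))%:E = (\int[P1]_x f (x, y))%:E)%E.
Proof.
rewrite /Rintegral fineK//; apply: integrable_fin_num => //.
exact: (bounded_measurable_integrable P1 (bounded_measurable_section y)).
Qed.

Let intf : (P1 \x P2)%E.-integrable setT (EFin \o f).
Proof.
exact: (@bounded_measurable_integrable _ (T1 * T2)%type R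
  ((P1 \x P2)%E : probability (T1 * T2)%type R) _ bf).
Qed.

Lemma bounded_measurable_Rintegral :
  bounded_measurable (fun y => \int[P1]_x f (x, y)).
Proof.
have [mf [M fM]] := bf; split.
  apply/measurable_EFinP; rewrite (_ : EFin \o _ = fun y => \int[P1]_x (f (x, y))%:E)%E.
    exact: (measurable_fubini_G intf).
  by apply/funext => y; rewrite Gfin.
exists M => y; apply: norm_Rintegral_le => // ; exact: (bounded_measurable_section y).1.
Qed.

Lemma bounded_fubini :
  \int[(P1 \x P2)%E]_z f z = \int[P2]_y \int[P1]_x f (x, y).
Proof.
rewrite {1}/Rintegral -(integral21_prod_meas1 intf)/=; congr fine.
by apply: eq_integral => y _; exact: Gfin.
Qed.

End bounded_fubini.

Lemma ae_eq_Rintegral d (T : measurableType d) (R : realType)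
    (m : {measure set T -> \bar R}) (f g : T -> R) :
  measurable_fun setT f -> measurable_fun setT g -> f = g %[ae m] ->
  \int[m]_x f x = \int[m]_x g x.
Proof.
move=> mf mg fg; rewrite /Rintegral; congr fine; apply: ae_eq_integral => //.
- exact/measurable_EFinP.
- exact/measurable_EFinP.
- by apply: filterS fg => x fgx Dx /=; rewrite fgx.
Qed.

Lemma Rintegral_distribution d d' (T : measurableType d) (T' : measurableType d')
    (R : realType) (P : probability T R) (X : {mfun T >-> T'}) (f : T' -> R) :
  bounded_measurable f ->
  \int[distribution P X]_y f y = \int[P]_w f (X w).
Proof.
move=> bf; have mf : measurable_fun setT (EFin \o f) by apply/measurable_EFinP; exact: bf.1.
rewrite /Rintegral; congr fine; rewrite integral_pushforward//.
apply: bounded_measurable_integrable; split; last by case: bf => _ [M fM]; exists M.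
by apply: measurableT_comp bf.1 _.
Qed.

Lemma expectation_sqr_lin d (T : measurableType d) (R : realType)
    (P : probability T R) (A B : T -> R) (c ea eab eb : R) :
  A \in Lfun P 2%:E -> B \in Lfun P 2%:E ->
  ('E_P[fun w => (A w * A w)%R] = ea%:E)%E ->
  ('E_P[fun w => (A w * B w)%R] = eab%:E)%E ->
  ('E_P[fun w => (B w * B w)%R] = eb%:E)%E ->
  ('E_P[fun w => ((A w + c * B w) * (A w + c * B w))%R]
    = (ea + 2 * c * eab + c ^+ 2 * eb)%:E)%E.
Proof.
move=> lA lB EA EAB EB.
have lAA := Lfun2_mul_Lfun1 lA lA; have lAB := Lfun2_mul_Lfun1 lA lB.
have lBB := Lfun2_mul_Lfun1 lB lB.
have -> : (fun w => (A w + c * B w) * (A w + c * B w)) =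
    (A \* A) \+ (((2 * c) \o* (A \* B)) \+ ((c ^+ 2) \o* (B \* B))).
  by apply/funext => w /=; ring.
have l1 : (2 * c) \o* (A \* B) \in Lfun P 1%E by exact: Lfun_scale.
have l2 : (c ^+ 2) \o* (B \* B) \in Lfun P 1%E by exact: Lfun_scale.
rewrite expectationD ?expectationD ?expectationZl//; last exact: rpredD.
by rewrite EA EAB EB -!EFinM -!EFinD addrA.
Qed.

Section gaussian_decomposition.
Context d (Omega : measurableType d) (R : realType) (P : probability Omega R).
Context (H : hilbertType R) (E : completeNormedModType R).
Context (W : (R -> H) -> Omega -> R) (T : (R -> H) -> E) (X : Omega -> E).
Hypothesis W_iso : isonormal_process P W.
Hypothesis X_gauss : gaussian_variable_of P W T X.
Context (v : R -> H) (s : R).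
Hypothesis L2v : L2 v.
Hypothesis s0 : 0 < s.
Hypothesis sE : L2_dotp v v = s ^+ 2.
Local Notation N := (normal_prob (0 : R) 1).

Let U (z : Omega * measurableTypeR R) : E :=
  X z.1 + ((s * (z.2 : R) - W v z.1) / s ^+ 2) *: T v.

Let mW u : L2 u -> measurable_fun setT (W u).
Proof. by case: W_iso => + _ _ _ => /[apply]; rewrite inE => /andP[]; rewrite inE. Qed.

Let e_ex : exists e : nat -> E, forall w, closure (range e) (X w).
Proof.
have [[_ [A cA XA]] _] := X_gauss.
have [e Ae] := countable_range cA; exists e => w.
by apply: (closureS Ae); apply: XA; exists w.
Qed.

Let mU : measurable_fun setT (U : _ -> borel E).
Proof.
have [e Xe] := e_ex; apply: (@vector_random_variable_axpy _ _ R E e (fun z => X z.1)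
  (fun z => (s * (z.2 : R) - W v z.1) / s ^+ 2)).
- by apply: (measurableT_comp X_gauss.1.1).
- by move=> w; exact: Xe.
- apply: measurable_funM => //; apply: measurable_funB.
    by apply: measurable_funM => //; exact: measurable_snd.
  by apply: measurableT_comp; [exact: mW|exact: measurable_fst].
Qed.

Lemma bounded_measurable_decomposition (f : E -> R) :
  bounded_measurable (f : borel E -> R) -> bounded_measurable (fun z => f (U z)).
Proof.
move=> [mf [M fM]]; split; last by exists M.
exact: (measurableT_comp mf mU).
Qed.

(* [X] is the sum of [(W v / s ^+ 2) *: T v] and of a variable independent of
   [W v]; the right-hand side replaces [W v] by an independent copy [s * r]. *)
Lemma gaussian_decomposition (f : E -> R) : bounded_measurable (f : borel E -> R) ->
  \int[P]_w f (X w) = \int[N]_r \int[P]_w f (U (w, r)).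
Proof.
move=> bf.
have bfU := bounded_measurable_decomposition bf.
rewrite -(bounded_fubini P N bfU).
pose X' : {mfun Omega >-> borel E} := HB.pack (X : Omega -> borel E)
  (isMeasurableFun.Build _ _ _ _ (X : Omega -> borel E) X_gauss.1.1).
pose U' : {mfun (Omega * measurableTypeR R)%type >-> borel E} := HB.pack (U : _ -> borel E)
  (isMeasurableFun.Build _ _ _ _ (U : _ -> borel E) mU).
have [e Xe] := e_ex; have [q qP] := dense_rat_seq R.
(* A common separable carrier for the laws of [X] and [U]: the points [e i] translated by countably
   many dense multiples of [T v]. *)
have [e2 e2P] : exists e2 : nat -> E, forall x c, closure (range e) x ->
    closure (range e2) (x + c *: T v).
  have [e2 e2P] : exists e2 : nat -> E,
      range (fun p : nat * nat => e p.1 + (q p.2 : R) *: T v) `<=` range e2.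
    by apply: countable_range; exact: (sub_countable (card_image_le _ _)).
  exists e2 => x c ex B nB.
  have cont : (fun p : E * R^o => p.1 + (p.2 : R) *: T v) @ (x, c : R^o) --> x + c *: T v.
    by apply: cvgD; [exact: cvg_fst|apply: cvgZr_tmp; exact: cvg_snd].
  have [[B1 B2] /= [nB1 nB2] sub] := cont _ nB.
  have [_ [[i _ <-] Bi]] := ex _ nB1; have [_ [[j _ <-] Bj]] := qP c _ nB2.
  exists (e i + (q j : R) *: T v); split; first by apply: e2P; exists (i, j).
  exact: (sub (e i, q j)).
pose PN : probability (Omega * measurableTypeR R)%type R := (P \x N)%E.
have fE (A : set E) : measurable (A : set (borel E)) ->
    distribution P X' A = distribution PN U' A.
  move=> mA; apply: (@fourier_uniqueness R E (distribution P X') (distribution PN U') e2) => //.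
  - transitivity (P set0); last exact: measure0.
    congr (P _); rewrite -subset0 => w /=; apply; rewrite -[X w]addr0 -(scale0r (T v)).
    exact: e2P.
  - transitivity (PN set0); last exact: measure0.
    by congr (PN _); rewrite -subset0 => z /=; apply; exact: e2P.
  - move=> th phi cphi.
    have bphi (a : R) : bounded_measurable (fun x : borel E => cos (a + phi x) : R).
      apply: (@bounded_measurable_comp _ _ _ (fun r => cos (a + r))).
      + move=> r; apply: continuous_comp; last exact: continuous_cos.
        by apply: cvgD; [exact: cvg_cst|exact: cvg_id].
      + by exists 1 => r; exact: cos_max.
      + exact: (@continuous_borel_real E R).
    rewrite !Rintegral_distribution//.
    have bU := bounded_measurable_decomposition (bphi th).
    rewrite (bounded_fubini P N bU).
    have [_ Xphi] := X_gauss; have [gphi [g [L2g gE] phiW]] := Xphi phi cphi.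
    have [W2 _ Wgauss Wcov] := W_iso.
    (* Since the inner product of g and v is phi (T v), [k] is the regression coefficient of W g on
       W v. *)
    pose vg := L2_dotp g g; pose k : R := phi (T v) / s ^+ 2.
    have sn0 : s != 0 by rewrite gt_eqF.
    have mphiX : measurable_fun setT (fun w => phi (X w) : R) by exact: gphi.1.
    have EX : ('E_P[fun w => ((phi (X w) : R) * phi (X w))%R] = vg%:E)%E.
      rewrite -(Wcov g g L2g L2g) !unlock; apply: ae_eq_integral => //.
      - by apply/measurable_EFinP; exact: measurable_funM.
      - by apply/measurable_EFinP; apply: measurable_funM; exact: mW.
      - by apply: filterS phiW => w /= phiXw _; rewrite /= -phiXw.
    rewrite (centred_gaussian_cos th gphi EX).
    (* The residual W g - k W v, written as a sum over two indices to be an instance of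
       [centred_gaussian_vector]. Its variance is vg - (k s)^2. *)
    pose Z w := \sum_(i < 2) (if i == ord0 then 1 else - k) *
      W (if i == ord0 then g else v) w.
    have ZE w : Z w = W g w + (- k) * W v w.
      by rewrite /Z big_ord_recl big_ord1 /= mul1r.
    have gZ : centred_gaussian P Z.
      apply: (Wgauss 2%N (fun i => if i == ord0 then g else v)
        _ (fun i => if i == ord0 then 1 else - k)).
      by move=> i; case: ifP.
    have EZ : ('E_P[fun w => (Z w * Z w)%R] = (vg - (k * s) ^+ 2)%:E)%E.
      under eq_fun do rewrite ZE.
      rewrite (expectation_sqr_lin (- k) (W2 _ L2g) (W2 _ L2v) (Wcov _ _ L2g L2g)
        (Wcov _ _ L2g L2v) (Wcov _ _ L2v L2v)) sE (gE v L2v).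
      by congr EFin; rewrite -/vg /k; field.
    (* For fixed r, phi (U (w, r)) is almost surely Z w + k s r, so r contributes only to the
       phase. *)
    have inner (r : R) : \int[P]_w cos (th + phi (U (w, r))) =
        expR (- (vg - (k * s) ^+ 2) / 2) * cos (th + k * s * r).
      rewrite mulrC -(centred_gaussian_cos (th + k * s * r) gZ EZ).
      have := bounded_measurable_section bU r => -[mUr _].
      apply: ae_eq_Rintegral => //.
        apply: measurableT_comp; first by apply: continuous_measurable_fun; exact: continuous_cos.
        by apply: measurable_funD => //; exact: gZ.1.
      apply: filterS phiW => w /= phiXw _; congr cos; move: (phiXw I) => {}phiXw.
      rewrite /U linearD linearZ /= phiXw ZE /GRing.scale /= /k; field.
      exact: sn0.
    under eq_Rintegral do rewrite inner.
    have bc : bounded_measurable (fun r : measurableTypeR R => cos (th + k * s * (r : R))).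
      split; last by exists 1 => r; exact: cos_max.
      apply: measurableT_comp; first by apply: continuous_measurable_fun; exact: continuous_cos.
      by apply: measurable_funD => //; exact: measurable_funM.
    have intc := bounded_measurable_integrable N bc.
    (* Averaging over r restores the missing variance (k s)^2, and the two exponents add up to - vg
       / 2. *)
    rewrite RintegralZl// integral_normal_prob// Rintegral_cos_normal_pdf// mulr1.
    by rewrite mulrCA -expRD; congr (_ * expR _); field.
have XE : \int[distribution P X']_x f x = \int[P]_w f (X w) by exact: Rintegral_distribution.
have UE : \int[distribution PN U']_x f x = \int[PN]_z f (U z) by exact: Rintegral_distribution.
rewrite -XE -[RHS]UE.
rewrite /Rintegral; congr fine; apply: eq_measure_integral => A mA _; exact: fE.
Qed.

End gaussian_decomposition.

Lemma is_derive_along (R : realType) (E : normedModType R) (F : E -> R) (x xi : E) (D : R) :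
  is_derive (0 : R) 1 (fun h : R => F (h *: xi + x)) D -> is_derive x xi F D.
Proof.
move=> dF; have [cF DE] := dF.
have E1 : (fun h : R => h^-1 *: (((fun k : R => F (k *: xi + x)) \o shift 0) (h *: 1) -
    F (0 *: xi + x))) = (fun h => h^-1 *: ((F \o shift x) (h *: xi) - F x)).
  by apply/funext => h /=; rewrite scale0r add0r addr0 [h *: 1]mulr1.
apply: DeriveDef; first by rewrite /derivable -E1.
by rewrite -DE /derive -E1.
Qed.

Section smoothing.
Context d (Omega : measurableType d) (R : realType) (P : probability Omega R).
Context (H : hilbertType R) (E : completeNormedModType R).
Context (W : (R -> H) -> Omega -> R) (T : (R -> H) -> E) (X : Omega -> E).
Hypothesis W_iso : isonormal_process P W.
Hypothesis T_bounded : L2_bounded_operator T.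
Hypothesis X_gauss : gaussian_variable_of P W T X.
Context (S : R -> {linear E -> E}) (t : R) (f : E -> R) (M : R).
Hypothesis mf : measurable_fun setT (f : borel E -> R).
Hypothesis fM : forall y, `|f y| <= M.
Context (x xi : E) (v : R -> H).
Hypothesis L2v : L2 v.
Hypothesis Tv : T v = S t xi.
Local Notation mu := (@lebesgue_measure R).

Lemma transition_derivative : exists2 D : R,
  is_derive x xi (transition P S X t f) D &
  `|D| <= Num.sqrt (2 / pi) * M * L2_norm v.
Proof.
have M0 : 0 <= M by exact: le_trans (fM 0).
have transE z : transition P S X t f z = \int[P]_w f (S t z + X w).
  by rewrite /transition unlock.
have v2 : 0 <= L2_dotp v v.
  by apply: Rintegral_ge0 => s _; rewrite -sqr_normE sqr_ge0.
(* With a zero control, boundedness of [T] forces S t xi = 0, so the function is constant along xi;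
   the division by s^2 is reserved for the other case. *)
have [v0|vn0] := eqVneq (L2_norm v) 0.
  exists 0; last by rewrite normr0 v0 mulr0.
  have y0 : S t xi = 0.
    have [_ [C TC]] := T_bounded; apply/eqP; rewrite -normr_le0 -Tv.
    by rewrite (le_trans (TC _ L2v))// v0 mulr0.
  apply: is_derive_along.
  have -> : (fun h : R => transition P S X t f (h *: xi + x)) = cst (transition P S X t f x).
    by apply/funext => h; rewrite !transE linearD linearZ /= y0 scaler0 add0r.
  exact: is_derive_cst.
set s := L2_norm v in vn0 *.
have s0 : 0 < s by rewrite lt_neqAle eq_sym vn0 sqrtr_ge0.
have sE : L2_dotp v v = s ^+ 2 by rewrite sqr_sqrtr.
pose U (z : Omega * measurableTypeR R) : E := X z.1 + ((s * (z.2 : R) - W v z.1) / s ^+ 2) *: T v.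
have bshift (a : E) : bounded_measurable ((fun y => f (a + y)) : borel E -> R).
  split; last by exists M.
  apply: (measurableT_comp mf); apply: (@continuous_borel_fun E E) => y.
  by apply: cvgD; [exact: cvg_cst|exact: cvg_id].
pose F (r : R) : R := \int[P]_w f (S t x + U (w, r)).
have bF : bounded_measurable F.
  apply: (bounded_measurable_Rintegral P (normal_prob 0 1) (f := fun z => f (S t x + U z))).
  exact: (bounded_measurable_decomposition W_iso X_gauss s L2v (bshift (S t x))).
have transF h : transition P S X t f (h *: xi + x) =
    \int[mu]_r (F r * normal_pdf (h * s) 1 r).
  rewrite transE linearD linearZ /= -Tv.
  rewrite (gaussian_decomposition W_iso X_gauss L2v s0 sE (bshift (h *: T v + S t x))).
  (* In the standardised coordinate r, adding h T v means adding h s to r. Hence one function [F]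
     serves all h, and only the density moves. *)
  have FE (r : R) : \int[P]_w f (h *: T v + S t x + U (w, r)) = F (r + h * s).
    apply: eq_Rintegral => w _; congr f; rewrite /U /=.
    rewrite (addrC (h *: _)) -!addrA; congr (_ + _); rewrite addrCA; congr (_ + _).
    by rewrite -scalerDl; congr (_ *: _); field.
  under eq_Rintegral do rewrite FE.
  have bFh : bounded_measurable (fun r : measurableTypeR R => F ((r : R) + h * s)).
    split; last by case: bF => _ [K FK]; exists K.
    by apply: measurableT_comp bF.1 _; exact: measurable_funD.
  rewrite integral_normal_prob; last exact: bounded_measurable_integrable.
  have mFn : measurable_fun setT (fun r : R => F r * normal_pdf (h * s) 1 r).
    by apply: measurable_funM bF.1 _; exact: measurable_normal_pdf.
  rewrite -(Rintegral_translate (h * s) mFn); apply: eq_Rintegral => r _.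
  by rewrite [normal_pdf (h * s) _ _]normal_pdf_shift// addrK.
(* The derivative in the mean, at mean 0. The mean is h s, so the chain rule supplies the factor
   s. *)
pose D0 := \int[mu]_r (F r * (r / 1 ^+ 2 * normal_pdf 0 1 r)).
exists (s * D0).
  apply: is_derive_along; under eq_fun do rewrite transF.
  have d0 := is_derive_normal_mean (ltr01 : 0 < 1 :> R) bF.
  have ds : is_derive (0 : R) 1 (fun h : R => h * s) s.
    by apply: is_derive_eq; rewrite /GRing.scale/= mulr0 mulr1 add0r.
  rewrite mulrC; apply: (@is_derive1_comp _ (fun h => \int[mu]_r (F r * normal_pdf h 1 r)) (fun h => h * s)).
  by rewrite mul0r.
have FM r : `|F r| <= M.
  apply: norm_Rintegral_le => [|w]; last exact: fM.
  exact: (bounded_measurable_section (bounded_measurable_decomposition W_iso X_gauss s L2v (bshift (S t x))) r).1.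
rewrite normrM (gtr0_norm s0) mulrC ler_wpM2r ?(ltW s0)//.
have mD : measurable_fun setT (fun r : R => F r * (r / 1 ^+ 2 * normal_pdf 0 1 r)).
  apply: measurable_funM bF.1 _; apply: measurable_funM; last exact: measurable_normal_pdf.
  exact: measurable_funM.
have intM : mu.-integrable setT (EFin \o (fun r : R => M * (`|r| * normal_pdf 0 1 r))).
  exact: (integrableZl measurableT _ (integrable_norm_normal_pdf (ltr01 : 0 < 1 :> R))).
have leM (r : R) : `|F r * (r / 1 ^+ 2 * normal_pdf 0 1 r)| <= M * (`|r| * normal_pdf 0 1 r).
  rewrite expr1n divr1 !normrM (ger0_norm (normal_pdf_ge0 _ _ _)).
  by rewrite ler_wpM2r ?mulr_ge0 ?normal_pdf_ge0.
have intD : mu.-integrable setT (EFin \o (fun r : R => F r * (r / 1 ^+ 2 * normal_pdf 0 1 r))).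
  apply: le_integrable intM => //; first exact/measurable_EFinP.
  move=> r _; rewrite /= lee_fin [leRHS]ger0_norm ?leM//.
  by rewrite !mulr_ge0// normal_pdf_ge0.
rewrite (le_trans (le_normr_Rintegral measurableT intD))//.
apply: (@le_trans _ _ (\int[mu]_r (M * (`|r| * normal_pdf 0 1 r)))).
  by apply: le_Rintegral => //; exact: integrable_norm.
rewrite RintegralZl//; last exact: integrable_norm_normal_pdf.
by rewrite {1}/Rintegral integral_norm_normal_pdf//= mul1r mulrC.
Qed.

End smoothing.

(** * Orthogonal preimages under [B] *)

Section hilbert.
Context (R : realType) (H : hilbertType R).
Implicit Types u v w : H.

Lemma dotpC u v : dotp u v = dotp v u.
Proof. by rewrite hermC expr0 mul1r. Qed.

Lemma dotpDr u v w : dotp u (v + w) = dotp u v + dotp u w.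
Proof. exact: linearDr. Qed.

Lemma dotpZr (c : R) u v : dotp u (c *: v) = c * dotp u v.
Proof. exact: linearZr_LR. Qed.

Lemma dotpDl u v w : dotp (u + v) w = dotp u w + dotp v w.
Proof. by rewrite dotpC dotpDr !(dotpC w). Qed.

Lemma dotpZl (c : R) u v : dotp (c *: u) v = c * dotp u v.
Proof. by rewrite dotpC dotpZr dotpC. Qed.

Lemma dotpNr u v : dotp u (- v) = - dotp u v.
Proof. by rewrite -scaleN1r dotpZr mulN1r. Qed.

Lemma dotpNl u v : dotp (- u) v = - dotp u v.
Proof. by rewrite dotpC dotpNr dotpC. Qed.

Lemma sqr_normD u v : `|u + v| ^+ 2 = `|u| ^+ 2 + 2 * dotp u v + `|v| ^+ 2.
Proof. by rewrite !sqr_normE dotpDl !dotpDr (dotpC v u); ring. Qed.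

Lemma sqr_normB u v : `|u - v| ^+ 2 = `|u| ^+ 2 - 2 * dotp u v + `|v| ^+ 2.
Proof. by rewrite sqr_normD dotpNr normrN; ring. Qed.

Lemma dotp_polar u v : dotp u v = 2^-1 * (`|u + v| ^+ 2 - `|u| ^+ 2 - `|v| ^+ 2).
Proof. by rewrite sqr_normD; field. Qed.

(** The form is tied to the topology only by [sqr_normE]; polarization transfers the continuity of
    the norm. *)
Lemma dotp_continuous : continuous (fun p : H * H => dotp p.1 p.2 : R).
Proof.
move=> p; rewrite (_ : (fun _ => _) =
    fun p : H * H => 2^-1 * (`|p.1 + p.2| ^+ 2 - `|p.1| ^+ 2 - `|p.2| ^+ 2)); last first.
  by apply/funext => q; exact: dotp_polar.
have sq (g : H * H -> H) : {for p, continuous g} ->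
    (fun q => `|g q| ^+ 2) @ p --> `|g p| ^+ 2.
  by move=> cg; apply: cvgM; exact: cvg_norm.
apply: cvgMr; apply: cvgB; first apply: cvgB.
- by apply: (sq (fun q => q.1 + q.2)); apply: cvgD; [exact: cvg_fst|exact: cvg_snd].
- by apply: (sq fst); exact: cvg_fst.
- by apply: (sq snd); exact: cvg_snd.
Qed.

Definition midpoint_closed (C : set H) : Prop :=
  forall u v, C u -> C v -> C (2^-1 *: (u + v)).

(* Elements of almost minimal norm form a Cauchy sequence by the parallelogram
   identity. *)
Lemma nested_midpoint_closed_min (C : nat -> set H) (M : R) :
  (forall n, closed (C n)) -> (forall n, midpoint_closed (C n)) ->
  (forall m n, (m <= n)%N -> C n `<=` C m) ->
  (forall n, exists2 u, C n u & `|u| <= M) ->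
  exists2 u, (forall n, C n u) & forall w, (forall n, C n w) -> `|u| <= `|w|.
Proof.
move=> cC mC dC CM.
pose N n := [set `|u| | u in C n].
have N0 n : has_inf (N n).
  split; first by have [u Cu _] := CM n; exists `|u|, u.
  by exists 0 => _ [u _ <-].
pose dist n := inf (N n).
have dist_le n u : C n u -> dist n <= `|u|.
  by move=> Cu; apply: ge_inf; [exact: (N0 n).2|exists u].
have dist_nd : {homo dist : m n / (m <= n)%N >-> m <= n}.
  move=> m n mn; apply: lb_le_inf; first exact: (N0 n).1.
  by move=> _ [u Cu <-]; apply: dist_le; exact: dC Cu.
have dist_ub n : dist n <= M.
  by have [u Cu uM] := CM n; exact: le_trans (dist_le _ _ Cu) uM.
have dist_cvg : cvgn dist.
  by apply: nondecreasing_is_cvgn => //; exists M => _ [n _ <-].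
have xP n : exists u, C n u /\ `|u| <= dist n + n.+1%:R^-1.
  have [_ [u Cu <-] ule] := @inf_adherent _ (N n) n.+1%:R^-1 ltac:(by []) (N0 n).
  by exists u; split => //; exact: ltW.
have [x xCle] := choice xP.
have dist0 n : 0 <= dist n.
  by apply: lb_le_inf; [exact: (N0 n).1|move=> _ [u _ <-]].
(* The midpoint of x n and x m lies in the larger set C m, so its norm is at least dist m; the rest
   is the parallelogram identity. *)
have xB m n : (m <= n)%N -> `|x n - x m| ^+ 2 <= 2 * (dist n + n.+1%:R^-1) ^+ 2 +
    2 * (dist m + m.+1%:R^-1) ^+ 2 - 4 * dist m ^+ 2.
  move=> mn; have [Cn xn] := xCle n; have [Cm xm] := xCle m.
  have := dist_le m _ (mC m _ _ (dC _ _ mn _ Cn) Cm).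
  have := sqr_normD (x n) (x m); have := sqr_normB (x n) (x m).
  rewrite normrZ ger0_norm ?invr_ge0// => -> pE le2.
  have sq (a b : R) : 0 <= a -> a <= b -> a ^+ 2 <= b ^+ 2.
    by move=> a0 ab; rewrite ler_sqr ?nnegrE// (le_trans a0).
  have := sq _ _ (normr_ge0 _) xn; have := sq _ _ (normr_ge0 _) xm.
  have := sq _ _ (dist0 m) le2; rewrite exprMn pE (_ : 2^-1 ^+ 2 = 4^-1 :> R); last by field.
  move: (dotp _ _) (`|x n| ^+ 2) (`|x m| ^+ 2) ((dist n + _) ^+ 2) ((dist m + _) ^+ 2) (dist m ^+ 2).
  by move=> a b c e f g; lra.
pose l := lim (dist @ \oo).
have d2 : dist n ^+ 2 @[n --> \oo] --> l ^+ 2 by apply: cvgM; exact: dist_cvg.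
have a2 : (dist n + n.+1%:R^-1) ^+ 2 @[n --> \oo] --> l ^+ 2.
  have da : dist n + n.+1%:R^-1 @[n --> \oo] --> l.
    rewrite -[l]addr0; apply: cvgD; first exact: dist_cvg.
    exact: cvg_harmonic.
  by apply: cvgM.
have /cauchy_cvgP x_cvg : cauchy (x @ \oo).
  apply/cauchy_exP => eps eps0.
  (* The bound [xB] has the form 2 a + 2 b - 4 c with a, b, c near l^2, so errors below eps^2 / 8
     add up to less than eps^2. *)
  have e8 : 0 < eps ^+ 2 / 8 by rewrite divr_gt0// exprn_gt0.
  have /cvgrPdist_lt/(_ _ e8) [N1 _ N1P] := d2.
  have /cvgrPdist_lt/(_ _ e8) [N2 _ N2P] := a2.
  pose N3 := maxn N1 N2; exists (x N3); exists N3 => // n /= N3n.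
  rewrite -ball_normE /= distrC.
  have N2n : (N2 <= n)%N by rewrite (leq_trans _ N3n)// leq_maxr.
  have := xB _ _ N3n; have := N1P N3 (leq_maxl _ _); have := N2P N3 (leq_maxr _ _).
  have := N2P n N2n; rewrite /= !ltr_norml => /andP[h1 h2] /andP[h3 h4] /andP[h5 h6] h7.
  have gen (a b c L e q : R) : - (e / 8) < L - a -> L - a < e / 8 ->
      - (e / 8) < L - b -> L - b < e / 8 -> - (e / 8) < L - c -> L - c < e / 8 ->
      q <= 2 * a + 2 * b - 4 * c -> q < e by lra.
  rewrite -ltr_sqr ?nnegrE ?(ltW eps0)//; exact: gen h1 h2 h3 h4 h5 h6 h7.
pose z := lim (x @ \oo).
have zC n : C n z.
  apply: (@closed_cvg _ _ (\oo) _ x (C n) (cC n)) => //.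
  by exists n => // m /= nm; apply: (dC _ _ nm); case: (xCle m).
exists z => // w wC.
have zl : `|x n| @[n --> \oo] --> `|z| by exact: cvg_norm.
have wl : `|w| + n.+1%:R^-1 @[n --> \oo] --> `|w|.
  rewrite -[X in _ --> X]addr0; apply: cvgD; first exact: cvg_cst.
  exact: cvg_harmonic.
apply: (ler_cvg_to zl wl); apply: nearW => n.
by rewrite (le_trans (xCle n).2)// lerD2r dist_le.
Qed.

Section orthogonal_preimage.
Context (E : completeNormedModType R) (B : {linear H -> E}).
Hypothesis B_continuous : continuous B.

Definition orthogonal_to_ker h := forall k, B k = 0 -> dotp h k = 0.

Lemma orthogonal_to_ker_lin (c : R) u v : orthogonal_to_ker u ->
  orthogonal_to_ker v -> orthogonal_to_ker (c *: (u + v)).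
Proof.
by move=> uK vK k Bk; rewrite dotpZl dotpDl uK// vK// addr0 mulr0.
Qed.

Lemma orthogonal_to_ker_closed : closed orthogonal_to_ker.
Proof.
have -> : orthogonal_to_ker = \bigcap_(k in [set k | B k = 0]) [set h | dotp h k = 0].
  by apply/seteqP; split=> h hK k Bk; exact: hK.
apply: closed_bigI => k _.
apply: (@closed_comp _ _ (fun h => dotp h k : R^o) [set (0 : R^o)]); last exact: closed_eq.
move=> h _; apply: (@continuous_comp _ _ _ (fun h => (h, k)) (fun p => dotp p.1 p.2 : R^o)).
  by apply: cvg_pair; [exact: cvg_id|exact: cvg_cst].
exact: dotp_continuous.
Qed.

Lemma orthogonal_preimage_unique u v : B u = B v -> orthogonal_to_ker u ->
  orthogonal_to_ker v -> u = v.
Proof.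
move=> Buv uK vK; apply/eqP; rewrite -subr_eq0 -normr_eq0 -sqrf_eq0 sqr_normE.
have Buv0 : B (u - v) = 0 by rewrite linearB/= Buv subrr.
by rewrite dotpDl dotpNl uK// vK// subrr.
Qed.

(** The preimage of least norm works: moving it along a kernel vector keeps it a preimage and cannot
    shorten it. *)
Lemma orthogonal_preimage_exists y : range B y ->
  exists h, B h = y /\ orthogonal_to_ker h.
Proof.
move=> [h0 _ Bh0].
have cBy : closed [set h | B h = y].
  apply: (@closed_comp _ _ B [set y]); first by move=> h _; exact: B_continuous.
  exact: (accessible_closed_set1 (hausdorff_accessible (@norm_hausdorff _ E))).
have [| | | |h Bh hmin] := @nested_midpoint_closed_min (fun=> [set h | B h = y]) `|h0|.
- by [].
- move=> _ u v /= Bu Bv; rewrite linearZ linearD/= Bu Bv -[X in X + X]scale1r -scalerDl.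
  by rewrite scalerA mulVf// scale1r.
- by move=> m n _ h.
- by move=> _; exists h0.
exists h; split; first exact: (Bh 0%N).
move=> k Bk; apply/eqP; rewrite -normr_eq0.
have quad (c : R) : 0 <= 2 * c * dotp h k + c ^+ 2 * dotp k k.
  have : `|h| <= `|h + c *: k|.
    by apply: hmin => _ /=; rewrite linearD linearZ/= Bk scaler0 addr0; exact: (Bh 0%N).
  rewrite -ler_sqr ?nnegrE// sqr_normD normrZ exprMn real_normK ?num_real// dotpZr.
  by rewrite (sqr_normE k); lra.
have k0 : 0 <= dotp k k by rewrite -sqr_normE sqr_ge0.
(* Near the minimiser of the quadratic; the added 1 keeps the denominator positive when k = 0 and
   still gives a negative value unless dotp h k = 0. *)
have := quad (- dotp h k / (dotp k k + 1)).
have -> : 2 * (- dotp h k / (dotp k k + 1)) * dotp h k +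
    (- dotp h k / (dotp k k + 1)) ^+ 2 * dotp k k =
    - (dotp h k ^+ 2 * (dotp k k + 2) / (dotp k k + 1) ^+ 2).
  by field; rewrite gt_eqF// ltr_wpDl.
rewrite oppr_ge0 pmulr_lle0 ?invr_gt0 ?exprn_gt0 ?ltr_wpDl//.
rewrite pmulr_lle0 ?ltr_wpDl// => hk.
by rewrite normr_eq0 -sqrf_eq0 eq_le hk sqr_ge0.
Qed.

(* Weak compactness in disguise: preimages of a point [y] of the closure that
   are better and better approximate form nested closed convex bounded sets. *)
Lemma closed_image_orthogonal_ball (h : H) (r : R) :
  closed (B @` [set k | orthogonal_to_ker k /\ `|k - h| <= r]).
Proof.
move=> y ycl.
pose C n := [set k | [/\ orthogonal_to_ker k, `|k - h| <= r & `|B k - y| <= n.+1%:R^-1]].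
have [| | | |x Cx _] := @nested_midpoint_closed_min C (r + `|h|).
- move=> n; rewrite (_ : C n = orthogonal_to_ker `&` ([set k | `|k - h| <= r] `&`
    [set k | `|B k - y| <= n.+1%:R^-1])); last first.
    by apply/seteqP; split=> k [? // [? ?]].
  apply: closedI; first exact: orthogonal_to_ker_closed.
  apply: closedI.
    apply: (@closed_comp _ _ (fun k => `|k - h|) [set z | z <= r]); last exact: closed_le.
    by move=> k _; apply: cvg_norm; apply: cvgB; [exact: cvg_id|exact: cvg_cst].
  apply: (@closed_comp _ _ (fun k => `|B k - y|) [set z | z <= n.+1%:R^-1]); last exact: closed_le.
  by move=> k _; apply: cvg_norm; apply: cvgB; [exact: B_continuous|exact: cvg_cst].
- move=> n u v [uK ur uy] [vK vr vy]; split; first exact: orthogonal_to_ker_lin.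
  + have -> : 2^-1 *: (u + v) - h = 2^-1 *: ((u - h) + (v - h)).
      rewrite addrACA -opprD scalerBr; congr (_ - _).
      by rewrite -[X in X + X]scale1r -scalerDl scalerA mulVf// scale1r.
    rewrite normrZ ger0_norm ?invr_ge0// ler_pdivrMl//.
    by rewrite (le_trans (ler_normD _ _))// mulr_natl mulr2n lerD.
  + have -> : B (2^-1 *: (u + v)) - y = 2^-1 *: ((B u - y) + (B v - y)).
      rewrite linearZ linearD/= addrACA -opprD scalerBr; congr (_ - _).
      by rewrite -[X in X + X]scale1r -scalerDl scalerA mulVf// scale1r.
    rewrite normrZ ger0_norm ?invr_ge0// ler_pdivrMl//.
    by rewrite (le_trans (ler_normD _ _))// mulr_natl mulr2n lerD.
- move=> m n mn k [kK kr ky]; split=> //; rewrite (le_trans ky)// lef_pV2 ?posrE//.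
  by rewrite ler_nat ltnS.
- move=> n; have [_ [[k [kK kr] <-] yk]] := ycl _ (nbhsx_ballx y n.+1%:R^-1 ltac:(by [])).
  exists k; first by split=> //; move: yk; rewrite -ball_normE /= distrC => /ltW.
  by rewrite -[k](subrK h) (le_trans (ler_normD _ _))// lerD2r.
exists x; first by have [] := Cx 0%N.
apply/eqP; rewrite -subr_eq0 -normr_le0; apply/ler_addgt0Pr => e e0; rewrite add0r.
have [n _ /(_ n (leqnn n)) ne] := near_infty_natSinv_lt (PosNum e0).
by have [_ _ /le_trans -> //] := Cx n; exact: ltW.
Qed.

End orthogonal_preimage.

End hilbert.

(* Away from its interior, such a set is countable: disjoint right
   neighbourhoods of its points contain distinct rationals. *)
Lemma right_open_measurable (R : realType) (A : set R) :
  (forall s, A s -> exists2 e, 0 < e & forall r, s <= r < s + e -> A r) ->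
  measurable A.
Proof.
move=> rA.
have [q qP] : exists q : R -> rat, forall s, A s -> exists2 e, s < ratr (q s) < s + e &
    forall r, s <= r < s + e -> A r.
  suff /choice[q qP] : forall s, exists q : rat, A s -> exists2 e, s < ratr q < s + e &
    forall r, s <= r < s + e -> A r by exists q.
  move=> s; have [As|nAs] := pselect (A s); last by exists 0.
  have [e e0 eA] := rA s As.
  have [q] := @rat_in_itvoo R s (s + e) ltac:(by rewrite ltrDl).
  by rewrite in_itv/= => sq; exists q => _; exists e.
have int s r e : (forall r, s <= r < s + e -> A r) -> s < r < s + e -> A^° r.
  move=> eA /andP[sr re]; apply: (filterS (P := `]s, s + e[%classic)).
    move=> z /=; rewrite in_itv/= => /andP[sz ze]; apply: eA; rewrite ze andbT; exact: ltW.
  by apply: near_in_itvoo; rewrite in_itv/= sr.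
have lt_q s r : A s -> (A `\` A^°) r -> s < r -> ratr (q s) < ratr (q r) :> R.
  move=> As [Ar nAr] sr; have [e /andP[_ qe] eA] := qP s As.
  have [e' /andP[rq _] _] := qP r Ar.
  rewrite (lt_trans qe)// (le_lt_trans _ rq)// leNgt; apply/negP => re.
  by apply: nAr; apply: int eA _; rewrite sr.
have cA : countable (A `\` A^°).
  apply/countable_injP; exists (pickle \o q) => s r /set_mem As /set_mem Ar.
  move=> /(pcan_inj pickleK) qsr; apply/eqP; rewrite eq_le !leNgt; apply/andP; split.
    by apply/negP => /(lt_q _ _ Ar.1 As); rewrite qsr ltxx.
  by apply/negP => /(lt_q _ _ As.1 Ar); rewrite qsr ltxx.
have -> : A = A^° `|` (A `\` A^°).
  by rewrite setDE setUIr setUv setIT; apply/esym/setUidPr; exact: interior_subset.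
apply: measurableU; first by apply: open_measurable; exact: open_interior.
by apply: countable_measurable.
Qed.

(** * Measurability of the orthogonal preimage along an orbit *)

Section preimage_path.
Context (R : realType) (H : hilbertType R) (E : completeNormedModType R).
Context (S : R -> {linear E -> E}) (B : {linear H -> E}) (t : R) (xi : E).
Context (e : nat -> H).
Hypothesis S_semigroup : C0_semigroup S.
Hypothesis B_continuous : continuous B.
Hypothesis e_dense : forall h, closure (range e) h.

(** The semigroup law gives right continuity of the orbit directly, since S (s + r) xi = S s (S r
    xi), and a set open to the right is already measurable. *)
Lemma measurable_orbit_open (U : set E) : open U ->
  measurable (`]0, t[ `&` [set s | U (S s xi)]).
Proof.
move=> oU; apply: right_open_measurable => s [/= st Us].
have [cS S0 SD Sc] := S_semigroup.
move: st; rewrite in_itv/= => /andP[s0 st].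
have cs : S (s + r) xi @[r --> 0^'+] --> S s xi.
  have : S s (S r xi) @[r --> 0^'+] --> S s xi.
    by apply: (@cvg_comp _ _ _ (S^~ xi) (S s)); [exact: Sc|exact: (cS s (ltW s0))].
  apply: cvg_trans; apply: near_eq_cvg; near=> r.
  have r0 : 0 < r by near: r; exact: nbhs_right_gt.
  by rewrite (SD s r (ltW s0) (ltW r0)).
have /cs : nbhs (S s xi) U by exact: open_nbhs_nbhs.
move=> [/= e1 e10 eU]; exists (Num.min e1 (t - s)); first by rewrite lt_min e10 subr_gt0.
move=> r /andP[]; rewrite le_eqVlt => /orP[/eqP<- _|sr rs].
  by split=> //=; rewrite in_itv/= s0.
have rs0 : 0 < r - s by rewrite subr_gt0.
move: rs; rewrite -ltrBlDl lt_min => /andP[re rt]; split => /=.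
  by rewrite in_itv/= (lt_trans s0 sr)/= -(ltrD2r (- s)).
have := eU (r - s); rewrite /ball_/= sub0r normrN gtr0_norm// (addrC s) subrK.
exact.
Unshelve. all: end_near. Qed.

Lemma measurable_orbit_closed (F : set E) : closed F ->
  measurable (`]0, t[ `&` [set s | F (S s xi)]).
Proof.
move=> cF; rewrite (_ : _ `&` _ = `]0, t[ `\` (`]0, t[ `&` [set s | (~` F) (S s xi)])).
  by apply: measurableD => //; apply: measurable_orbit_open; exact: closed_openC.
apply/seteqP; split=> s [st]; first by move=> Fs; split=> // -[].
by move=> nF; split=> //=; apply: contrapT => nFs; apply: nF.
Qed.

(** By uniqueness of orthogonal preimages, S s xi lies in this set exactly when it is in the range
    of [B] with preimage within r of h. A condition on the preimage thus becomes a closed condition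
    on the orbit. *)
Let C h r := B @` [set k | orthogonal_to_ker B k /\ `|k - h| <= r].

(** The same choice as in [range_norm], so the norm of the path is [range_norm B (S s xi)] by
    definition, with default value 0 off the range. *)
Definition preimage_path (s : R) : H :=
  xget 0 [set h | B h = S s xi /\ orthogonal_to_ker B h].

Lemma preimage_pathP s : range B (S s xi) ->
  B (preimage_path s) = S s xi /\ orthogonal_to_ker B (preimage_path s).
Proof.
move=> /(orthogonal_preimage_exists B_continuous)[h hP].
exact: (@xgetI _ 0 [set h | B h = S s xi /\ orthogonal_to_ker B h] h).
Qed.

Lemma preimage_path_out s : ~ range B (S s xi) -> preimage_path s = 0.
Proof.
move=> nB; apply: xgetPN => h [Bh _]; apply: nB; by exists h.
Qed.

(** The range of [B] need not be closed, but it is the union of the closed images of the orthogonal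
    balls of integer radius. *)
Lemma measurable_orbit_range : measurable (`]0, t[ `&` [set s | range B (S s xi)]).
Proof.
have -> : `]0, t[ `&` [set s | range B (S s xi)] =
    \bigcup_n (`]0, t[ `&` [set s | C 0 n%:R (S s xi)]).
  apply/seteqP; split=> [s [st Bs]|s [n _ [st [k _ kE]]]]; last first.
    by split=> //=; exists k.
  have [Bk kK] := preimage_pathP Bs.
  have [n kn] : exists n, `|preimage_path s| < n%:R.
    by exists (Num.bound `|preimage_path s|); rewrite archi_boundP.
  exists n => //; split=> //=; exists (preimage_path s) => //; split=> //.
  by rewrite subr0 ltW.
apply: bigcupT_measurable => n; apply: measurable_orbit_closed.
exact: closed_image_orthogonal_ball.
Qed.

(** On times when the orbit is in the range, U is covered by countably many closed balls inside it,
    each giving a closed condition. At the other times the path is 0, so only whether U contains 0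
    matters. *)
Lemma measurable_preimage_path_open (U : set H) : open U ->
  measurable (`]0, t[ `&` preimage_path @^-1` U).
Proof.
move=> oU.
pose Dr := `]0, t[ `&` [set s | range B (S s xi)].
pose D0 := `]0, t[ `\` Dr.
have mDr : measurable Dr by exact: measurable_orbit_range.
have -> : `]0, t[ `&` preimage_path @^-1` U =
    (\bigcup_(p in [set p : nat * nat | closed_ball (e p.1) p.2.+1%:R^-1 `<=` U])
      (`]0, t[ `&` [set s | C (e p.1) p.2.+1%:R^-1 (S s xi)])) `|` (D0 `&` [set s | U 0]).
  apply/seteqP; split=> [s [st Us]|s].
    have [Bs|nBs] := pselect (range B (S s xi)); last first.
      right; split; first by split=> // -[].
      by move: Us; rewrite /= preimage_path_out.
    left; have [Bk kK] := preimage_pathP Bs.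
    have /nbhs_ballP[r /= r0 rU] : nbhs (preimage_path s) U by exact: open_nbhs_nbhs.
    have [n nr] : exists n : nat, n.+1%:R^-1 < r / 2.
      have r2 : 0 < r / 2 by rewrite divr_gt0.
      by have [n _ /(_ n (leqnn n))] := near_infty_natSinv_lt (PosNum r2); exists n.
    have [_ [[i _ <-]]] := e_dense (nbhsx_ballx (preimage_path s) n.+1%:R^-1 ltac:(by [])).
    rewrite -ball_normE /= => ki.
    exists (i, n) => /=; last first.
      by split=> //=; exists (preimage_path s) => //; split=> //; exact: ltW.
    move=> y; rewrite closed_ballE// /closed_ball_ /= => yi; apply: rU.
    rewrite -ball_normE /= -(subrKA (e i)) (le_lt_trans (ler_normD _ _))//.
    by rewrite (splitr r) ltrD// ?(lt_trans ki)// (le_lt_trans yi).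
  move=> [[[i n] /= sub [st [k [kK ki] Bk]]]|[[st nB] U0]].
    split=> //=; apply: sub; rewrite closed_ballE// /closed_ball_ /= distrC.
    have Bs : range B (S s xi) by exists k.
    have [Bk' k'K] := preimage_pathP Bs.
    by rewrite (@orthogonal_preimage_unique _ _ _ B (preimage_path s) k)// Bk.
  split=> //=; rewrite preimage_path_out// => Bs; apply: nB; by split.
apply: measurableU.
  rewrite bigcup_mkcond; apply: countable_bigcupT_measurable => // p.
  by case: ifP => _ //; apply: measurable_orbit_closed; exact: closed_image_orthogonal_ball.
apply: measurableI; first exact: measurableD.
have [U0|nU0] := pselect (U 0).
  by rewrite (_ : [set _ | _] = setT)//; apply/seteqP; split.
by rewrite (_ : [set _ | _] = set0)//; apply/seteqP; split.
Qed.

End preimage_path.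

(** * Steering controls *)

Section restrict_itv.
Context (R : realType) (t : R).
Local Notation mu := (@lebesgue_measure R).

Lemma integral_restrict_itv (g : R -> \bar R) : (forall s, s \notin `]0, t[ -> g s = 0%E) ->
  (\int[mu]_(s in `[0%R, +oo[) g s = \int[mu]_(s in `]0%R, t[) g s)%E.
Proof.
move=> g0.
have -> : g = g \_ `]0, t[.
  apply/funext => s; rewrite patchE; case: ifPn => // /negP snot; apply: g0.
  by apply/negP => st; apply: snot; exact: mem_set.
rewrite -integral_mkcondr [RHS]integral_mkcond [LHS]integral_mkcond.
congr (\int[mu]_s _)%E; apply/funext => s; rewrite !patchE.
have [st|nst] := boolP (s \in (`]0, t[%classic : set R)); last first.
  by case: ifPn => // /set_mem[_ st]; move/negP : nst; case; exact: mem_set.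
rewrite mem_set//; move/set_mem : st => /= st; split=> //=.
by move: st; rewrite !in_itv/= andbT => /andP[/ltW].
Qed.

Lemma Rintegral_restrict_itv (g : R -> R) : (forall s, s \notin `]0, t[ -> g s = 0) ->
  \int[mu]_(s in `[0, +oo[) g s = \int[mu]_(s in `]0, t[) g s.
Proof.
move=> g0; rewrite /Rintegral integral_restrict_itv// => s /g0 ->.
by [].
Qed.

End restrict_itv.

Lemma Linfty_bound (R : realType) (t : R) (u : R -> R) : 0 < t ->
  (Linfty_norm t u < +oo)%E ->
  0 <= fine (Linfty_norm t u) /\
  {ae @lebesgue_measure R, forall s, s \in `]0, t[ -> `|u s| <= fine (Linfty_norm t u)}.
Proof.
move=> t0 uoo.
have N0 : (0 <= Linfty_norm t u)%E by exact: Lnorm_ge0.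
split; first exact: fine_ge0.
have Nfin : Linfty_norm t u \is a fin_num by rewrite ge0_fin_numE.
have : {ae lebesgue_on t, forall s, (`|(u s)%:E| <= Linfty_norm t u)%E}.
  have mut : (0 < lebesgue_on t setT)%E.
    by rewrite /lebesgue_on /mrestr setTI lebesgue_measure_itv/= lte_fin t0 sube0 lte_fin.
  (* Positive total mass selects the branch of the norm that is the essential supremum. *)
  rewrite /Linfty_norm unlock mut.
  exact: (ess_sup_ge (lebesgue_on t) (abse \o (EFin \o u))).
move=> [A [mA A0 uA]].
(* Null for the restricted measure means Lebesgue null after intersection with the interval. *)
exists (A `&` `]0, t[); split; first exact: measurableI.
  exact: A0.
move=> s /= /not_implyP[st us]; split=> //; apply: uA => /= us'; apply: us.
by rewrite -lee_fin fineK.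
Qed.

Section control.
Context (R : realType) (H : hilbertType R) (t : R) (k : R -> H) (b : R -> R) (L : R).
Context (e : nat -> H).
Local Notation mu := (@lebesgue_measure R).
Hypothesis e_dense : forall h, closure (range e) h.
Hypothesis k_open : forall U, open U -> measurable (`]0, t[ `&` k @^-1` U).
Hypothesis k_int : (\int[mu]_(s in `]0%R, t[) (`|k s| ^+ 2)%:E < +oo)%E.
Hypothesis b_meas : measurable_fun `]0, t[ (b : measurableTypeR R -> R).
Hypothesis L0 : 0 <= L.
Hypothesis b_le : {ae mu, forall s, s \in `]0, t[ -> `|b s| <= L}.

Definition control (s : R) : H := if s \in `]0, t[ then b s *: k s else 0.

Lemma measurable_control_open (U : set H) : open U ->
  measurable (`[0, +oo[ `&` control @^-1` U).
Proof.
move=> oU; have [q qP] := dense_rat_seq R.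
have mb : measurable (`]0, t[ `&` [set s | U (b s *: k s)]).
  apply: (@measurable_pair_open _ R R R^o H `]0, t[ b k q e _ _ _ _
    [set p | U ((p.1 : R) *: p.2)]) => //.
  - by move=> V oV; apply: measurable_fun_open.
  - apply: (@open_comp _ _ (fun p : R^o * H => (p.1 : R) *: p.2)) => // p _.
    by apply: cvgZ; [exact: cvg_fst|exact: cvg_snd].
have -> : `[0, +oo[ `&` control @^-1` U =
    (`]0, t[ `&` [set s | U (b s *: k s)]) `|` ((`[0, +oo[ `\` `]0, t[) `&` [set s | U 0]).
  apply/seteqP; split=> s.
    move=> [s0]; rewrite /control /=; case: ifPn => [st Us|nst U0]; [by left|right].
    by split=> //; split=> //; exact/negP.
  move=> [[st Us]|[[s0 /negP nst] U0]].
    split; first by move: st; rewrite /= !in_itv/= andbT => /andP[/ltW].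
    by rewrite /control /= (_ : s \in `]0, t[).
  by split=> //; rewrite /control /= (negbTE nst).
apply: measurableU => //; apply: measurableI; first exact: measurableD.
have [U0|nU0] := pselect (U 0).
  by rewrite (_ : [set _ | _] = setT)//; apply/seteqP; split.
by rewrite (_ : [set _ | _] = set0)//; apply/seteqP; split.
Qed.

Let mk2 : measurable_fun `]0, t[ (fun s : measurableTypeR R => `|k s| ^+ 2).
Proof.
apply: measurable_funX.
apply: (@measurableT_comp _ _ _ _ (borel H) _ (fun h => `|h|)).
  by apply: continuous_borel_real; exact: norm_continuous.
exact: borel_measurableP.
Qed.

Let int_control_le : (\int[mu]_(s in `[0%R, +oo[) (`|control s| ^+ 2)%:E <=
  (L ^+ 2)%:E * \int[mu]_(s in `]0%R, t[) (`|k s| ^+ 2)%:E)%E.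
Proof.
rewrite (@integral_restrict_itv R t); last first.
  by move=> s /negbTE nst; rewrite /control nst normr0 expr0n.
have mk2E : measurable_fun `]0, t[ (fun s : measurableTypeR R => (`|k s| ^+ 2)%:E).
  exact/measurable_EFinP.
rewrite -ge0_integralZl//; last by rewrite lee_fin sqr_ge0.
have E : (\int[mu]_(s in `]0%R, t[) (`|control s| ^+ 2)%:E =
    \int[mu]_(s in `]0%R, t[) (b s ^+ 2 * `|k s| ^+ 2)%:E)%E.
  apply: eq_integral => s; rewrite inE /= => st.
  by rewrite /control st normrZ exprMn real_normK ?num_real.
rewrite E; apply: ae_ge0_le_integral => //.
- by move=> s _; rewrite lee_fin mulr_ge0 ?sqr_ge0.
- by apply/measurable_EFinP; apply: measurable_funM => //; exact: measurable_funX.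
- by move=> s _; rewrite -EFinM lee_fin mulr_ge0 ?sqr_ge0.
- exact: measurable_funeM.
- apply: (@filterS _ _ (ae_filter_ringOfSetsType mu) _ _ _ b_le) => s bs st.
  rewrite -EFinM lee_fin ler_wpM2r ?sqr_ge0//.
  by rewrite -(real_normK (num_real (b s))) lerXn2r ?nnegrE// bs.
Qed.

Lemma L2_control : L2 control.
Proof.
split; first by apply: borel_measurableP => U; exact: measurable_control_open.
apply: (le_lt_trans int_control_le); apply: lte_mul_pinfty => //.
by rewrite lee_fin sqr_ge0.
Qed.

Lemma L2_norm_control :
  L2_norm control <= L * Num.sqrt (\int[mu]_(s in `]0, t[) (`|k s| ^+ 2)).
Proof.
rewrite /L2_norm -{1}(ger0_norm L0) -sqrtr_sqr -sqrtrM ?sqr_ge0//.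
apply: ler_wsqrtr; rewrite /L2_dotp.
under eq_Rintegral do rewrite -sqr_normE.
have fin1 : (\int[mu]_(s in `]0%R, t[) (`|k s| ^+ 2)%:E)%E \is a fin_num.
  by rewrite ge0_fin_numE// integral_ge0// => s _; rewrite lee_fin sqr_ge0.
have fin2 : (\int[mu]_(s in `[0%R, +oo[) (`|control s| ^+ 2)%:E)%E \is a fin_num.
  rewrite ge0_fin_numE; first exact: L2_control.2.
  by apply: integral_ge0 => s _; rewrite lee_fin sqr_ge0.
by rewrite /Rintegral -lee_fin fineK// EFinM fineK.
Qed.

End control.

(** * Pointwise form of the adjoint *)

Section adjoint.
Context (R : realType) (H : hilbertType R) (E : completeNormedModType R).
Local Notation mu := (@lebesgue_measure R).

(** Almost everywhere F is the derivative of its primitive, and near a point of the open interval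
    this primitive is identically zero. *)
Lemma ae_eq0_of_integral_itv (t : R) (F : R -> R) : mu.-integrable setT (EFin \o F) ->
  (forall x, x \in `]0, t[ -> \int[mu]_(s in `[0, x]) F s = 0) ->
  {ae mu, forall s, s \in `]0, t[ -> F s = 0}.
Proof.
move=> iF F0.
have locF : locally_integrable setT F by apply: open_integrable_locally => //; exact: openT.
have := @FTC1 R F (BLeft 0) _ locF.
have intF y : mu.-integrable [set` Interval (BLeft 0) (BRight y)] (EFin \o F).
  by apply: (integrableS measurableT).
move=> /(_ intF); apply: (@filterS _ _ (ae_filter_ringOfSetsType mu)) => s Fs st.
have [|_ <-] := Fs; first by move: st; rewrite in_itv/= => /andP[s0 _]; rewrite lte_fin.
rewrite derive1E; apply: (@derive_val _ _ _ _ _ _ 0).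
apply: (@near_eq_is_derive R R^o R^o (cst (0 : R^o))).
near=> x; rewrite F0//; near: x; exact: (near_in_itvoo st).
Unshelve. all: end_near. Qed.

Context (t : R) (S : R -> {linear E -> E}) (B : {linear H -> E}).
Context (I : (R -> H) -> E) (phi : {linear E -> R^o}) (g : R -> H) (e : nat -> H).
Hypothesis S_semigroup : C0_semigroup S.
Hypothesis B_continuous : continuous B.
Hypothesis e_dense : forall h, closure (range e) h.
Hypothesis SB_int : stochastically_integrable
  (extend0 t (fun s => (S s \o B : {linear H -> E}))).
Hypothesis I_op : integral_operator
  (extend0 t (fun s => (S (t - s) \o B : {linear H -> E}))) I.
Hypothesis phi_continuous : continuous phi.
Hypothesis g_adjoint : L2_adjoint_at I phi g.

Let Phi s h : R := phi (extend0 t (fun s => (S (t - s) \o B : {linear H -> E})) s h).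

Let extend0_in (G : R -> {linear H -> E}) s h : 0 <= s <= t -> extend0 t G s h = G s h.
Proof. by move=> st; rewrite /extend0 in_itv/= st. Qed.

Let extend0_out (G : R -> {linear H -> E}) s h : ~~ (0 <= s <= t) -> extend0 t G s h = 0.
Proof. by move=> /negbTE st; rewrite /extend0 in_itv/= st. Qed.

(** Square integrability is available for the forward integrand S s B; reflecting s into t - s
    transfers it to [Phi]. *)
Let integrable_Phi (h : H) : mu.-integrable setT (EFin \o (Phi ^~ h)).
Proof.
pose w s : R := phi (extend0 t (fun s => (S s \o B : {linear H -> E})) s h).
have w0 s : s < 0 -> w s = 0.
  by move=> s0; rewrite /w extend0_out ?linear0// negb_and -ltNge s0.
have [_ /(_ h phi phi_continuous)[mw iw] _] := SB_int.
have {}mw : measurable_fun setT (w : R -> R).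
  have -> : w = w \_ `[0, +oo[.
    apply/funext => s; rewrite patchE; case: ifPn => // /negP s0; apply: w0.
    by rewrite ltNge; apply/negP => s0'; apply: s0; apply: mem_set; rewrite /= in_itv/= s0'.
  by apply/(measurable_restrictT _ _).1.
have PhiE s : Phi s h = w (t - s).
  rewrite /Phi /w; have [st|st] := boolP (0 <= s <= t).
    by rewrite !extend0_in//; move: st => /andP[? ?]; apply/andP; split; lra.
  rewrite !extend0_out//; apply: contra st => /andP[? ?]; apply/andP; split; lra.
have mPhi : measurable_fun setT (Phi ^~ h).
  rewrite (_ : Phi ^~ h = fun s => w (t - s)); last by apply/funext => s; exact: PhiE.
  by apply: (measurableT_comp mw); exact: measurable_funB.
have iPhi2 : (\int[mu]_s ((Phi s h) ^+ 2)%:E < +oo)%E.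
  under eq_integral do rewrite PhiE.
  have mw2 : measurable_fun setT (fun s => (w s ^+ 2)%:E).
    by apply/measurable_EFinP; exact: measurable_funX.
  rewrite (integral_reflect t mw2); last by move=> s; rewrite lee_fin sqr_ge0.
  rewrite (_ : (fun s => (w s ^+ 2)%:E) = (fun s => (w s ^+ 2)%:E) \_ `[0, +oo[).
    by rewrite -integral_mkcond.
  apply/funext => s; rewrite patchE; case: ifPn => // /negP s0; rewrite w0 ?expr0n//.
  by rewrite ltNge; apply/negP => s0'; apply: s0; apply: mem_set; rewrite /= in_itv/= s0'.
have int2 : mu.-integrable setT (fun s => (Phi s h ^+ 2)%:E).
  apply/integrableP; split; first by apply/measurable_EFinP; exact: measurable_funX.
  by under eq_integral do rewrite /= ger0_norm ?sqr_ge0//.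
have int1 := @integrable_indic_itv R 0 t true false.
(* Square integrable on a bounded interval implies integrable, by |y| <= 1 + y^2 on [0, t]. *)
apply: (@le_integrable _ _ _ mu setT measurableT _ (fun s => ((\1_`[0, t] s : R) + Phi s h ^+ 2)%:E)).
- exact/measurable_EFinP.
- move=> s _; rewrite /= lee_fin [leRHS]ger0_norm ?addr_ge0 ?sqr_ge0//.
  have [st|st] := boolP (0 <= s <= t); last first.
    by rewrite /Phi extend0_out// linear0 normr0 addr_ge0 ?sqr_ge0.
  rewrite indicE mem_set/= ?in_itv//= -(real_normK (num_real (Phi s h))).
  have := normr_ge0 (Phi s h); have : 0 <= (`|Phi s h| - 1) ^+ 2 by rewrite sqr_ge0.
  nra.
- by under eq_fun do rewrite EFinD; apply: integrableD.
Qed.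

Let L2_step (x : R) (h : H) : L2 (step `[0, x[ h).
Proof.
split.
  apply: measurable_funTS.
  apply: (@measurableT_comp _ _ _ _ _ _ ((fun c : R => c *: h) : R -> borel H)).
    apply: borel_measurableP => U oU; rewrite setTI; apply: open_measurable.
    apply: (@open_comp _ _ (fun c : R^o => c *: h)) => // c _.
    by apply: cvgZr_tmp; exact: cvg_id.
  exact: measurable_indic.
have -> : (\int[mu]_(s in `[0%R, +oo[) (`|step `[0%R, x[ h s| ^+ 2)%:E =
    \int[mu]_(s in `[0%R, +oo[) (((cst (`|h| ^+ 2)%:E) \_ `[0%R, x[) s))%E.
  apply: eq_integral => s _; rewrite /step patchE indicE.
  by case: (_ \in _); rewrite ?scale1r// scale0r normr0 expr0n.
rewrite -integral_mkcondr integral_cst; last exact: measurableI.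
apply: lte_mul_pinfty => //.
apply: (@le_lt_trans _ _ (mu `[0, x[)).
  by apply: le_measure; rewrite ?inE//; exact: measurableI.
by rewrite lebesgue_measure_itv/=; case: ifP => _; rewrite ?ltry.
Qed.

Let measurable_dotp (h : H) : measurable_fun (`[0, +oo[ : set R)
  (fun s : measurableTypeR R => dotp (g s) h : R).
Proof.
have [[mg _] _] := g_adjoint.
apply: (@measurableT_comp _ _ _ _ (borel H) _ ((fun u => dotp u h) : borel H -> R)) => //.
apply: continuous_borel_real => u.
apply: (@continuous_comp _ _ _ (fun u => (u, h)) (fun p => dotp p.1 p.2 : R^o)).
  by apply: cvg_pair; [exact: cvg_id|exact: cvg_cst].
exact: dotp_continuous.
Qed.

Let sub_itv (x : R) : `[0, x] `<=` (`[0, +oo[ : set R).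
Proof. by move=> s /=; rewrite !in_itv/= andbT => /andP[]. Qed.

Let integrable_dotp (h : H) (x : R) : mu.-integrable `[0, x] (EFin \o (fun s => dotp (g s) h : R)).
Proof.
have [[mg ig] _] := g_adjoint.
have mx : measurable_fun (`[0, x] : set R) (fun s : measurableTypeR R => dotp (g s) h : R).
  have m0 : measurable (`[0, +oo[ : set R) by [].
  exact: (measurable_funS m0 (@sub_itv x) (measurable_dotp h)).
have mg2 : measurable_fun (`[0, +oo[ : set R) (fun s : measurableTypeR R => `|g s| ^+ 2).
  apply: measurable_funX.
  apply: (@measurableT_comp _ _ _ _ (borel H) _ (fun h => `|h|)) => //.
  by apply: continuous_borel_real; exact: norm_continuous.
have ig2 : mu.-integrable `[0, x] (EFin \o (fun s => `|g s| ^+ 2)).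
  refine (@integrableS _ _ _ mu _ _ _ _ _ (@sub_itv x) _) => //.
  apply/integrableP; split; first exact/measurable_EFinP.
  by under eq_integral do rewrite /= ger0_norm ?sqr_ge0//.
have ic : mu.-integrable `[0, x] (EFin \o cst (`|h| ^+ 2)).
  apply: measurable_bounded_integrable => //.
    rewrite [X in (X < _)%E](lebesgue_measure_itv `[0, x])/=.
    by case: ifP => _; rewrite ?ltry.
  by exists (`|h| ^+ 2); split; rewrite ?num_real// => M /ltW hM s _; rewrite /= ger0_norm.
apply: (@le_integrable _ _ _ mu `[0, x] _ _ (fun s => (`|g s| ^+ 2)%:E + (cst (`|h| ^+ 2) s)%:E)%E) => //.
- exact/measurable_EFinP.
- move=> s _; rewrite -EFinD /= lee_fin [leRHS]ger0_norm ?addr_ge0 ?sqr_ge0//.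
  have := sqr_ge0 (`|g s + h|); have := sqr_ge0 (`|g s - h|).
  rewrite sqr_normB sqr_normD => h1 h2.
  have g2 := sqr_ge0 `|g s|; have hh2 := sqr_ge0 `|h|.
  by rewrite ler_norml; apply/andP; split; lra.
- exact: integrableD.
Qed.

(** The step supported on [0, x[ with value h is the test function: the adjoint relation evaluates
    it on one side, the defining property of the integral operator on the other. *)
Let Rintegral_dotp_Phi (h : H) (x : R) : x \in `]0, t[ ->
  \int[mu]_(s in `[0, x]) (dotp (g s) h : R) = \int[mu]_(s in `[0, x]) Phi s h.
Proof.
rewrite in_itv/= => /andP[x0 xt].
have [_ gI] := g_adjoint; have [_ IE] := I_op.
rewrite /Phi -(IE 0 x h phi (lexx 0) x0 phi_continuous) -(gI _ (L2_step x h)).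
rewrite -Rintegral_itv_bndo_bndc; last first.
  apply: integrableS (integrable_dotp h x) => //.
  by move=> s /=; rewrite !in_itv/= => /andP[-> /ltW].
rewrite /L2_dotp.
have -> : \int[mu]_(s in `[0, +oo[) (dotp (g s) (step `[0, x[ h s) : R) =
    \int[mu]_(s in `[0, +oo[) ((fun s => dotp (g s) h : R) \_ `[0, x[) s.
  apply: eq_Rintegral => s _; rewrite /step patchE indicE dotpZr.
  by case: (_ \in _); rewrite ?mul1r ?mul0r.
rewrite -Rintegral_mkcondr; congr Rintegral; apply/esym/setIidPr.
by move=> s /=; rewrite !in_itv/= andbT => /andP[].
Qed.

Let adjointE_at (h : H) : {ae mu, forall s, s \in `]0, t[ -> (dotp (g s) h : R) = Phi s h}.
Proof.
(* Truncation makes the difference integrable on the whole line without changing it on the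
   interval. *)
pose G : R -> R := (fun s => dotp (g s) h : R) \_ `[0, t].
pose F s := G s - Phi s h.
have iG : mu.-integrable setT (EFin \o G).
  rewrite -restrict_EFin.
  exact: ((@integrable_mkcond _ _ _ mu _ _ (measurable_itv `[0, t])).1 (integrable_dotp h t)).
have iF : mu.-integrable setT (EFin \o F).
  rewrite (_ : EFin \o F = (EFin \o G) \- (EFin \o Phi ^~ h))%E//.
  by apply: integrableB => //; exact: integrable_Phi.
have F0 x : x \in `]0, t[ -> \int[mu]_(s in `[0, x]) F s = 0.
  move=> xt; rewrite RintegralB//; last 2 first.
  - exact: integrableS iG.
  - exact: integrableS (integrable_Phi h).
  rewrite -(Rintegral_dotp_Phi h xt); apply/eqP; rewrite subr_eq0; apply/eqP.
  apply: eq_Rintegral => s; rewrite inE /= in_itv/= => /andP[s0 sx].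
  rewrite /G patchE mem_set//= in_itv/= s0 (le_trans sx)//.
  by move: xt; rewrite in_itv/= => /andP[_ /ltW].
have := ae_eq0_of_integral_itv iF F0.
apply: (@filterS _ _ (ae_filter_ringOfSetsType mu)) => s Fs st.
apply/eqP; rewrite -subr_eq0 -(Fs st) /F /G patchE mem_set//=.
by move: st; rewrite !in_itv/= => /andP[/ltW -> /ltW ->].
Qed.

(** This says g s = B^* S(t - s)^* phi. The exceptional null set of [adjointE_at] depends on h;
    countably many dense vectors give a single one, and both sides are continuous in h. *)
Lemma adjointE : {ae mu, forall s, s \in `]0, t[ -> forall h,
  (dotp (g s) h : R) = phi (S (t - s) (B h))}.
Proof.
have ae_n n := adjointE_at (e n).
have : {ae mu, forall s, forall n, s \in `]0, t[ -> (dotp (g s) (e n) : R) = Phi s (e n)}.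
  exact: ae_foralln.
apply: (@filterS _ _ (ae_filter_ringOfSetsType mu)) => s gs st h.
have [cS _ _ _] := S_semigroup.
have st' : 0 <= s <= t by move: st; rewrite in_itv/= => /andP[/ltW -> /ltW ->].
have ts0 : 0 <= t - s by rewrite subr_ge0; case/andP: st'.
pose Q (h : H) : R^o := dotp (g s) h - phi (S (t - s) (B h)).
have cQ : continuous Q.
  move=> u; apply: cvgB.
    apply: (@continuous_comp _ _ _ (fun u => (g s, u)) (fun p => dotp p.1 p.2 : R^o)).
      by apply: cvg_pair; [exact: cvg_cst|exact: cvg_id].
    exact: dotp_continuous.
  apply: (@continuous_comp _ _ _ (fun u => S (t - s) (B u)) phi); last exact: phi_continuous.
  apply: (@continuous_comp _ _ _ B (S (t - s))); first exact: B_continuous.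
  exact: (cS _ ts0).
have clQ : closed [set h | Q h = 0].
  by apply: (@closed_comp _ _ Q [set (0 : R^o)]) => //; exact: closed_eq.
have eQ : range e `<=` [set h | Q h = 0].
  move=> _ [n _ <-] /=; rewrite /Q gs//.
  by rewrite /Phi extend0_in// subrr.
apply/eqP; rewrite -subr_eq0; apply/eqP.
have : closure [set h | Q h = 0] h by apply: (closureS eQ); exact: e_dense.
by rewrite -(closure_id _).1.
Qed.

End adjoint.

Lemma integrable_ae_bounded (R : realType) (t : R) (b : R -> R) (L : R) :
  measurable_fun `]0, t[ (b : measurableTypeR R -> R) -> 0 <= L ->
  {ae @lebesgue_measure R, forall s, s \in `]0, t[ -> `|b s| <= L} ->
  (@lebesgue_measure R).-integrable `]0, t[ (EFin \o b).
Proof.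
move=> mb L0 bL; apply/integrableP; split; first exact/measurable_EFinP.
apply: (@le_lt_trans _ _ (\int[@lebesgue_measure R]_(s in `]0%R, t[) (cst L%:E s))%E).
  apply: ae_ge0_le_integral => //.
  by apply: measurableT_comp => //; exact/measurable_EFinP.
rewrite integral_cst//= lebesgue_measure_itv/=; case: ifP => _; rewrite ?mule0 ?ltry//.
Qed.

Section steering.
Context (R : realType) (H : hilbertType R) (E : completeNormedModType R).
Context (t : R) (S : R -> {linear E -> E}) (B : {linear H -> E}) (xi : E).
Context (I : (R -> H) -> E) (e : nat -> H) (b : R -> R) (L : R).
Local Notation mu := (@lebesgue_measure R).
Hypothesis S_semigroup : C0_semigroup S.
Hypothesis B_continuous : continuous B.
Hypothesis e_dense : forall h, closure (range e) h.
Hypothesis SB_int : stochastically_integrable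
  (extend0 t (fun s => (S s \o B : {linear H -> E}))).
Hypothesis I_op : integral_operator
  (extend0 t (fun s => (S (t - s) \o B : {linear H -> E}))) I.
Hypothesis I_adjoint : forall phi : {linear E -> R^o}, continuous phi ->
  exists g, L2_adjoint_at I phi g.
Hypothesis xi_admissible : admissible_direction S B t xi.
Hypothesis b_meas : measurable_fun `]0, t[ (b : measurableTypeR R -> R).
Hypothesis L0 : 0 <= L.
Hypothesis b_le : {ae mu, forall s, s \in `]0, t[ -> `|b s| <= L}.
Hypothesis b_int : \int[mu]_(s in `]0, t[) b s = 1.

Let v := control t (preimage_path S B xi) b.

Let k_open (U : set H) : open U ->
  measurable (`]0, t[ `&` preimage_path S B xi @^-1` U).
Proof. by move=> oU; exact: (measurable_preimage_path_open t xi S_semigroup B_continuous e_dense oU). Qed.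

Let L2_v : L2 v.
Proof. apply: (L2_control e_dense k_open _ b_meas L0 b_le); exact: xi_admissible.2. Qed.

(** The control is not a step, so [I v] is reached through an adjoint element g. The integrand dotp
    (g s) (v s) is then b s * phi (S t xi), where only b depends on s. *)
Let steering_dual (phi : {linear E -> R^o}) : continuous phi -> phi (I v) = phi (S t xi).
Proof.
move=> cphi; have [g gI] := I_adjoint cphi.
rewrite -(gI.2 _ L2_v) /L2_dotp (@Rintegral_restrict_itv _ t); last first.
  by move=> s /negbTE nst; rewrite /v /control nst -(scale0r 0) dotpZr mul0r.
(* Two Borel maps into the separable space H form a jointly measurable pair, on which the inner
   product is continuous. *)
have mgv : measurable_fun `]0, t[ (fun s : measurableTypeR R => dotp (g s) (v s) : R).
  have m1 U : open U -> measurable (`]0, t[ `&` g @^-1` U).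
    move=> oU; have [[mg _] _] := gI.
    have := mg (measurable_itv _) _ (open_borel oU).
    move=> mU; rewrite (_ : _ `&` _ = `]0, t[ `&` (`[0, +oo[ `&` g @^-1` U)).
      exact: measurableI.
    apply/seteqP; split=> s /= [st]; last by move=> [].
    by split=> //; split=> //; move: st; rewrite !in_itv/= andbT => /andP[/ltW].
  have m2 U : open U -> measurable (`]0, t[ `&` v @^-1` U).
    move=> oU; have := measurable_control_open e_dense k_open b_meas oU.
    move=> mU; rewrite (_ : _ `&` _ = `]0, t[ `&` (`[0, +oo[ `&` v @^-1` U)).
      exact: measurableI.
    apply/seteqP; split=> s /= [st]; last by move=> [].
    by split=> //; split=> //; move: st; rewrite !in_itv/= andbT => /andP[/ltW].
  apply: (measurability (@RGenOInfty.G R)); first exact: RGenOInfty.measurableE.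
  move=> _ [_ [x ->] <-].
  have oO : open [set p : H * H | (dotp p.1 p.2 : R) \in `]x, +oo[].
    apply: (@open_comp _ _ (fun p : H * H => dotp p.1 p.2 : R^o) `]x, +oo[) => //.
    by move=> p _; exact: dotp_continuous.
  have mO := measurable_pair_open m1 m2 (fun s _ => @e_dense (g s)) (fun s _ => @e_dense (v s)) oO.
  exact: mO.
have mb : measurable_fun `]0, t[ (fun s : measurableTypeR R => b s * phi (S t xi) : R).
  exact: measurable_funM.
have [_ _ SD _] := S_semigroup.
transitivity (\int[mu]_(s in `]0, t[) (b s * phi (S t xi) : R)).
  rewrite /Rintegral; congr fine; apply: ae_eq_integral => //.
  - exact/measurable_EFinP.
  - exact/measurable_EFinP.
  have := adjointE S_semigroup B_continuous e_dense SB_int I_op cphi gI.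
  apply: (@filterS2 _ _ (ae_filter_ringOfSetsType mu) _ _ _ _ xi_admissible.1) => s Bs gs st.
  have st' : s \in `]0, t[ by [].
  have /andP[s0 st1] : 0 < s < t by move: st'; rewrite in_itv.
  congr EFin; rewrite /v /control st' dotpZr gs//.
  rewrite (preimage_pathP B_continuous (Bs st')).1.
  have := SD (t - s) s; rewrite subr_ge0 subrK => -> //; exact: ltW.
rewrite RintegralZr//; last exact: (integrable_ae_bounded b_meas L0 b_le).
by rewrite b_int mul1r.
Qed.

(** A functional norming the difference of the two sides vanishes on it. *)
Lemma steering : I (control t (preimage_path S B xi) b) = S t xi.
Proof.
have [phi [cphi _ phiE]] := norming_functional (I v - S t xi).
apply/eqP; rewrite -subr_eq0 -normr_eq0 -phiE linearB steering_dual// subrr.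
by [].
Qed.

End steering.

(** * Integral of a weak derivative *)

Lemma continuous_maxr0 (R : realType) : continuous (fun x : R => Num.max 0 x : R).
Proof. by move=> x; apply: continuous_max; [exact: cvg_cst|exact: cvg_id]. Qed.

Lemma is_derive_maxr0_sqr (R : realType) (u : R) :
  is_derive u 1 (fun x : R => Num.max 0 x ^+ 2) (2 * Num.max 0 u).
Proof.
have [u0|] := boolP (u < 0).
  rewrite (max_l (ltW u0)) mulr0.
  apply: (@near_eq_is_derive R R^o R^o (cst (0 : R^o))).
  near=> x; rewrite max_l ?expr0n//; near: x.
  by apply: filterS (lt_nbhsl u0) => x /ltW.
rewrite -leNgt le_eqVlt => /predU1P[<-|u0].
  (* At the corner the difference quotient is max (0, h) itself, which tends to 0. *)
  have c0 : h^-1 *: ((Num.max 0 ((h *: (1 : R^o) + 0 : R^o) : R) ^+ 2 : R^o)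
      - Num.max 0 (0 : R) ^+ 2) @[h --> (0 : R)^'] --> (0 : R^o).
    apply: (@cvg_trans _ ((Num.max (0 : R) (h : R) : R) @[h --> (0:R)^'])).
      apply: near_eq_cvg; near=> h.
      have h0 : h != 0 by near: h; exact: nbhs_dnbhs_neq.
      rewrite maxxx expr0n addr0 subr0 /GRing.scale/= mulr1.
      by case: leP => hh; rewrite ?expr0n ?mulr0// expr2 mulKf.
    have := @continuous_maxr0 R 0; rewrite /continuous_at maxxx => cm.
    exact: (cvg_within_filter _ cm).
  by rewrite maxxx mulr0; apply: DeriveDef; [apply/cvg_ex; exists 0|exact: cvg_lim].
rewrite (max_r (ltW u0)).
apply: (@near_eq_is_derive R R^o R^o (fun x => x ^+ 2)).
  near=> x; rewrite max_r//; near: x.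
  by apply: filterS (lt_nbhsr u0) => x /ltW.
by apply: is_derive_eq; rewrite /GRing.scale/=; ring.
Unshelve. all: end_near. Qed.

Section ramp.
Context (R : realType) (p e : R).
Hypothesis e0 : 0 < e.
Local Notation mu := (@lebesgue_measure R).
Local Notation pos x := (Num.max 0 x).

(* The second difference of the truncated square is a C^1 transition from 0 to
   1 on [p, p + 2e]; its derivative [tent] is a hat function of total mass 1. *)
Definition ramp (s : R) : R :=
  (pos (s - p) ^+ 2 - 2 * pos (s - (p + e)) ^+ 2 + pos (s - (p + 2 * e)) ^+ 2)
  / (2 * e ^+ 2).

Definition tent (s : R) : R :=
  (pos (s - p) - 2 * pos (s - (p + e)) + pos (s - (p + 2 * e))) / e ^+ 2.

Lemma is_derive_ramp (s : R) : is_derive s 1 ramp (tent s).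
Proof.
have d q : is_derive s 1 (fun x : R => pos (x - q) ^+ 2) (2 * pos (s - q)).
  have dq : is_derive s 1 (fun x : R => x - q) 1.
    by apply: is_derive_eq; rewrite subr0.
  rewrite -[2 * _]mulr1.
  apply: (@is_derive1_comp _ (fun y => pos y ^+ 2) (fun x => x - q)).
  exact: is_derive_maxr0_sqr.
have := d p; have := d (p + e); have := d (p + 2 * e).
move=> d1 d2 d3.
rewrite /ramp; apply: is_derive_eq; rewrite /GRing.scale/= /tent.
field; exact: lt0r_neq0.
Qed.

Lemma continuous_tent : continuous tent.
Proof.
have c q : continuous (fun s : R => pos (s - q) : R^o).
  move=> s; apply: (@continuous_comp _ _ _ (fun s => s - q) (fun x => pos x)).
    by apply: cvgB; [exact: cvg_id|exact: cvg_cst].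
  exact: continuous_maxr0.
move=> s; apply: (@cvgMl _ R^o); apply: cvgD; last exact: c.
apply: cvgB; first exact: c.
by apply: cvgM; [exact: cvg_cst|exact: c].
Qed.

Lemma ramp_le (s : R) : s <= p -> ramp s = 0.
Proof.
have h0 := e0; have pos0 (x : R) : x <= 0 -> pos x = 0 by exact: max_l.
by move=> sp; rewrite /ramp !pos0; [ring|lra..].
Qed.

Lemma ramp_ge (s : R) : p + 2 * e <= s -> ramp s = 1.
Proof.
have h0 := e0; have posE (x : R) : 0 <= x -> pos x = x by exact: max_r.
by move=> sp; rewrite /ramp !posE; [field; exact: lt0r_neq0|lra..].
Qed.

Lemma ramp_ge0_le1 (s : R) : 0 <= ramp s <= 1.
Proof.
have h0 := e0; have e2 : 0 < 2 * e ^+ 2 by rewrite mulr_gt0// exprn_gt0.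
rewrite /ramp ler_pdivlMr// ler_pdivrMr// mul0r mul1r.
by case: (leP 0 (s - p)) => h1; case: (leP 0 (s - (p + e))) => h2;
  case: (leP 0 (s - (p + 2 * e))) => h3; apply/andP; split; nra.
Qed.

Lemma tent_ge0 (s : R) : 0 <= tent s.
Proof.
have h0 := e0; rewrite /tent divr_ge0 ?sqr_ge0//.
by case: (leP 0 (s - p)) => h1; case: (leP 0 (s - (p + e))) => h2;
  case: (leP 0 (s - (p + 2 * e))) => h3; lra.
Qed.

Lemma tent_le (s : R) : tent s <= e^-1.
Proof.
have h0 := e0; have e2 : 0 < e ^+ 2 by rewrite exprn_gt0.
rewrite /tent ler_pdivrMr// expr2 mulKf ?lt0r_neq0//.
by case: (leP 0 (s - p)) => h1; case: (leP 0 (s - (p + e))) => h2;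
  case: (leP 0 (s - (p + 2 * e))) => h3; lra.
Qed.

Lemma tent_out (s : R) : s \notin `[p, p + 2 * e] -> tent s = 0.
Proof.
have h0 := e0; have pos0 (x : R) : x <= 0 -> pos x = 0 by exact: max_l.
have posE (x : R) : 0 <= x -> pos x = x by exact: max_r.
rewrite in_itv/= negb_and -!ltNge /tent => /orP[sp|sp].
  by rewrite !pos0; [ring|lra..].
by rewrite !posE; [ring|lra..].
Qed.

Lemma integral_tent (t : R) : 0 <= p -> p + 2 * e <= t ->
  \int[mu]_(s in `]0, t[) tent s = 1.
Proof.
have h0 := e0; move=> p0 pt; have t0 : 0 < t by lra.
have ct : {within `[0, t], continuous tent}.
  by apply: continuous_subspaceT; exact: continuous_tent.
have iT : mu.-integrable `[0, t] (EFin \o tent).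
  by apply: continuous_compact_integrable => //; exact: segment_compact.
have cr : continuous ramp.
  by move=> s; apply: differentiable_continuous; apply/derivable1_diffP; have [] := is_derive_ramp s.
rewrite Rintegral_itv_obnd_cbnd ?Rintegral_itv_bndo_bndc; last 2 first.
- by apply: integrableS iT => // s; rewrite /= !in_itv/= => /andP[? ?]; apply/andP; split; lra.
- by apply: integrableS iT => // s; rewrite /= !in_itv/= => /andP[? ?]; apply/andP; split; lra.
rewrite /Rintegral (@continuous_FTC2 _ _ ramp)//.
- by rewrite (ramp_le p0) ramp_ge//= subr0.
- split=> [s _| |]; first by have [] := is_derive_ramp s.
    by apply: cvg_at_right_filter; exact: cr.
  by apply: cvg_at_left_filter; exact: cr.
- by move=> s _; rewrite derive1E; apply: derive_val; exact: is_derive_ramp.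
Qed.

End ramp.

Section interval_integral.
Context (R : realType) (t : R).
Local Notation mu := (@lebesgue_measure R).
Implicit Types f g : R -> R.

Lemma ae_norm_Rintegral_le f g :
  measurable_fun `]0, t[ (f : measurableTypeR R -> R) ->
  mu.-integrable `]0, t[ (EFin \o g) ->
  {ae mu, forall s, s \in `]0, t[ -> `|f s| <= g s} ->
  `|\int[mu]_(s in `]0, t[) f s| <= \int[mu]_(s in `]0, t[) g s.
Proof.
move=> mf ig fg.
have mfE : measurable_fun `]0, t[ (fun s : measurableTypeR R => (f s)%:E).
  exact/measurable_EFinP.
have [mg goo] := integrableP _ _ _ ig.
have mng : measurable_fun `]0, t[ (fun s : measurableTypeR R => `|(g s)%:E|)%E.
  exact: measurableT_comp.
have mnf : measurable_fun `]0, t[ (fun s : measurableTypeR R => `|(f s)%:E|)%E.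
  exact: measurableT_comp.
have le1 : (\int[mu]_(s in `]0%R, t[) `|(f s)%:E| <= \int[mu]_(s in `]0%R, t[) `|(g s)%:E|)%E.
  apply: ae_ge0_le_integral => //.
  apply: (@filterS _ _ (ae_filter_ringOfSetsType mu) _ _ _ fg) => s fgs st.
  by rewrite lee_fin (le_trans (fgs st))// ler_norm.
have intf : mu.-integrable `]0, t[ (EFin \o f).
  by apply/integrableP; split => //; exact: le_lt_trans le1 goo.
rewrite (le_trans (le_normr_Rintegral _ intf))//.
have gE : \int[mu]_(s in `]0, t[) g s = \int[mu]_(s in `]0, t[) `|g s|.
  rewrite /Rintegral; congr fine; apply: ae_eq_integral => //.
  apply: (@filterS _ _ (ae_filter_ringOfSetsType mu) _ _ _ fg) => s fgs st.
  by rewrite ger0_norm// (le_trans _ (fgs st)).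
rewrite gE /Rintegral fine_le//.
- by rewrite ge0_fin_numE ?integral_ge0//; exact: le_lt_trans le1 goo.
- by rewrite ge0_fin_numE ?integral_ge0.
Qed.

Lemma measurable_tent p e (D : set R) :
  measurable_fun D (tent p e : measurableTypeR R -> R).
Proof.
apply: measurable_funTS.
exact: (continuous_measurable_fun (@continuous_tent R p e)).
Qed.

(** The tent is a probability density carried by [p, p + 2e], so a function within eps of l there
    has weighted mean within eps of l. *)
Lemma tent_mean (p e : R) (f : R -> R) (l eps K : R) :
  0 < e -> 0 <= p -> p + 2 * e <= t -> 0 <= eps -> 0 <= K ->
  measurable_fun `]0, t[ (f : measurableTypeR R -> R) ->
  {ae mu, forall s, s \in `]0, t[ -> `|f s| <= K} ->
  {ae mu, forall s, s \in `]0, t[ -> s \in `[p, p + 2 * e] -> `|f s - l| <= eps} ->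
  mu.-integrable `]0, t[ (fun s => (f s * tent p e s)%:E) /\
  `|\int[mu]_(s in `]0, t[) (f s * tent p e s) - l| <= eps.
Proof.
move=> e0 p0 pt eps0 K0 mf fK fl.
have ei0 : 0 <= e^-1 by rewrite invr_ge0 ltW.
have mT := @measurable_tent p e.
have Tb s : `|tent p e s| <= e^-1 by rewrite ger0_norm ?tent_ge0 ?tent_le.
have iT : mu.-integrable `]0, t[ (EFin \o tent p e).
  by apply: (integrable_ae_bounded (mT _) ei0); apply: aeW => s _; exact: Tb.
have ifT : mu.-integrable `]0, t[ (EFin \o (fun s => f s * tent p e s)).
  apply: (@integrable_ae_bounded _ _ _ (K * e^-1)).
  - exact: measurable_funM.
  - exact: mulr_ge0.
  apply: (@filterS _ _ (ae_filter_ringOfSetsType mu) _ _ _ fK) => s fs st.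
  by rewrite normrM ler_pM// fs.
split=> //.
have -> : l = \int[mu]_(s in `]0, t[) (l * tent p e s).
  by rewrite RintegralZl// integral_tent// mulr1.
rewrite -RintegralB//; last first.
  by apply: (integrableZl _ l iT).
have -> : eps = \int[mu]_(s in `]0, t[) (eps * tent p e s).
  by rewrite RintegralZl// integral_tent// mulr1.
apply: ae_norm_Rintegral_le.
- by apply: measurable_funB; apply: measurable_funM.
- exact: (integrableZl _ eps iT).
apply: (@filterS _ _ (ae_filter_ringOfSetsType mu) _ _ _ fl) => s fs st.
rewrite -mulrBl normrM (ger0_norm (tent_ge0 _ _ _))//.
have [sp|sp] := boolP (s \in `[p, p + 2 * e]).
  by rewrite ler_wpM2r ?tent_ge0// fs.
by rewrite tent_out// !mulr0.
Qed.

End interval_integral.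

Lemma Rintegral_endpoints (R : realType) (c t : R) : 0 <= c -> c <= t ->
  (@lebesgue_measure R).-integrable `]0, t[
    (EFin \o (\1_(`[0, c] `|` `[t - c, t] : set R) : R -> R)) /\
  \int[@lebesgue_measure R]_(s in `]0, t[) (\1_(`[0, c] `|` `[t - c, t] : set R) s : R)
    <= 2 * c.
Proof.
move=> c0 ct; set mu := @lebesgue_measure R; set A := (X in \1_X).
have mA : measurable A by exact: measurableU.
have muA : (mu (A `&` `]0%R, t[) <= (2 * c)%:E)%E.
  apply: (@le_trans _ _ (mu A)).
    by apply: le_measure; rewrite ?inE//; exact: measurableI.
  have m1 : mu `[0%R, c]%classic = c%:E.
    rewrite /mu lebesgue_measure_itv/= lte_fin; case: ltP => h; rewrite ?sube0//.
    by congr EFin; apply/eqP; rewrite eq_le c0 h.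
  have m2 : mu `[t - c, t]%classic = c%:E.
    rewrite /mu lebesgue_measure_itv/= lte_fin; case: ltP => h.
      by rewrite -EFinB; congr EFin; ring.
    by congr EFin; apply/eqP; rewrite eq_le c0/=; lra.
  have := measureU2 mu (measurable_itv `[0, c]) (measurable_itv `[t - c, t]).
  move=> /le_trans; apply.
  by rewrite [X in (X + _ <= _)%E]m1 [X in (_ + X <= _)%E]m2 -EFinD lee_fin; lra.
have iE : (\int[mu]_(s in `]0%R, t[) (\1_A s)%:E = mu (A `&` `]0%R, t[))%E.
  exact: integral_indic.
have muAoo : (mu (A `&` `]0%R, t[) < +oo)%E by rewrite (le_lt_trans muA)// ltry.
split.
  apply/integrableP; split; first exact/measurable_EFinP/measurable_indic.
  by under eq_integral do rewrite /= ger0_norm//; rewrite iE.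
by rewrite -lee_fin /Rintegral fineK ?iE// ge0_fin_numE.
Qed.

(** The test function is a plateau rising near 0 and falling near t, whose derivative is a
    difference of two tents. The weak formula then equates - int b phi with the mean of a near 0
    minus its mean near t, and both sides are compared with their limits. *)
Lemma sobolev_integral (R : realType) (t : R) (a b : R -> R) (l r : R) :
  0 < t -> sobolev1oo t a b -> boundary_values t a l r ->
  \int[@lebesgue_measure R]_(s in `]0, t[) b s = r - l.
Proof.
move=> t0 [[ma aoo] [mb boo] weak] [abar [aE _ al ar]].
set mu := @lebesgue_measure R.
have [K0 aK] := Linfty_bound t0 aoo; have [L0 bL] := Linfty_bound t0 boo.
move: K0 aK L0 bL; set K := fine (Linfty_norm t a); set L := fine (Linfty_norm t b).
move=> K0 aK L0 bL.
have ib := integrable_ae_bounded mb L0 bL.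
suff key eps : 0 < eps -> `|\int[mu]_(s in `]0, t[) b s - (r - l)| <= (2 + 6 * L) * eps.
  apply/eqP; rewrite -subr_eq0 -normr_le0; apply/ler_addgt0Pr => d d0; rewrite add0r.
  have c0 : 0 < 2 + 6 * L by lra.
  by rewrite (le_trans (key (d / (2 + 6 * L)) _)) ?divr_gt0// mulrC divfK// lt0r_neq0.
move=> eps0.
have [d1 /= d10 al1] : \forall s \near 0^'+, `|l - abar s| <= eps by move/cvgrPdist_le : al; exact.
have [d2 /= d20 ar1] : \forall s \near t^'-, `|r - abar s| <= eps by move/cvgrPdist_le : ar; exact.
(* The ramps occupy [e, 3e] and [t - 3e, t - e]: e <= d / 4 keeps each within the zone where the
   representative of a is near its limit, and e <= t / 8 keeps them disjoint. *)
pose e := Num.min (Num.min (d1 / 4) (d2 / 4)) (Num.min (t / 8) eps).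
have [e0 [ed1 [ed2 [et eeps]]]] : 0 < e /\ e <= d1 / 4 /\ e <= d2 / 4 /\ e <= t / 8 /\ e <= eps.
  rewrite /e; split; first by rewrite !lt_min eps0 !divr_gt0.
  by rewrite !ge_min !lexx !orbT; split=> //; split=> //; split.
pose q := t - 3 * e.
have q0 : 0 <= q by rewrite /q; lra.
pose phi s : R := ramp e e s - ramp q e s.
have dphi (s : R) : is_derive s 1 phi (tent e e s - tent q e s).
  have := is_derive_ramp e e0 s; have := is_derive_ramp q e0 s => h1 h2.
  exact: is_deriveB.
have phi' : derive1 phi = fun s => tent e e s - tent q e s.
  by apply/funext => s; rewrite derive1E; apply: derive_val.
have phi01 (s : R) : `|1 - phi s| <= 1 /\ (s \in `[3 * e, q] -> phi s = 1).
  split; last first.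
    rewrite in_itv/= => /andP[s3 sq].
    rewrite /phi ramp_ge ?(@ramp_le _ q)//; first by rewrite subr0.
    by rewrite (le_trans _ s3)//; lra.
  have [sq|sq] := leP s q.
    rewrite /phi (@ramp_le _ q)// subr0.
    have /andP[? ?] := ramp_ge0_le1 e e0 s.
    by rewrite ger0_norm; lra.
  rewrite /phi ramp_ge; [|by []|by move: sq; rewrite /q; lra].
  have /andP[? ?] := ramp_ge0_le1 q e0 s.
  by rewrite opprB addrC subrK ger0_norm.
have test : test_function t phi.
  split.
  - by move=> s; have [] := dphi s.
  - rewrite phi' => s; apply: cvgB; exact: continuous_tent.
  exists e, (t - e); split=> //; first lra.
  move=> s; rewrite in_itv/= negb_and -!ltNge => /orP[se|se].
    have seq : s <= q by rewrite /q; lra.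
    by rewrite /phi (ramp_le e0 (ltW se)) (ramp_le e0 seq) subrr.
  have s1 : e + 2 * e <= s by lra.
  have s2 : q + 2 * e <= s by rewrite /q; lra.
  by rewrite /phi !ramp_ge// subrr.
have := weak phi test; rewrite phi'.
have al_ae : {ae mu, forall s, s \in `]0, t[ -> s \in `[e, e + 2 * e] -> `|a s - l| <= eps}.
  apply: (@filterS _ _ (ae_filter_ringOfSetsType mu) _ _ _ aE) => s as_ st.
  rewrite in_itv/= => /andP[s1 s2]; rewrite as_// distrC; apply: al1.
    by rewrite /ball_/= sub0r normrN ger0_norm; lra.
  by move: st; rewrite in_itv/= => /andP[].
have ar_ae : {ae mu, forall s, s \in `]0, t[ -> s \in `[q, q + 2 * e] -> `|a s - r| <= eps}.
  apply: (@filterS _ _ (ae_filter_ringOfSetsType mu) _ _ _ aE) => s as_ st.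
  rewrite in_itv/= /q => /andP[s1 s2]; rewrite as_// distrC; apply: ar1.
    have st' : s < t by move: st; rewrite in_itv/= => /andP[].
    by rewrite /ball_/= ger0_norm; lra.
  by move: st; rewrite in_itv/= => /andP[].
have pt1 : e + 2 * e <= t by lra.
have pt2 : q + 2 * e <= t by rewrite /q; lra.
have [ia1 a1] := tent_mean e0 (ltW e0) pt1 (ltW eps0) K0 ma aK al_ae.
have [ia2 a2] := tent_mean e0 q0 pt2 (ltW eps0) K0 ma aK ar_ae.
under eq_Rintegral do rewrite mulrBr.
rewrite RintegralB// => weakE.
have mphi : measurable_fun `]0, t[ (phi : measurableTypeR R -> R).
  apply: measurable_funTS; apply: continuous_measurable_fun => s.
  by apply: differentiable_continuous; apply/derivable1_diffP; have [] := dphi s.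
have ibphi : mu.-integrable `]0, t[ (EFin \o (fun s => b s * phi s)).
  apply: (@integrable_ae_bounded _ _ _ (L * 2)).
  - exact: measurable_funM.
  - exact: mulr_ge0.
  apply: (@filterS _ _ (ae_filter_ringOfSetsType mu) _ _ _ bL) => s bs st.
  rewrite normrM ler_pM// ?bs//; have [h _] := phi01 s.
  have -> : phi s = 1 - (1 - phi s) by ring.
  by rewrite (le_trans (ler_normB _ _))// normr1; lra.
(* The plateau differs from 1 only on two end segments of length 3e, by at most 1, while b is
   bounded by L. *)
have bphi : `|\int[mu]_(s in `]0, t[) b s - \int[mu]_(s in `]0, t[) (b s * phi s)| <= 6 * L * e.
  rewrite -RintegralB//.
  have e3 : 0 < 3 * e by lra.
  have e3t : 3 * e <= t by lra.
  pose A : set R := `[0, 3 * e] `|` `[q, t].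
  have [iA intA] := Rintegral_endpoints (ltW e3) (e3t : 3 * e <= t).
  apply: (@le_trans _ _ (\int[mu]_(s in `]0, t[) (L * \1_A s))).
    apply: ae_norm_Rintegral_le.
    - by apply: measurable_funB => //; exact: measurable_funM.
    - exact: (integrableZl _ L iA).
    apply: (@filterS _ _ (ae_filter_ringOfSetsType mu) _ _ _ bL) => s bs st.
    have -> : b s - b s * phi s = b s * (1 - phi s) by ring.
    have [h1 h2] := phi01 s; rewrite normrM ler_pM// ?bs// indicE.
    have [|sA] := boolP (s \in A); first by [].
    rewrite h2 ?subrr ?normr0//.
    have /andP[s0 st'] : 0 < s < t by move: st; rewrite in_itv.
    rewrite in_itv/=; apply: contraR sA; rewrite negb_and -!ltNge => /orP[?|?]; apply: mem_set.
      by left; rewrite /= in_itv/= !ltW.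
    by right; rewrite /= in_itv/= !ltW.
  rewrite RintegralZl// (mulrC 6) -mulrA ler_wpM2l// (le_trans intA)//; lra.
have gen (I1 I2 I3 I4 : R) : `|I1 - l| <= eps -> `|I2 - r| <= eps ->
    `|I3 - I4| <= 6 * L * e -> I1 - I2 = - I4 -> `|I3 - (r - l)| <= (2 + 6 * L) * eps.
  move=> h1 h2 h3 h4.
  have -> : I3 - (r - l) = (I3 - I4) + (I2 - r) - (I1 - l).
    by rewrite -[I4]opprK -h4; ring.
  rewrite (le_trans (ler_normB _ _))// (le_trans (lerD (ler_normD _ _) (lexx _)))//.
  rewrite (le_trans (lerD (lerD h3 h2) h1))//.
  have : L * e <= L * eps by rewrite ler_wpM2l.
  lra.
exact: gen a1 a2 bphi weakE.
Qed.

(** * The gradient estimate *)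

Theorem corollary5p4 (R : realType) (E : completeNormedModType R)
    (H : hilbertType R) (H_separable : separable H)
    (S : R -> {linear E -> E}) (S_semigroup : C0_semigroup S)
    (B : {linear H -> E}) (B_continuous : continuous B)
    (d : measure_display) (Omega : measurableType d) (P : probability Omega R)
    (WH : R -> H -> Omega -> R) (WH_BM : cylindrical_brownian_motion P WH)
    (W : (R -> H) -> Omega -> R) (W_WH : isonormal_extension P WH W)
    (SB_integrable : forall T : R, 0 < T ->
      stochastically_integrable
        (extend0 T (fun s => (S s \o B : {linear H -> E}))))
    (t : R) (t_gt0 : 0 < t)
    (WA : Omega -> E) (WA_conv : stochastic_convolution P S B W t WA)
    (x xi : E) (xi_admissible : admissible_direction S B t xi)
    (f : E -> R) (f_borel : measurable_fun setT (f : borel E -> R))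
    (f_bounded : bounded_fun f) :
  derivable (transition P S WA t f) x xi /\
  (forall a a' : R -> R, sobolev1oo t a a' -> boundary_values t a 0 1 ->
    `|'D_xi (transition P S WA t f) x| <=
      Num.sqrt (2 / pi) * sup_norm f * fine (Linfty_norm t a') *
      Num.sqrt (admissible_energy S B t xi)) /\
  `|'D_xi (transition P S WA t f) x| <=
    Num.sqrt (2 / pi) / t * sup_norm f *
    Num.sqrt (admissible_energy S B t xi).
Proof.
have [A cA dA] := H_separable; have [e eA] := countable_range cA.
have e_dense (h : H) : closure (range e) h.
  by move=> U; rewrite nbhsE => -[V [oV Vh] VU]; have [|k [Vk Ak]] := dA V _ oV;
    [exists h|exists k; split; [exact: eA|exact: VU]].
have [I I_op WA_gauss] := WA_conv.
have I_adjoint (phi : {linear E -> R^o}) : continuous phi -> exists g, L2_adjoint_at I phi g.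
  by move=> /WA_gauss.2[_ [g gI _]]; exists g.
have f_sup y : `|f y| <= sup_norm f.
  apply: ub_le_sup; last by exists y.
  (* [bounded_fun] gives the bound for every number strictly above M, hence M + 1. *)
  have [M [_ fM]] := f_bounded; exists (M + 1) => _ [z _ <-].
  by apply: fM => //; rewrite ltrDl.
have main (b : R -> R) (L : R) :
    measurable_fun `]0, t[ (b : measurableTypeR R -> R) -> 0 <= L ->
    {ae @lebesgue_measure R, forall s, s \in `]0, t[ -> `|b s| <= L} ->
    \int[@lebesgue_measure R]_(s in `]0, t[) b s = 1 ->
    exists2 D, is_derive x xi (transition P S WA t f) D &
      `|D| <= Num.sqrt (2 / pi) * sup_norm f * L * Num.sqrt (admissible_energy S B t xi).
  move=> mb L0 bL b1.
  have k_open (U : set H) (oU : open U) :=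
    measurable_preimage_path_open t xi S_semigroup B_continuous e_dense oU.
  have vL2 := L2_control e_dense k_open xi_admissible.2 mb L0 bL.
  have vE := steering S_semigroup B_continuous e_dense (SB_integrable t t_gt0) I_op
    I_adjoint xi_admissible mb L0 bL b1.
  have [D dD Dle] := transition_derivative W_WH.1 I_op.1.1 WA_gauss f_borel f_sup x vL2 vE.
  exists D => //; rewrite (le_trans Dle)// -[leRHS]mulrA ler_wpM2l//.
    by rewrite mulr_ge0 ?sqrtr_ge0// (le_trans _ (f_sup 0)).
  exact: (L2_norm_control e_dense k_open xi_admissible.2 mb L0 bL).
(* The constant weight settles differentiability independently of any a. For a given a, the number
   produced by [main] is another derivative at the same point, hence the same one. *)
have [] := main (cst t^-1) t^-1.
- exact: measurable_cst.
- by rewrite invr_ge0 ltW.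
- by apply: aeW => s _; rewrite /= ger0_norm// invr_ge0 ltW.
- have mut : @lebesgue_measure R `]0, t[%classic = t%:E.
    by rewrite lebesgue_measure_itv/= lte_fin t_gt0 sube0.
  by rewrite Rintegral_cst// [X in fine X]mut mulVf// lt0r_neq0.
move=> D dD Dle; split; first by have [] := dD.
split; last by rewrite derive_val [_ / t * _]mulrAC.
move=> a a' aa' a01; have [_ [ma' a'oo] _] := aa'.
have [a'0 a'L] := Linfty_bound t_gt0 a'oo.
have [|D' dD' D'le] := main a' _ ma' a'0 a'L; first by rewrite (sobolev_integral t_gt0 aa' a01) subr0.
by rewrite derive_val.
Qed.
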